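(* Let $K$ be a Galois number field of degree $d = [K:\mathbb{Q}]$ and let $\Lambda_K = \Sigma_K(\mathcal{O}_K) \subset \mathbb{C}^d$ be the lattice coming from its ring of integers $\mathcal{O}_K$. Then, for an appropriate ordering of the embeddings of $K$, $\Lambda_K$ is cyclic in $\mathbb{C}^d$ if and only if $K/\mathbb{Q}$ is a cyclic extension. Further, when $K/\mathbb{Q}$ is a cyclic extension, $\Lambda_K$ is simple cyclic (for an appropriate ordering of the embeddings) if and only if $K/\mathbb{Q}$ is tamely ramified. In particular, for an integer $n \geq 2$ and $\zeta_n = e^{2\pi i/n}$, the cyclotomic lattice $\Lambda_{\mathbb{Q}(\zeta_n)}$ is cyclic (for an appropriate ordering of the embeddings) if and only if $n = 2$, $n = 4$, $n = p^k$ or $n = 2p^k$ for an odd prime $p$ and an integer $k \geq 1$, and it is simple cyclic (for an appropriate ordering of the embeddings) if and only if $n = 2$, $n = p$ or $n = 2p$ for an odd prime $p$.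
   Context: For a number field $K$ of degree $d$ with the $d$ distinct embeddings $\sigma_1, \dots, \sigma_d : K \hookrightarrow \mathbb{C}$ listed in some order, $\Sigma_K = (\sigma_1, \dots, \sigma_d) : K \to \mathbb{C}^d$ is the corresponding embedding (its image lies in $K_{\mathbb{R}} = K \otimes_{\mathbb{Q}} \mathbb{R}$, viewed as a $d$-dimensional real subspace of $\mathbb{C}^d$), and $\Lambda_K = \Sigma_K(\mathcal{O}_K)$, a free $\mathbb{Z}$-module of rank $d$. Let $\rho : \mathbb{C}^d \to \mathbb{C}^d$ be the rotation shift $\rho(c_1, c_2, \dots, c_d) = (c_d, c_1, \dots, c_{d-1})$. For a given ordering of the embeddings, $\Lambda_K$ is cyclic if $\rho(\Lambda_K) = \Lambda_K$, and it is simple cyclic if it is cyclic and there exists $\boldsymbol{a} \in \Lambda_K$ such that $\Lambda_K = \operatorname{span}_{\mathbb{Z}}\{\boldsymbol{a}, \rho(\boldsymbol{a}), \dots, \rho^{d-1}(\boldsymbol{a})\}$. ''For an appropriate ordering of the embeddings, $\Lambda_K$ has property P'' means that there exists an ordering of the embeddings for which $\Lambda_K$ has property P. A cyclic extension is a Galois extension with cyclic Galois group. A Galois extension $K/\mathbb{Q}$ is tamely ramified if for every rational prime $p$ the ramification indices of the primes of $K$ above $p$ are relatively prime to $p$. *)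

(* Defs.v *)
From mathcomp Require Import all_boot all_order all_algebra all_fingroup.
From mathcomp Require Import all_solvable all_field.
From mathcomp Require Import complex.
From mathcomp Require boolp.
From mathcomp Require Import classical_sets reals trigo.

Set Implicit Arguments.
Unset Strict Implicit.
Unset Printing Implicit Defensive.

Import Order.TTheory GRing.Theory Num.Theory.

Local Open Scope classical_set_scope.
Local Open Scope ring_scope.

(* A number field is a [fieldExtType rat], which is finite-dimensional over   *)
(* [rat]; its degree is [\dim {:K}]. The complex numbers are [R[i]] for       *)
(* [R : realType].                                                            *)

Section Lattices.
Variables (V : zmodType) (d : nat).
Implicit Types (c : 'rV[V]_d) (L : set 'rV[V]_d).

(* [ord_pred] is i |-> i - 1 mod d, so (c_1, ..., c_d) is sent to             *)
(* (c_d, c_1, ..., c_{d-1}).                                                  *)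
Definition rotation_shift c : 'rV[V]_d := \row_i c 0 (ord_pred i).

Definition int_span (a : 'I_d -> 'rV[V]_d) : set 'rV[V]_d :=
  [set x | exists m : 'I_d -> int, x = \sum_(k < d) a k *~ m k].

Definition cyclic_lattice L : Prop := rotation_shift @` L = L.

Definition simple_cyclic_lattice L : Prop :=
  cyclic_lattice L /\
  exists2 a, L a & L = int_span (fun k : 'I_d => iter k rotation_shift a).

End Lattices.

Section NumberField.
Variable K : fieldExtType rat.

Definition ring_of_integers : set K :=
  [set x | integralOver (intr : int -> K) x].

Definition is_ideal (I : set K) : Prop :=
  [/\ I `<=` ring_of_integers, I 0,
      (forall x y, I x -> I y -> I (x + y)) &
      (forall a x, ring_of_integers a -> I x -> I (a * x))].

Definition is_prime_ideal (P : set K) : Prop :=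
  [/\ is_ideal P, ~ P 1 &
      (forall x y, ring_of_integers x -> ring_of_integers y ->
         P (x * y) -> P x \/ P y)].

Definition ideal_mul (I J : set K) : set K :=
  [set x | exists2 s : seq (K * K),
     (forall u, u \in s -> I u.1 /\ J u.2) & x = \sum_(u <- s) u.1 * u.2].

Definition ideal_exp (I : set K) (e : nat) : set K :=
  iter e (ideal_mul I) ring_of_integers.

Definition ideal_dvd (I J : set K) : Prop :=
  exists2 A, is_ideal A & J = ideal_mul I A.

Definition principal_ideal (x : K) : set K :=
  [set a * x | a in ring_of_integers].

Definition lies_above (P : set K) (p : nat) : Prop :=
  forall m : int, P m%:~R <-> (p %| m)%Z.

(* e is the exponent of P in the prime factorization of p O_K.                *)
Definition is_ramification_index (P : set K) (p e : nat) : Prop :=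
  ideal_dvd (ideal_exp P e) (principal_ideal p%:R) /\
  ~ ideal_dvd (ideal_exp P e.+1) (principal_ideal p%:R).

Definition tamely_ramified : Prop :=
  forall (p : nat) (P : set K) (e : nat),
    prime p -> is_prime_ideal P -> lies_above P p ->
    is_ramification_index P p e -> coprime e p.

Section Embeddings.
Variable R : realType.
Local Notation d := (\dim {:K}).

Definition embedding_ordering (sigma : 'I_d -> {rmorphism K -> R[i]}) : Prop :=
  (forall i j, sigma i =1 sigma j -> i = j) /\
  (forall tau : {rmorphism K -> R[i]}, exists i, sigma i =1 tau).

Definition Sigma (sigma : 'I_d -> {rmorphism K -> R[i]}) (x : K) :
  'rV[R[i]]_d := \row_i sigma i x.

Definition Lambda (sigma : 'I_d -> {rmorphism K -> R[i]}) :
  set 'rV[R[i]]_d := Sigma sigma @` ring_of_integers.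

Definition for_appropriate_ordering (Prp : set 'rV[R[i]]_d -> Prop) : Prop :=
  exists2 sigma, embedding_ordering sigma & Prp (Lambda sigma).

End Embeddings.
End NumberField.

Definition cyclic_extension (K : splittingFieldType rat) : Prop :=
  galois 1%VS {:K} /\ cyclic 'Gal({:K} / 1%VS).

Section Cyclotomic.
Variable R : realType.

(* e^(2 pi i / n)                                                             *)
Definition zeta (n : nat) : R[i] :=
  (cos (2 * pi / n%:R) +i* sin (2 * pi / n%:R))%C.

(* K is isomorphic to the subfield Q(zeta_n) of the complex numbers: some     *)
(* complex embedding of K has image Q(zeta_n).                                *)
Definition is_cyclotomic_field (n : nat) (K : fieldExtType rat) : Prop :=
  exists (iota : {rmorphism K -> R[i]}) (z : K),
    iota z = zeta n /\ <<1; z>>%VS = fullv.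

Lemma zeta_expn n : (0 < n)%N -> zeta n ^+ n = 1.
Proof.
move=> n_gt0; set t := 2 * pi / n%:R : R.
have zetaX m : zeta n ^+ m = (cos (t *+ m) +i* sin (t *+ m))%C.
  elim: m => [|m IHm]; first by rewrite expr0 !mulr0n cos0 sin0.
  rewrite exprSr IHm !mulrSr cosD sinD /zeta -/t.
  by apply/eqP; rewrite eq_complex /= eqxx /= addrC.
have tn : t *+ n = pi *+ 2.
  by rewrite -mulr_natr /t mulfVK ?mulr_natl // pnatr_eq0 -lt0n.
by rewrite zetaX tn cos2pi sin2pi.
Qed.

(* Consistency check: fields satisfying [is_cyclotomic_field n] exist.        *)
Lemma cyclotomic_field_exists n : (0 < n)%N ->
  exists K : fieldExtType rat, is_cyclotomic_field n K.
Proof.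
move=> n_gt0.
pose f : {rmorphism rat -> R[i]} := ratr.
pose isr (q : {poly rat}) := (q != 0) && root (map_poly f q) (zeta n).
have exq : exists m, exists2 q, isr q & size q = m.
  exists (size ('X^n - 1 : {poly rat})), ('X^n - 1) => //.
  rewrite /isr -size_poly_gt0 size_XnsubC //= rmorphB /= rmorph1 map_polyXn.
  by rewrite rootE !hornerE zeta_expn ?subrr.
have [p [/andP[nz_p pz0]] minp] : exists p, isr p /\
    forall q, isr q -> (size p <= size q)%N.
  case: exq => m; elim/ltn_ind: m => m IHm [q isq szq].
  have [[q' [isq' ltq']]|noq] :=
      boolp.EM (exists q', isr q' /\ (size q' < size q)%N).
    by apply: (IHm (size q')); [rewrite -szq | exists q'].
  exists q; split=> // q' isq'; rewrite leqNgt; apply/negP => ltq.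
  by apply: noq; exists q'.
have irr_p : irreducible_poly p.
  apply/(subfx_irreducibleP pz0 nz_p) => q qz0 nz_q.
  by apply: minp; apply/andP.
pose L : fieldExtType rat := SubFieldExtType pz0 irr_p.
pose iota : {rmorphism L -> R[i]} := @subfx_inj _ _ f (zeta n) p.
exists L, iota, (@subfx_root _ _ f (zeta n) p : L); split.
  exact: subfx_inj_root.
apply/vspaceP => x; rewrite memvf.
have [q ->] := subfxEroot pz0 nz_p x.
apply: mempx_Fadjoin; apply/polyOverP => i.
by rewrite coef_map; apply: rpredZ; apply: mem1v.
Qed.

End Cyclotomic.

(* Main.v *)
Require Import Defs.
From HB Require Import structures.
From mathcomp Require Import all_boot all_order all_algebra all_fingroup.
From mathcomp Require Import all_solvable all_field.
From mathcomp Require Import complex.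
From mathcomp Require boolp.
From mathcomp Require Import classical_sets reals trigo.
From mathcomp Require Import zify ring lra.

Set Implicit Arguments.
Unset Strict Implicit.
Unset Printing Implicit Defensive.

Import Order.TTheory GRing.Theory Num.Theory.
Local Open Scope ring_scope.

(** Let K be a Galois number field with group G, and fix one embedding of K; the
    others are its composites with the elements of G. If the rotation preserves
    Lambda_K, comparing one coordinate shows that it acts on integers as some c in
    G, and c generates G because rotating reaches every embedding. Conversely,
    listing the embeddings along the powers of a generator turns the rotation into
    the action of that generator. So Lambda_K is cyclic for some ordering exactly
    when G is cyclic ([cyclic_latticeP]). Under this dictionary the rotations of
    the vector of t are those of its conjugates, and Lambda_K is simple cyclic
    exactly when the conjugates of some t form an integral basis
    ([simple_cyclic_latticeP]).

    It remains to show, for abelian G, that such a normal integral generator t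
    exists exactly when K is tame. If it exists, the coordinates of 1 are all equal,
    so t has trace 1 or -1 ([normal_gen_gal_trace]); but wild ramification at P
    puts the trace of every integer in P ([gal_trace_wild]). For the converse
    ([tame_normal_gen]) K is embedded in a cyclotomic field of squarefree
    conductor n, n being the product of the primes that may ramify. In M =
    K(zeta_n) all inertia groups are tame, and a tame inertia group above p has at
    most p - 1 elements since G is abelian ([inertia_bound]). Hence the inertia
    groups generate a subgroup H of order at most phi(n). The field fixed by H is
    unramified over Q, and an abelian field unramified over Q is Q: otherwise it
    has a subfield of prime degree and discriminant 1 or -1, excluded by
    Stickelberger in degree 2 and by Minkowski's linear forms in odd degree
    ([unram_prime_index]). So M has degree at most phi(n), that is
    M = Q(zeta_n). Since n is squarefree, zeta_n is a normal integral generator of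
    M ([cyclo_basis]), and its relative trace is one for K ([normal_gen_descend]).

    The local theory rests on a valuation at each prime ideal P, defined from an
    element that has a simple pole at P and no other pole ([prime_colon]), and on the
    independence modulo P of the characters of G up to inertia ([dedekind_mod]).
    Ramification indices in the sense of factorization of ideals are the
    valuations of the rational primes ([ramification_indexE]).

    For K = Q(zeta_n) the group G is that of the units modulo n. It is cyclic when
    there is a primitive residue, and otherwise there is a square root of 1 modulo
    n besides 1 and -1, hence a second involution. If the square of p divides n,
    then p divides the ramification index above p ([wild_ramidx]); if n is
    squarefree, zeta_n itself is a normal integral generator. *)

(** * Algebraic integers *)

Section Integers.
Variable K : fieldExtType rat.
Implicit Types (x y : K) (n : nat).

Definition Oint : {pred K} := fun x => boolp.asbool (ring_of_integers x).

Lemma OintP x : reflect (ring_of_integers x) (x \in Oint).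
Proof. exact: boolp.asboolP. Qed.

Fact Oint_subring : subring_closed Oint.
Proof.
split=> [|x y /OintP Ox /OintP Oy|x y /OintP Ox /OintP Oy]; apply/OintP.
- exact: integral1.
- exact: integral_sub.
- exact: integral_mul.
Qed.
HB.instance Definition _ := GRing.isSubringClosed.Build K Oint Oint_subring.

Lemma Oint_root_monic x (p : {poly K}) :
  p \is monic -> root p x -> p \is a polyOver Oint -> x \in Oint.
Proof.
move=> mon_p px0 Op; apply/OintP/(integral_root_monic mon_p px0).
by move=> y py; apply/OintP; apply: (allP Op).
Qed.

Lemma Oint_rootX n x : (0 < n)%N -> x ^+ n \in Oint -> x \in Oint.
Proof.
move=> n_gt0 Oxn; apply: (@Oint_root_monic x ('X^n - (x ^+ n)%:P)).
- exact: monicXnsubC.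
- by rewrite rootE !hornerE subrr.
- by rewrite rpredB ?polyOverXn ?polyOverC.
Qed.

Lemma rat_Oint (a : rat) : a%:A \in Oint -> a \is a Num.int.
Proof.
case/OintP=> p mon_p p_a; have p_a' : root (map_poly intr p : {poly rat}) a.
  rewrite -(fmorph_root (in_alg K)) -map_poly_comp.
  by rewrite (eq_map_poly (g := intr)) // => z; rewrite /= -in_algE rmorph_int.
have Aa : (ratr a : algC) \in Aint.
  apply: (@root_monic_Aint (map_poly intr p)).
  - move: p_a'; rewrite -(fmorph_root (ratr : {rmorphism rat -> algC})).
    rewrite -map_poly_comp; congr root; apply: eq_map_poly => z /=.
    by rewrite rmorph_int.
  - exact: monic_map.
  - by apply/polyOverP=> i; rewrite coef_map /= rpred_int.
have /intrP[m] := Cint_rat_Aint (Crat_rat a) Aa.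
rewrite -[RHS](rmorph_int (ratr : {rmorphism rat -> algC})).
by move/(fmorph_inj (ratr : {rmorphism rat -> algC})) ->; rewrite rpred_int.
Qed.

Lemma Oint1v x : x \in 1%VS -> x \in Oint -> exists m : int, x = m%:~R.
Proof.
case/vlineP=> a -> /rat_Oint/intrP[m ->]; exists m.
by rewrite -in_algE rmorph_int.
Qed.

Lemma natK_neq0 n : (0 < n)%N -> (n%:R : K) != 0.
Proof.
by move=> n_gt0; rewrite -(rmorph_nat (in_alg K)) fmorph_eq0 pnatr_eq0 -lt0n.
Qed.

Lemma intK_eq0 (m : int) : ((m%:~R : K) == 0) = (m == 0).
Proof. by rewrite -(rmorph_int (in_alg K)) fmorph_eq0 intr_eq0. Qed.

Lemma intK_inj : injective (intr : int -> K).
Proof.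
move=> m n /eqP; rewrite -subr_eq0 -rmorphB intK_eq0 subr_eq0; exact/eqP.
Qed.

(** Clearing denominators in the minimal polynomial of x gives an integer
    polynomial; its leading coefficient times x is a root of a monic one. *)
Lemma Oint_denom x : exists2 n, (0 < n)%N & n%:R * x \in Oint.
Proof.
have [p nz_p px0] : exists2 p : {poly rat}, p != 0 & root (map_poly (in_alg K) p) x.
  have /polyOver1P[p Dp] := minPolyOver 1 x.
  exists p; last by rewrite -Dp root_minPoly.
  by rewrite -(map_poly_eq0 (in_alg K)) -Dp monic_neq0 ?monic_minPoly.
have [q [a nz_a Dp]] := rat_poly_scale p.
have nz_q : q != 0 by apply: contraNneq nz_p => q0; rewrite Dp q0 rmorph0 scaler0.
have qx0 : root (map_poly intr q : {poly K}) x.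
  move: px0; rewrite Dp map_polyZ /= rootZ; last first.
    by rewrite -in_algE fmorph_eq0 invr_eq0 intr_eq0.
  rewrite -map_poly_comp (eq_map_poly (g := intr)) // => z.
  by rewrite /= -in_algE rmorph_int.
set c := lead_coef q; have nz_c : c != 0 by rewrite lead_coef_eq0.
have Ocx : c%:~R * x \in Oint.
  have sq : (1 < size q)%N.
    rewrite ltn_neqAle eq_sym size_poly_gt0 nz_q andbT.
    apply: contraTneq qx0 => /eqP/size_poly1P[d nz_d ->].
    by rewrite map_polyC rootC intK_eq0.
  have Dm : (size q).-1 = (size q).-2.+1 by case: (size q) sq => [|[]].
  set m := (size q).-2 in Dm.
  pose s : {poly K} := \poly_(i < m.+1) (q`_i * c ^+ (m - i))%:~R.
  pose r : {poly K} := 'X^(m.+1) + s.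
  have szs : (size s <= m.+1)%N by apply: size_poly.
  apply: (@Oint_root_monic _ r).
  - rewrite monicE lead_coefDl ?lead_coefXn //.
    by rewrite size_polyXn ltnS.
  - rewrite rootE hornerD hornerXn /s horner_poly.
    apply/eqP; transitivity (c%:~R ^+ m * (map_poly intr q).[x] : K); last first.
      by rewrite (rootP qx0) mulr0.
    rewrite horner_coef size_map_inj_poly ?rmorph0 //; last exact: intK_inj.
    have -> : size q = m.+2 by rewrite -(prednK (ltnW sq)) Dm.
    rewrite [in RHS]big_ord_recr /= mulrDr addrC; congr (_ + _).
      rewrite mulr_sumr; apply: eq_bigr => i _.
      rewrite coef_map exprMn intrM.
      have -> : c%:~R ^+ m = (c ^+ (m - i))%:~R * c%:~R ^+ i :> K.
        by rewrite rmorphXn -exprD subnK // -ltnS.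
      by rewrite [RHS]mulrACA (mulrC (q`_i)%:~R).
    rewrite coef_map /= -Dm -lead_coefE -/c exprMn Dm mulrA -exprSr //.
  - rewrite rpredD ?polyOverXn //; apply/polyOverP => i; rewrite coef_poly.
    by case: ifP => // _; rewrite ?rpred_int ?rpred0.
exists `|c|%N; first by rewrite absz_gt0.
by case: (intP c) Ocx => [|k|k] //; rewrite rmorphN mulNr rpredN.
Qed.

(** Divisibility by a among the integers, stated through the quotient x / a so
    that the multiples of a form an additive subgroup without a choice of
    cofactor. *)
Definition modO (a : K) : {pred K} := fun x => x / a \in Oint.

Lemma modOE a x : (x \in modO a) = (x / a \in Oint). Proof. by []. Qed.

Fact modO_zmod a : zmod_closed (modO a).
Proof.
split=> [|x y]; rewrite !modOE ?mul0r ?rpred0 //.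
by rewrite mulrBl => Ox Oy; rewrite rpredB.
Qed.
HB.instance Definition _ a := GRing.isZmodClosed.Build K (modO a) (modO_zmod a).

Lemma modOM a x y : y \in Oint -> x \in modO a -> x * y \in modO a.
Proof. by move=> Oy; rewrite !modOE mulrAC => Ox; rewrite rpredM. Qed.

Lemma modOMl a x y : y \in Oint -> x \in modO a -> y * x \in modO a.
Proof. by rewrite mulrC; apply: modOM. Qed.

Lemma modOP a x : a != 0 -> reflect (exists2 y, y \in Oint & x = a * y) (x \in modO a).
Proof.
move=> nz_a; apply: (iffP idP) => [Ox | [y Oy ->]].
  by exists (x / a); rewrite // mulrC mulfVK.
by rewrite modOE mulrC mulKf.
Qed.

Lemma modO_int (n : nat) (m : int) : (0 < n)%N ->
  ((m%:~R : K) \in modO n%:R) = (n %| m)%Z.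
Proof.
move=> n_gt0; apply/(modOP _ (natK_neq0 n_gt0))/dvdzP => [[y Oy Dm]|[q ->]].
  have [|q Dq] := @Oint1v y _ Oy.
    have -> : y = n%:R^-1 * m%:~R by rewrite Dm mulKf ?natK_neq0.
    by rewrite memvM ?memvV ?rpred_nat ?rpred_int ?mem1v.
  exists q; apply: intK_inj; rewrite Dm Dq intrM mulrC //.
by exists q%:~R; rewrite ?rpred_int // intrM mulrC.
Qed.

End Integers.

Lemma Oint_rmorph (K L : fieldExtType rat) (f : {rmorphism K -> L}) x :
  (f x \in @Oint L) = (x \in @Oint K).
Proof.
apply/OintP/OintP=> [] [p mon_p px]; exists p => //.
  rewrite -(fmorph_root f) -map_poly_comp (eq_map_poly (g := intr)) // => z /=.
  by rewrite rmorph_int.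
rewrite (eq_map_poly (g := f \o intr)) ?map_poly_comp ?fmorph_root // => z /=.
by rewrite rmorph_int.
Qed.

(** * Trace, norm and integral bases *)

Section GaloisBasics.
Variable L : splittingFieldType rat.
Hypothesis galL : galois 1 {:L}.
Local Notation gT := (gal_of {:L}).
Local Notation O := (@Oint L).
Implicit Types (x y : L) (g h : gT).

Lemma gal_all g : (g \in 'Gal({:L} / 1%VS))%g.
Proof. by rewrite gal_kHom ?sub1v // k1HomE; apply: ahomWin. Qed.

Lemma GalT : ('Gal({:L} / 1%VS))%g = [set: gT]%SET.
Proof. by apply/setP=> g; rewrite gal_all inE. Qed.

Lemma galMx g h x : (g * h)%g x = h (g x).
Proof. by rewrite galM ?memvf. Qed.

Lemma galKV g : cancel g (g^-1)%g.
Proof. by move=> x; rewrite -galMx mulgV gal_id. Qed.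

Lemma galVK g : cancel (g^-1)%g g.
Proof. by move=> x; rewrite -galMx mulVg gal_id. Qed.

Lemma galXx g n x : (g ^+ n)%g x = iter n g x.
Proof. by elim: n => [|n IHn]; rewrite ?expg0 ?gal_id // expgSr galMx IHn. Qed.

Lemma gal_eq g h : (forall x, g x = h x) -> g = h.
Proof. by move=> eq_gh; apply/eqP/gal_eqP => x _. Qed.

Lemma Oint_gal g x : (g x \in O) = (x \in O).
Proof. exact: (Oint_rmorph g). Qed.

Lemma gal_fix1 x : (forall g, g x = x) -> x \in 1%VS.
Proof.
move=> fix_x; rewrite -(galois_fixedField galL).
by apply/fixedFieldP; rewrite ?memvf.
Qed.

Lemma card_gal : #|{: gT}| = \dim {:L}.
Proof. by rewrite -cardsT -GalT -(galois_dim galL) // dimv1 divn1. Qed.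

Definition gal_trace x := \sum_(g : gT) g x.
Definition gal_norm x := \prod_(g : gT) g x.

Fact gal_trace_linear : linear gal_trace.
Proof.
move=> a x y; rewrite /gal_trace scaler_sumr -big_split; apply: eq_bigr => g _.
by rewrite linearP.
Qed.
HB.instance Definition _ := GRing.isLinear.Build rat L L *:%R gal_trace gal_trace_linear.

Lemma gal_gal_trace g x : g (gal_trace x) = gal_trace x.
Proof.
rewrite /gal_trace rmorph_sum [RHS](reindex_inj (mulIg g)); apply: eq_bigr => h _.
by rewrite galMx.
Qed.

Lemma gal_gal_norm g x : g (gal_norm x) = gal_norm x.
Proof.
rewrite /gal_norm rmorph_prod [RHS](reindex_inj (mulIg g)); apply: eq_bigr => h _.
by rewrite galMx.
Qed.

Lemma gal_trace1 x : gal_trace x \in 1%VS.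
Proof. by apply: gal_fix1 => g; apply: gal_gal_trace. Qed.

Lemma gal_norm1 x : gal_norm x \in 1%VS.
Proof. by apply: gal_fix1 => g; apply: gal_gal_norm. Qed.

Lemma gal_trace_int x : x \in O -> exists m : int, gal_trace x = m%:~R.
Proof.
by move=> Ox; apply: Oint1v (gal_trace1 x) _; apply: rpred_sum => g _; rewrite Oint_gal.
Qed.

Lemma gal_norm_int x : x \in O -> exists m : int, gal_norm x = m%:~R.
Proof.
by move=> Ox; apply: Oint1v (gal_norm1 x) _; apply: rpred_prod => g _; rewrite Oint_gal.
Qed.

Lemma gal_norm_eq0 x : (gal_norm x == 0) = (x == 0).
Proof.
apply/prodf_eq0/eqP=> [[g _]|->]; first by rewrite fmorph_eq0 => /eqP.
by exists 1%g; rewrite // gal_id.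
Qed.

Lemma dvd_gal_norm x : x \in O -> exists2 y, y \in O & gal_norm x = x * y.
Proof.
move=> Ox; exists (\prod_(g : gT | g != 1%g) g x).
  by apply: rpred_prod => g _; rewrite Oint_gal.
by rewrite /gal_norm (bigD1 1%g) //= gal_id.
Qed.

Fact gal_traceQ_ex x : exists a : rat, gal_trace x = a%:A.
Proof. exact/vlineP/gal_trace1. Qed.
Definition gal_traceQ x : rat := sval (sig_eqW (gal_traceQ_ex x)).

Lemma gal_traceQE x : (gal_traceQ x)%:A = gal_trace x.
Proof. by rewrite /gal_traceQ; case: sig_eqW. Qed.

Fact gal_traceQ_linear : linear_for *%R gal_traceQ.
Proof.
move=> a x y; apply: (fmorph_inj (in_alg L)).
by rewrite rmorphD rmorphM /= !gal_traceQE linearP mulr_algl.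
Qed.
HB.instance Definition _ := GRing.isLinear.Build rat L rat *%R gal_traceQ gal_traceQ_linear.

Lemma gal_traceQ_int x : x \in O -> gal_traceQ x \is a Num.int.
Proof.
case/gal_trace_int=> m; rewrite -gal_traceQE -(rmorph_int (in_alg L)).
by move/(fmorph_inj (in_alg L)) ->; rewrite rpred_int.
Qed.

Lemma gal_traceQ_1 : gal_traceQ 1 != 0.
Proof.
rewrite -(fmorph_eq0 (in_alg L)) /= gal_traceQE /gal_trace.
rewrite (eq_bigr (fun=> 1)) => [|g _]; last exact: rmorph1.
rewrite sumr_const natK_neq0 //; apply/card_gt0P; by exists 1%g.
Qed.

Section Gram.
Variable n : nat.
Implicit Types b : 'I_n -> L.

Definition gram b : 'M[rat]_n := \matrix_(i, j) gal_traceQ (b i * b j).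

Lemma gram_mul (T : 'M[rat]_n) b :
  gram (fun i => \sum_j T i j *: b j) = T *m gram b *m T^T.
Proof.
apply/matrixP=> i j; rewrite !mxE mulr_sumr linear_sum; apply: eq_bigr => k _.
rewrite !mxE -scalerAr linearZ /= mulrC; congr (_ * _).
rewrite mulr_suml linear_sum; apply: eq_bigr => l _.
by rewrite !mxE -scalerAl linearZ.
Qed.

Lemma det_gram_mul (T : 'M[rat]_n) b :
  \det (gram (fun i => \sum_j T i j *: b j)) = \det T ^+ 2 * \det (gram b).
Proof. by rewrite gram_mul !det_mulmx det_tr mulrAC expr2. Qed.

Lemma det_gram_int b : (forall i, b i \in O) -> \det (gram b) \is a Num.int.
Proof.
move=> Ob; rewrite rpred_sum // => s _; rewrite rpredMsign rpred_prod // => i _.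
by rewrite mxE gal_traceQ_int ?rpredM.
Qed.

Lemma gram_free b : \det (gram b) != 0 ->
  forall c : 'I_n -> rat, \sum_i c i *: b i = 0 -> forall i, c i = 0.
Proof.
move=> nzD c cb0 i; apply/eqP; apply: contraNT nzD => nz_ci.
apply/det0P; exists (\row_j c j).
  by apply/negP=> /eqP/rowP/(_ i); rewrite !mxE => /eqP; apply/negP.
apply/rowP=> j; rewrite !mxE; rewrite -[RHS](linear0 gal_traceQ) -(mul0r (b j)) -cb0.
rewrite mulr_suml linear_sum; apply: eq_bigr => k _.
by rewrite !mxE -scalerAl linearZ.
Qed.

End Gram.

Section IntegralBasis.
Variable E : {subfield L}.
Local Notation n := (\dim E).
Implicit Types b : 'I_n -> L.

Definition int_family b :=
  [/\ forall i, b i \in E, forall i, b i \in O & \det (gram b) != 0].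

Lemma int_family_span b x : int_family b -> x \in E ->
  exists c : 'I_n -> rat, x = \sum_i c i *: b i.
Proof.
case=> Eb Ob /gram_free free_b Ex; pose X := [tuple b i | i < n].
have freeX : free X.
  apply/freeP=> k k0 i; apply: (free_b k); rewrite -[RHS]k0.
  by apply: eq_bigr => j _; rewrite (nth_map j) ?size_enum_ord // nth_ord_enum.
have baX : basis_of E X.
  rewrite basisEfree freeX size_tuple leqnn andbT /=.
  by apply/span_subvP=> _ /mapP[j _ ->].
exists (fun i => coord X i x); rewrite [LHS](coord_basis baX) //.
by apply: eq_bigr => j _; rewrite (nth_map j) ?size_enum_ord // nth_ord_enum.
Qed.

(** The trace form is nondegenerate: if y in E is orthogonal to E and nonzero,
    then y * y^-1 = 1 has trace 0. *)
Lemma int_family_ex : exists b, int_family b.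
Proof.
pose X := vbasis E; have baX := vbasisP E.
pose b0 (i : 'I_n) := X`_i.
have nz0 : \det (gram b0) != 0.
  apply/negP=> /det0P[v nz_v vM0].
  pose y := \sum_i v 0 i *: b0 i.
  have Ey : y \in E by rewrite memv_suml // => i _; rewrite memvZ ?vbasis_mem ?mem_nth ?size_tuple.
  have tr0 w : w \in E -> gal_traceQ (y * w) = 0.
    move=> Ew; rewrite (coord_basis baX Ew) mulr_sumr linear_sum big1 // => j _.
    rewrite -scalerAr linearZ /=; have /rowP/(_ j) := vM0; rewrite !mxE.
    rewrite mulr_suml linear_sum => v0; rewrite -[RHS](mulr0 (coord X j w)) -[in RHS]v0.
    congr (_ * _); apply: eq_bigr => i _.
    by rewrite !mxE -scalerAl linearZ.
  have nz_y : y != 0.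
    apply: contraNneq nz_v => y0; apply/eqP/rowP=> i; rewrite mxE.
    have /freeP := basis_free baX; exact.
  by have := gal_traceQ_1; rewrite -(mulfV nz_y) tr0 ?eqxx // memvV.
have [N N_gt0 ON] : exists2 N, (0 < N)%N & forall i, N%:R * b0 i \in O.
  have /fin_all_exists2[N N_gt0 ON] i := Oint_denom (b0 i).
  exists (\prod_i N i)%N; first by rewrite prodn_gt0.
  move=> i; rewrite (bigD1 i) //= mulnC natrM -mulrA.
  by rewrite rpredM ?rpred_nat.
exists (fun i => \sum_j (N%:R%:M : 'M[rat]_n) i j *: b0 j).
have DN i : \sum_j (N%:R%:M : 'M[rat]_n) i j *: b0 j = N%:R * b0 i.
  rewrite (bigD1 i) //= big1 ?addr0 => [|j ne_ji].
    by rewrite mxE eqxx scaler_nat mulr_natl.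
  by rewrite mxE eq_sym (negPf ne_ji) scale0r.
split=> [i|i|]; rewrite ?DN ?ON //.
  by rewrite mulr_natl rpredMn // vbasis_mem // mem_nth // size_tuple.
by rewrite det_gram_mul det_scalar mulf_neq0 // !expf_neq0 // pnatr_eq0 -lt0n.
Qed.

Lemma det_row_replace (c : 'I_n -> rat) i0 :
  \det (\matrix_(i, j) (if i == i0 then c j else (i == j)%:R)) = c i0.
Proof.
rewrite (expand_det_row _ i0) (bigD1 i0) //= mxE eqxx.
have cofE j : cofactor (\matrix_(i, j) (if i == i0 then c j else (i == j)%:R)) i0 j
    = (i0 == j)%:R.
  transitivity ((\adj (1%:M : 'M[rat]_n)) j i0).
    rewrite [RHS]mxE /cofactor; congr (_ * \det _); apply/matrixP=> k l.
    by rewrite !mxE eq_sym (negPf (neq_lift _ _)).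
  by rewrite adj1 mxE eq_sym.
rewrite cofE eqxx mulr1 big1 ?addr0 // => j ne_j.
by rewrite cofE eq_sym (negPf ne_j) mulr0.
Qed.

(** A family of integers with Gram determinant of least absolute value is an
    integral basis. Otherwise some integer x of E has a nonintegral coordinate
    c; replacing the corresponding member of the family by x minus floor(c)
    times that member multiplies the determinant by the square of the fractional
    part of c. *)
Lemma integral_basis : exists b, int_family b /\
  forall x, x \in E -> x \in O -> exists m : 'I_n -> int, x = \sum_i b i *~ m i.
Proof.
pose h b := `|Num.floor (\det (gram b))|%N.
suffices: forall k b, h b = k -> int_family b -> exists b, int_family b /\
  forall x, x \in E -> x \in O -> exists m : 'I_n -> int, x = \sum_i b i *~ m i.
  by have [b fam_b] := int_family_ex => /(_ _ b erefl fam_b).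
elim/ltn_ind=> k IHk b Dk fam_b.
have [] := boolp.EM (forall x, x \in E -> x \in O ->
  forall c : 'I_n -> rat, x = \sum_i c i *: b i -> forall i, c i \is a Num.int).
  move=> int_b; exists b; split=> // x Ex Ox.
  have [c Dx] := int_family_span fam_b Ex.
  have /fin_all_exists[m Dm] i : exists m : int, c i = m%:~R.
    by apply/intrP/(int_b x Ex Ox c Dx).
  by exists m; rewrite Dx; apply: eq_bigr => i _; rewrite Dm scaler_int.
move=> /boolp.existsNP[x] /boolp.not_implyP[Ex] /boolp.not_implyP[Ox].
move=> /boolp.existsNP[c] /boolp.not_implyP[Dx] /boolp.existsNP[i0] /negP Nci.
have [Eb Ob nzD] := fam_b.
pose c' i := if i == i0 then c i0 - (Num.floor (c i0))%:~R else c i.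
pose T : 'M[rat]_n := \matrix_(i, j) (if i == i0 then c' j else (i == j)%:R).
pose b' i := \sum_j T i j *: b j.
have b'E i : i != i0 -> b' i = b i.
  move=> ne_i; rewrite /b' (bigD1 i) //= big1 ?addr0 => [|j ne_j].
    by rewrite mxE (negPf ne_i) eqxx scale1r.
  by rewrite mxE (negPf ne_i) eq_sym (negPf ne_j) scale0r.
have b'0 : b' i0 = x - (Num.floor (c i0))%:~R *: b i0.
  rewrite /b' Dx (bigD1 i0) //= [in RHS](bigD1 i0) //= addrAC -scalerBl.
  rewrite mxE eqxx /c' eqxx; congr (_ + _); apply: eq_bigr => j ne_j.
  by rewrite mxE eqxx /c' (negPf ne_j).
have detT : \det T = c i0 - (Num.floor (c i0))%:~R by rewrite det_row_replace /c' eqxx.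
have T_gt0 : 0 < \det T.
  rewrite detT subr_gt0 lt_neqAle ge_floor andbT.
  by apply: contraNneq Nci => <-; rewrite rpred_int.
have T_lt1 : \det T < 1 by rewrite detT ltrBlDl -[1]/1%:~R -intrD floorD1_gt.
have fam_b' : int_family b'.
  split=> [i|i|].
  - have [->|/b'E-> //] := eqVneq i i0.
    by rewrite b'0 rpredB // memvZ.
  - have [->|/b'E-> //] := eqVneq i i0.
    by rewrite b'0 scaler_int rpredB // rpredMz.
  - by rewrite det_gram_mul mulf_neq0 // expf_neq0 // gt_eqF.
apply: IHk (erefl (h b')) (fam_b'); rewrite -Dk.
have hE b1 : int_family b1 -> (h b1)%:R = `|\det (gram b1)|.
  case=> _ Ob1 _; rewrite -[in RHS](floorK (det_gram_int Ob1)).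
  by rewrite -intr_norm -abszE.
have detb' : \det (gram b') = \det T ^+ 2 * \det (gram b) := det_gram_mul T b.
rewrite -(ltr_nat rat) (hE _ fam_b) (hE _ fam_b') detb' normrM gtr_pMl ?normr_gt0 //.
by rewrite ger0_norm ?exprn_ge0 ?ltW // exprn_ilt1 // ltW.
Qed.

End IntegralBasis.

(** The integers modulo N are finite in number, as the coordinates in an
    integral basis show. *)
Lemma pigeonhole_mod (f : nat -> L) N : (0 < N)%N -> (forall i, f i \in O) ->
  exists i j, (i < j)%N /\ f i - f j \in modO N%:R.
Proof.
case: N => // M _ Of; have [b [[_ Ob _] ib]] := integral_basis {:L}%AS.
have Fm i : exists m : {ffun 'I_(\dim {:L}) -> int}, f i == \sum_j b j *~ m j.
  have [m Dm] := ib (f i) (memvf _) (Of i).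
  by exists (finfun m); rewrite Dm; apply/eqP/eq_bigr => j _; rewrite ffunE.
pose m i := xchoose (Fm i).
have lt_modM (z : int) : (`|(z %% M.+1%:Z)%Z| < M.+1)%N.
  by rewrite -ltz_nat abszE ger0_norm ?modz_ge0 ?ltz_pmod.
pose r i : {ffun 'I_(\dim {:L}) -> 'I_M.+1} := [ffun j => inord `|(m i j %% M.+1%:Z)%Z|%N].
have [inj|] := boolP (injectiveb (fun i : 'I_(#|{ffun 'I_(\dim {:L}) -> 'I_M.+1}|.+1) => r i)).
  by have := leq_card _ (injectiveP _ inj); rewrite card_ord ltnn.
case/injectivePn=> i [j ne_ij /ffunP eq_r].
wlog lt_ij : i j ne_ij eq_r / (i < j)%N.
  move=> IH; have [lt_ij|lt_ji|eq_ij] := ltngtP i j; first exact: IH lt_ij.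
    by apply: IH lt_ji => //; rewrite eq_sym.
  by case/eqP: ne_ij; apply: val_inj.
exists i, j; split=> //.
rewrite (eqP (xchooseP (Fm i))) (eqP (xchooseP (Fm j))) -sumrB rpred_sum // => k _.
rewrite -mulrzBr -mulrzr modOMl //.
rewrite modO_int // -eqz_mod_dvd -/(m i) -/(m j).
have := eq_r k; rewrite !ffunE => /(congr1 val); rewrite /= !inordK ?lt_modM //.
by move/(congr1 Posz); rewrite !abszE !ger0_norm ?modz_ge0 // => ->.
Qed.

End GaloisBasics.

(** * Prime ideals above a rational prime *)

Section PrimeOver.
Variable K : fieldExtType rat.
Local Notation O := (@Oint K).
Implicit Types (x y a : K) (p : nat).

(** Membership is a boolean predicate, so that a prime ideal is an instance of
    the additive subgroup structure. *)
Definition prime_over_spec (P : {pred K}) p :=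
  [/\ zmod_closed P, {subset P <= O},
      (forall a x, a \in O -> x \in P -> a * x \in P),
      (forall x y, x \in O -> y \in O -> x * y \in P -> x \in P \/ y \in P) &
      1 \notin P /\ p%:R \in P].

Record prime_over p := PrimeOver {
  pmem :> {pred K};
  pmemP : prime_over_spec pmem p }.

Fact prime_over_zmod p (P : prime_over p) : zmod_closed (pmem P).
Proof. by case: P => P []. Qed.
HB.instance Definition _ p (P : prime_over p) :=
  GRing.isZmodClosed.Build K (pmem P) (prime_over_zmod P).

Section Basics.
Variables (p : nat) (P : prime_over p).

Lemma primeO x : x \in P -> x \in O.
Proof. by have [_ PO _ _ _] := pmemP P; apply: PO. Qed.

Lemma primeMl a x : a \in O -> x \in P -> a * x \in P.
Proof. by have [_ _ PM _ _] := pmemP P; apply: PM. Qed.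

Lemma primeMr a x : a \in O -> x \in P -> x * a \in P.
Proof. by rewrite mulrC; apply: primeMl. Qed.

Lemma prime1 : 1 \notin P.
Proof. by have [_ _ _ _ []] := pmemP P. Qed.

Lemma prime_p : p%:R \in P.
Proof. by have [_ _ _ _ []] := pmemP P. Qed.

Lemma primeM x y : x \in O -> y \in O -> (x * y \in P) = (x \in P) || (y \in P).
Proof.
move=> Ox Oy; apply/idP/orP=> [|[]]; last 2 first.
- exact: primeMr.
- exact: primeMl.
by have [_ _ _ PM _] := pmemP P; apply: PM.
Qed.

Lemma primeX x n : x \in O -> (x ^+ n \in P) = (0 < n)%N && (x \in P).
Proof.
move=> Ox; elim: n => [|n IHn]; first by rewrite expr0 (negPf prime1).
by rewrite exprS primeM ?rpredX // IHn /=; case: (x \in P); rewrite ?andbF.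
Qed.

Lemma prime_prod (I : Type) (r : seq I) (F : I -> K) :
  (forall i, F i \in O) -> (forall i, F i \notin P) -> (\prod_(i <- r) F i) \notin P.
Proof.
move=> OF NF; elim: r => [|i r IHr]; first by rewrite big_nil prime1.
have Or : (\prod_(j <- r) F j) \in O by apply: rpred_prod => j _; apply: OF.
by rewrite big_cons primeM // negb_or NF.
Qed.

Lemma modO_prime x : prime p -> x \in modO p%:R -> x \in P.
Proof.
move=> p_pr /modOP[]; first by rewrite natK_neq0 ?prime_gt0.
by move=> y Oy ->; rewrite primeMr // prime_p.
Qed.

Lemma prime_int (m : int) : prime p -> (m%:~R \in P) = (p %| m)%Z.
Proof.
move=> p_pr; apply/idP/idP=> [|dv_m]; last first.
  by apply: modO_prime => //; rewrite modO_int ?prime_gt0.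
apply: contraLR => p'm.
have /coprimezP[[u v] /= uv1] : coprimez p m.
  by rewrite coprimezE absz_nat prime_coprime // -(dvdzE p m).
apply/negP=> Pm; have := prime1; rewrite -[1]/(1%:~R) -uv1 intrD !intrM.
by rewrite rpredD // primeMl ?rpred_int // prime_p.
Qed.

Lemma prime_nat (m : nat) : prime p -> (m%:R \in P) = (p %| m)%N.
Proof. by move/(prime_int m); rewrite dvdzE. Qed.

End Basics.

(** Zorn on the ideals that contain p and not 1. The empty set is admitted as
    well, because it is the union of the empty chain. *)
Lemma prime_over_exists p : prime p -> exists P : prime_over p, True.
Proof.
move=> p_pr; have p_gt0 := prime_gt0 p_pr; have nz_p := natK_neq0 K p_gt0.
pose good (A : set K) := [/\ A `<=` [set x | x \in O], A 0 /\ A p%:R, (forall x y, A x -> A y -> A (x - y)),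
  (forall a x, a \in O -> A x -> A (a * x)) & ~ A 1]%classic.
pose Q (A : set K) := A = set0 \/ good A.
have [F sFQ totF|A [QA maxA]] := @Zorn_bigcup K Q.
  have [[A0 [FA0 gA0]]|noA] := boolp.EM (exists A, F A /\ good A); last first.
    left; apply/seteqP; split=> // x [A FA Ax]; apply: noA; exists A; split=> //.
    by case: (sFQ A FA) => // A0; rewrite A0 in Ax.
  right; have gF A x : F A -> A x -> good A.
    by move=> FA Ax; case: (sFQ A FA) => // A0'; rewrite A0' in Ax.
  split.
  - by move=> x [A FA Ax]; have [AO _ _ _ _] := gF A x FA Ax; apply: AO.
  - by split; exists A0 => //; case: gA0 => _ [].
  - move=> x y [A FA Ax] [B FB By].
    have [sAB|sBA] := totF A B FA FB.
      by exists B => //; have [_ _ BB _ _] := gF B y FB By; apply: BB => //; apply: sAB.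
    by exists A => //; have [_ _ BA _ _] := gF A x FA Ax; apply: BA => //; apply: sBA.
  - move=> a x Oa [A FA Ax]; exists A => //.
    by have [_ _ _ AM _] := gF A x FA Ax; apply: AM.
  - by move=> [A FA A1]; have [_ _ _ _] := gF A 1 FA A1.
have good_p : good [set x | x \in modO p%:R]%classic.
  split=> /=.
  - by move=> x /(modOP _ nz_p)[y Oy ->] /=; rewrite rpredM ?rpred_nat.
  - by rewrite rpred0 modOE mulfV ?rpred1.
  - by move=> x y; apply: rpredB.
  - by move=> a x Oa; apply: modOMl.
  - rewrite -[1]/(1%:~R) modO_int // dvdzE /= dvdn1 => /eqP p1.
    by rewrite p1 in p_pr.
have gA : good A.
  case: QA => // A0; case: (maxA [set x | x \in modO p%:R]%classic); last by right.
  rewrite A0; split=> [|sA]; first exact: sub0set.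
  by case: (sA 0 (rpred0 _)).
have [AO [A0 Ap] AB AM A1] := gA.
have AD x y : A x -> A y -> A (x + y).
  by move=> Ax Ay; rewrite -[y]opprK; apply: (AB) => //; rewrite -sub0r; apply: AB.
have ext x : x \in O -> ~ A x -> exists r a, [/\ r \in O, A a & 1 = a + r * x].
  move=> Ox Nx; pose B := [set y | exists r a, [/\ r \in O, A a & y = a + r * x]]%classic.
  apply: boolp.contrapT => no1; apply: (maxA B).
    split=> [y Ay|sBA]; first by exists 0, y; rewrite mul0r addr0 rpred0.
    by apply: Nx; apply: sBA; exists 1, 0; rewrite mul1r add0r rpred1.
  right; split.
  - move=> _ [r [a [Or Aa ->]]] /=; rewrite rpredD ?rpredM //; exact: AO.
  - by split; [exists 0, 0|exists 0, p%:R]; rewrite mul0r addr0 rpred0.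
  - move=> _ _ [r [a [Or Aa ->]]] [r' [a' [Or' Aa' ->]]]; exists (r - r'), (a - a').
    by rewrite rpredB //; split=> //; [apply: AB|rewrite mulrBl opprD addrACA].
  - move=> c _ Oc [r [a [Or Aa ->]]]; exists (c * r), (c * a).
    by rewrite rpredM //; split=> //; [apply: AM|rewrite mulrDr mulrA].
  - by move=> [r [a [Or Aa D1]]]; apply: no1; exists r, a.
pose P := fun x => boolp.asbool (A x).
have PE x : (x \in (P : {pred K})) = P x by [].
suffices specP : prime_over_spec P p by exists (PrimeOver specP).
split.
- split=> [|x y]; first exact/boolp.asboolP.
  by move=> /boolp.asboolP Ax /boolp.asboolP Ay; apply/boolp.asboolP/AB.
- by move=> x /boolp.asboolP/AO.
- by move=> a x Oa /boolp.asboolP Ax; apply/boolp.asboolP/AM.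
- move=> x y Ox Oy /boolp.asboolP Axy.
  have [Ax|Nx] := boolp.EM (A x); first by left; apply/boolp.asboolP.
  right; apply/boolp.asboolP; have [r [a [Or Aa D1]]] := ext x Ox Nx.
  rewrite -[y]mul1r D1 mulrDl; apply: AD; first by rewrite mulrC; apply: AM.
  by rewrite -mulrA; apply: AM.
- by split; [apply/negP=> /boolp.asboolP|apply/boolp.asboolP].
Qed.

End PrimeOver.

(** * The valuation at a prime ideal *)

Fact socle_identity (R : comPzRingType) (e b E Y : R) :
  e * b = b * (1 - Y) * e + E * Y * (b * e) - (e * E - e) * (b * Y).
Proof. ring. Qed.

Fact expand_identity1 (R : comPzRingType) (u v x c w : R) :
  u * v * (x - c * w) = u * x * v - c * u * (v * w).
Proof. ring. Qed.

Fact expand_identity2 (R : comPzRingType) (pi y v c u t : R) :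
  pi * y * v - c * u * (pi * t) = pi * (y * v - c * (u * t)).
Proof. ring. Qed.

Fact expand_identity3 (R : comPzRingType) (y v b u t : R) :
  y * v - b * (v * y) * (u * t) = - (v * y * (u * t * b - 1)).
Proof. ring. Qed.

Section Local.
Variable L : splittingFieldType rat.
Hypothesis galL : galois 1 {:L}.
Local Notation gT := (gal_of {:L}).
Local Notation O := (@Oint L).
Implicit Types (x y a : L) (g h : gT).

(** By finiteness modulo N two of the N z^n are congruent modulo N, and their
    difference is N times a monic polynomial relation for z. *)
Lemma Oint_bounded z N : (0 < N)%N -> (forall n, N%:R * z ^+ n \in O) -> z \in O.
Proof.
move=> N_gt0 Oz; have [i [j [lt_ij]]] := pigeonhole_mod galL N_gt0 Oz.
rewrite -mulrBr modOE mulrC mulKf ?natK_neq0 // => Oij.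
apply: (@Oint_root_monic _ z ('X^j - 'X^i + (z ^+ i - z ^+ j)%:P)).
- rewrite -addrA monicE lead_coefDl ?lead_coefXn //.
  rewrite size_polyXn ltnS (leq_trans (size_polyD _ _)) // geq_max size_polyN.
  by rewrite size_polyXn lt_ij (leq_trans (size_polyC_leq1 _)) // (leq_trans _ lt_ij).
- by rewrite rootE hornerD hornerC hornerD hornerN !hornerXn subrKA subrr.
- by rewrite rpredD ?rpredB ?polyOverXn ?polyOverC // ?rpredB.
Qed.

Variables (p : nat).
Hypothesis p_pr : prime p.
Let p_gt0 := prime_gt0 p_pr.
Let nz_p : (p%:R : L) != 0 := natK_neq0 L p_gt0.
Implicit Types (P : prime_over L p).

Fact conj_prime_spec P g : prime_over_spec [pred x | (g^-1)%g x \in P] p.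
Proof.
split.
- by split=> [|x y]; rewrite !inE ?rmorph0 ?rpred0 // rmorphB => Px Py; rewrite rpredB.
- by move=> x; rewrite inE => /primeO; rewrite Oint_gal.
- by move=> a x Oa; rewrite !inE rmorphM => Px; rewrite primeMl // Oint_gal.
- by move=> x y Ox Oy; rewrite !inE rmorphM primeM ?Oint_gal // => /orP.
- by rewrite !inE rmorph1 rmorph_nat prime1 prime_p.
Qed.
Definition conj_prime P g := PrimeOver (conj_prime_spec P g).

Lemma conj_primeE P g x : (x \in conj_prime P g) = ((g^-1)%g x \in P).
Proof. by []. Qed.

(** Two powers of x agree modulo p, hence modulo P, so some positive power of x
    is 1 modulo P. *)
Lemma prime_inv P x : x \in O -> x \notin P -> exists2 y, y \in O & x * y - 1 \in P.
Proof.
move=> Ox Nx; have Oxn n : x ^+ n \in O by apply: rpredX.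
have [i [j [lt_ij /(modO_prime P p_pr)]]] := pigeonhole_mod galL p_gt0 Oxn.
have Ok : 1 - x ^+ (j - i) \in O by rewrite rpredB ?rpred1.
rewrite -(subnKC (ltnW lt_ij)) exprD -{1}[x ^+ i]mulr1 -mulrBr primeM //.
rewrite primeX // (negPf Nx) andbF /= => Pxk; exists (x ^+ (j - i).-1); rewrite ?rpredX //.
by rewrite -exprS prednK ?subn_gt0 // -opprB rpredN.
Qed.

Lemma prod_XsubC_mod P (s : seq L) : {subset s <= P} ->
  (\prod_(a <- s) ('X - a%:P) - 'X^(size s)) \is a polyOver P.
Proof.
elim: s => [|a s IHs] Ps; first by rewrite big_nil expr0 subrr rpred0.
have Pa : a \in P by apply: Ps; rewrite inE eqxx.
have {}IHs : (\prod_(a <- s) ('X - a%:P) - 'X^(size s)) \is a polyOver P.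
  by apply: IHs => b sb; apply: Ps; rewrite inE sb orbT.
rewrite big_cons /= exprS mulrBl addrAC -mulrBr rpredB //.
  by apply/polyOverP=> [] [|i]; rewrite coefXM ?rpred0 // (polyOverP IHs).
apply/polyOverP=> i; rewrite coefCM primeMr //; apply/polyOverP: i.
rewrite big_seq rpred_prod // => b sb; rewrite polyOverXsubC (@primeO _ _ P) // Ps //.
by rewrite inE sb orbT.
Qed.

(** The polynomial with roots the conjugates of x has rational integer
    coefficients; those below the leading one lie in P, hence are divisible by
    p. *)
Lemma radical_p P x : x \in O -> (forall g, x \in conj_prime P g) ->
  x ^+ #|{: gT}| \in modO p%:R.
Proof.
move=> Ox Px; pose s := [seq (g : gT) x | g <- enum {: gT}].
have szs : size s = #|{: gT}| by rewrite size_map cardE.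
have Ps : {subset s <= P}.
  by move=> _ /mapP[g _ ->]; have := Px (g^-1)%g; rewrite conj_primeE invgK.
have := prod_XsubC_mod Ps; set f := \prod_(a <- s) _ => Pf.
have Df : f = \prod_(g : gT) ('X - (g x)%:P) by rewrite /f big_map big_enum.
have Of : f \is a polyOver O.
  rewrite /f big_map rpred_prod // => g _; rewrite polyOverXsubC (@primeO _ _ P) //.
  by apply: Ps; apply: map_f; rewrite mem_enum.
have fix_f i : f`_i \in 1%VS.
  apply: gal_fix1 => // g; rewrite -coef_map; congr ((polyseq _)`_i).
  rewrite {1}Df rmorph_prod Df [RHS](reindex_inj (mulIg g)).
  apply: eq_bigr => h _.
  by rewrite rmorphB /= map_polyX map_polyC /= galMx.
have fx0 : f.[x] = 0.
  rewrite Df (bigD1 1%g) //= hornerM gal_id hornerXsubC subrr.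
  by rewrite mul0r.
have -> : x ^+ #|{: gT}| = - (f - 'X^(size s)).[x].
  by rewrite hornerD hornerN hornerXn fx0 sub0r opprK szs.
rewrite rpredN horner_coef rpred_sum // => i _; rewrite modOM ?rpredX //.
have := polyOverP Pf i; have : (f - 'X^(size s))`_i \in 1%VS.
  by rewrite coefB coefXn rpredB ?rpred_nat.
set c := _`_i => c1 Pc; have [m Dm] := Oint1v c1 (primeO Pc).
by move: Pc; rewrite Dm prime_int // modO_int.
Qed.

(** The product, over the conjugates Q of P, of an element of Q outside P, or of
    1 when Q contains P. *)
Lemma prime_avoid P : exists a, [/\ a \in O, a \notin P &
  forall g x, x \in P -> a * x \in conj_prime P g].
Proof.
have ex_a g : exists a, [/\ a \in O, a \notin P & forall x, x \in P -> a * x \in conj_prime P g].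
  have [[a [Ga Na]]|noa] := boolp.EM (exists a, a \in conj_prime P g /\ a \notin P).
    exists a; split=> //; first exact: primeO Ga.
    by move=> x Px; rewrite primeMr ?(primeO Px).
  exists 1; rewrite rpred1 prime1; split=> // x Px; rewrite mul1r.
  apply: boolp.contrapT => /negP Nx.
  have [y Oy Gxy] := prime_inv (primeO Px) Nx; apply: noa; exists (x * y - 1).
  split=> //; apply: contra (prime1 P) => Pxy.
  by rewrite -[1](subKr (x * y)) rpredB // primeMr.
have [a Ha] := boolp.choice ex_a.
exists (\prod_g a g); split.
- by apply: rpred_prod => g _; case: (Ha g).
- by apply: prime_prod => g; case: (Ha g).
move=> g x Px; rewrite (bigD1 g) // mulrAC primeMr //; last by case: (Ha g) => _ _; apply.
by apply: rpred_prod => h _; case: (Ha h).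
Qed.

(** A power e of the element given by [prime_avoid] is idempotent modulo p, and
    e P consists of nilpotents modulo p. One wants b outside p O with b P inside
    p O. If there is none, products B_n of elements of P can be prolonged
    forever with e B_n outside p O; by finiteness B_i = B_i y modulo p for some
    y in P, and the nilpotence of e y then puts e B_i in p O. *)
Lemma prime_colon P : exists z, z \notin O /\ forall x, x \in P -> z * x \in O.
Proof.
have [a [Oa Na Ha]] := prime_avoid P.
have [e [Oe Ne He De]] : exists e, [/\ e \in O, e \notin P,
   forall x g, x \in P -> e * x \in conj_prime P g & e ^+ 2 - e \in modO p%:R].
  have Oai i : a ^+ i.+1 \in O by apply: rpredX.
  have [i [j [lt_ij]]] := pigeonhole_mod galL p_gt0 Oai.
  set k := (j - i)%N; have k_gt0 : (0 < k)%N by rewrite subn_gt0.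
  have -> : j.+1 = (i.+1 + k)%N by rewrite addSn subnKC // ltnW.
  rewrite exprD -{1}[a ^+ i.+1]mulr1 -mulrBr => Dik.
  exists (a ^+ (i.+1 * k)); split; first exact: rpredX.
  - by rewrite primeX // (negPf Na) andbF.
  - move=> x g Px; rewrite -(prednK (_ : 0 < i.+1 * k)%N) ?muln_gt0 // exprSr -mulrA.
    by rewrite primeMl ?rpredX ?Ha.
  have -> : a ^+ (i.+1 * k) ^+ 2 - a ^+ (i.+1 * k)
     = - (a ^+ i.+1 * (1 - a ^+ k) * ((\sum_(l < i.+1) (a ^+ k) ^+ l) * a ^+ (i.+1 * k.-1))).
    rewrite -mulrA [(1 - _) * _]mulrA -(opprB (a ^+ k)) mulNr -subrX1 -exprM mulnC.
    rewrite mulNr mulrN opprK mulrCA -exprD -mulnS prednK // mulrBl mul1r.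
    by rewrite mul2n -addnn exprD [k in a ^+ k * _]mulnC exprM.
  rewrite rpredN modOM // rpredM ?rpredX ?rpred_sum // => l _.
  by rewrite !rpredX.
have nilp x : x \in P -> (e * x) ^+ #|{: gT}| \in modO p%:R.
  by move=> Px; apply: radical_p => [|g]; [rewrite rpredM ?(primeO Px)|apply: He].
have [[b [Ob Nb bP]]|nob] := boolp.EM (exists b, [/\ b \in O, b \notin modO p%:R &
   forall x, x \in P -> b * x \in modO p%:R]).
  exists (b / p%:R); split=> // x Px.
  by rewrite mulrAC; apply: bP.
have next b : exists x, x \in P /\ (b \in O -> e * b \notin modO p%:R ->
   e * (b * x) \notin modO p%:R).
  have [[x Hx]|nox] := boolp.EM (exists x, x \in P /\ e * (b * x) \notin modO p%:R).
    by exists x; case: Hx.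
  exists 0; split=> [|Ob Neb]; first exact: rpred0.
  case: nob; exists (e * b); split=> //; first exact: rpredM.
  move=> x Px; apply: boolp.contrapT => /negP Nx; apply: nox; exists x.
  by rewrite mulrA.
have [f Hf] := boolp.choice next.
pose B := fix B n := if n is m.+1 then B m * f (B m) else 1.
have BS n : B n.+1 = B n * f (B n) by [].
have OB n : B n \in O.
  by elim: n => [|n IHn] /=; rewrite ?rpred1 // rpredM // (primeO (proj1 (Hf _))).
have NB n : e * B n \notin modO p%:R.
  elim: n => [|n IHn] /=; last by case: (Hf (B n)) => _; apply.
  by rewrite mulr1; apply: contra Ne => /(modO_prime P p_pr).
have [i [j [lt_ij]]] := pigeonhole_mod galL p_gt0 OB.
have [y Py ->] : exists2 y, y \in P & B j = B i * y.
  rewrite -(subnKC lt_ij); elim: (j - i.+1)%N => [|m [y Py IHm]].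
    by exists (f (B i)); rewrite ?addn0 //; case: (Hf (B i)).
  rewrite addnS BS IHm; exists (y * f (B i * y)); last by rewrite mulrA.
  by rewrite primeMr // (primeO (proj1 (Hf _))).
rewrite -{1}[B i]mulr1 -mulrBr => DB.
case/negP: (NB i); set n := #|{: gT}| in nilp.
have eE m : e ^+ m.+1 - e \in modO p%:R.
  elim: m => [|m IHm]; first by rewrite expr1 subrr rpred0.
  rewrite -(subrKA (e ^+ 2)) exprS expr2 -mulrBr rpredD ?modOMl //.
have n_gt0 : (0 < n)%N by apply/card_gt0P; exists 1%g.
(* e B i = e B i (1 - y^n) + e B i y^n, and e = e^(n+1) mod p *)
have -> : e * B i = B i * (1 - y) * ((\sum_(l < n) y ^+ l) * e) + (e * y) ^+ n * (B i * e)
   - (e ^+ n.+1 - e) * (B i * y ^+ n).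
  rewrite exprMn.
  have -> : B i * (1 - y) * ((\sum_(l < n) y ^+ l) * e) = B i * (1 - y ^+ n) * e.
    rewrite -!mulrA; congr (_ * _); rewrite mulrA; congr (_ * _).
    by rewrite -[RHS]opprB subrX1 -mulNr opprB.
  by rewrite exprS; apply: socle_identity.
have Oy := primeO Py.
rewrite rpredB ?rpredD // modOM ?rpredM ?rpredX ?rpred_sum ?nilp // => l _.
by rewrite rpredX.
Qed.

(** If z P were contained in P, all the p z^n would be integers and so would z. *)
Lemma uniformizer_ex P : exists z, (forall x, x \in P -> z * x \in O) /\
  exists pi, pi \in P /\ z * pi \notin P.
Proof.
have [z [Nz zP]] := prime_colon P; exists z; split=> //.
apply: boolp.contrapT => nopi; case/negP: Nz.
apply: (Oint_bounded p_gt0) => n; rewrite mulrC; apply: (primeO (P := P)).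
elim: n => [|n IHn]; first by rewrite mul1r prime_p.
rewrite exprS -mulrA; apply: boolp.contrapT => /negP Nx.
by apply: nopi; exists (z ^+ n * p%:R).
Qed.

(** It has a simple pole at P and no other pole: multiplying it by an element
    of P gives an integer, which exhibits P as locally principal. *)
Definition inv_unif P : L := sval (boolp.cid (uniformizer_ex P)).
Lemma inv_unifP P x : x \in P -> inv_unif P * x \in O.
Proof. by move: x; rewrite /inv_unif; case: boolp.cid => z []. Qed.
Fact unif_ex P : exists pi, pi \in P /\ inv_unif P * pi \notin P.
Proof. by rewrite /inv_unif; case: boolp.cid => z []. Qed.
Definition unif P : L := sval (boolp.cid (unif_ex P)).
Lemma unif_in P : unif P \in P.
Proof. by rewrite /unif; case: boolp.cid => z []. Qed.
Lemma unif_O P : unif P \in O. Proof. exact/(primeO (unif_in P)). Qed.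
Lemma inv_unif_unif P : inv_unif P * unif P \notin P.
Proof. by rewrite /unif; case: boolp.cid => z []. Qed.
Lemma unif_neq0 P : unif P != 0.
Proof. by apply: contraNneq (inv_unif_unif P) => ->; rewrite mulr0 rpred0. Qed.

Lemma prime_princ P x : x \in P -> exists u y,
  [/\ u \in O, u \notin P, y \in O & u * x = unif P * y].
Proof.
move=> Px; exists (inv_unif P * unif P), (inv_unif P * x).
by rewrite inv_unifP ?unif_in // inv_unif_unif inv_unifP // mulrAC mulrC mulrA.
Qed.

(** The integers of valuation at least s at P. The denominator u, prime to P,
    stands for a unit of the localization. *)
Definition level P s : {pred L} := fun x => boolp.asbool (x \in O /\ exists u y,
  [/\ u \in O, u \notin P, y \in O & u * x = unif P ^+ s * y]).

Lemma levelP P s x : reflect (x \in O /\ exists u y,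
  [/\ u \in O, u \notin P, y \in O & u * x = unif P ^+ s * y]) (x \in level P s).
Proof. exact: boolp.asboolP. Qed.

Fact level_zmod P s : zmod_closed (level P s).
Proof.
split=> [|x1 x2 /levelP[Ox1 [u1 [y1 [Ou1 Nu1 Oy1 D1]]]] /levelP[Ox2 [u2 [y2 [Ou2 Nu2 Oy2 D2]]]]].
  by apply/levelP; split; rewrite ?rpred0 //; exists 1, 0; rewrite rpred1 prime1 rpred0 !mulr0.
apply/levelP; split; first exact: rpredB.
exists (u1 * u2), (u2 * y1 - u1 * y2).
have Ou : u1 * u2 \in O by rewrite rpredM.
rewrite Ou primeM // negb_or Nu1 Nu2; split=> //.
  by rewrite rpredB ?rpredM.
by rewrite !mulrBr [u1 * u2]mulrC -mulrA D1 [u2 * u1]mulrC -mulrA D2 !(mulrCA (unif P ^+ s)).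
Qed.
HB.instance Definition _ P s := GRing.isZmodClosed.Build L (level P s) (level_zmod P s).

Lemma levelO P s x : x \in level P s -> x \in O. Proof. by case/levelP. Qed.

Lemma level0 P x : (x \in level P 0) = (x \in O).
Proof.
apply/idP/idP=> [/levelO //|Ox]; apply/levelP; split=> //.
by exists 1, x; rewrite rpred1 prime1.
Qed.

Lemma levelM P s t x y : x \in level P s -> y \in level P t -> x * y \in level P (s + t).
Proof.
move=> /levelP[Ox1 [u1 [y1 [Ou1 Nu1 Oy1 D1]]]] /levelP[Ox2 [u2 [y2 [Ou2 Nu2 Oy2 D2]]]].
apply/levelP; split; first exact: rpredM.
exists (u1 * u2), (y1 * y2); rewrite !rpredM // primeM // negb_or Nu1 Nu2; split=> //.
by rewrite mulrACA D1 D2 exprD mulrACA.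
Qed.

Lemma levelMl P s a x : a \in O -> x \in level P s -> a * x \in level P s.
Proof. by rewrite -(level0 P) => Oa /(levelM Oa). Qed.

Lemma levelMr P s a x : a \in O -> x \in level P s -> x * a \in level P s.
Proof. by rewrite mulrC; apply: levelMl. Qed.

Lemma levelX P s x n : x \in level P s -> x ^+ n \in level P (n * s).
Proof.
move=> Px; elim: n => [|n IHn]; first by rewrite level0 rpred1.
by rewrite exprS mulSn levelM.
Qed.

(** When x is y times the s-th power of the uniformizer, up to a factor prime to
    P, only the residue of y decides whether the valuation exceeds s. *)
Lemma levelS P s x u y : x \in O -> u \in O -> u \notin P -> y \in O ->
  u * x = unif P ^+ s * y -> (x \in level P s.+1) = (y \in P).
Proof.
move=> Ox Ou Nu Oy D; apply/idP/idP=> [/levelP[_ [v [w [Ov Nv Ow D']]]]|Py].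
  have Dvy : v * y = unif P * (u * w).
    apply: (mulfI (expf_neq0 s (unif_neq0 P))).
    by rewrite mulrCA -D mulrCA D' exprSr -!mulrA mulrCA (mulrCA u).
  have: v * y \in P by rewrite Dvy primeMr ?unif_in ?rpredM.
  by rewrite primeM // (negPf Nv).
have [v [w [Ov Nv Ow Dy]]] := prime_princ Py.
apply/levelP; split=> //; exists (v * u), w.
rewrite rpredM // primeM // negb_or Nu Nv; split=> //.
by rewrite -mulrA D mulrCA Dy mulrA -exprSr.
Qed.

Lemma level_le P s t x : (s <= t)%N -> x \in level P t -> x \in level P s.
Proof.
move/subnKC<-; case/levelP=> Ox [u [y [Ou Nu Oy D]]]; apply/levelP; split=> //.
by exists u, (unif P ^+ (t - s) * y); rewrite mulrA -exprD rpredM ?rpredX ?unif_O.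
Qed.

Lemma level1 P x : (x \in level P 1) = (x \in P).
Proof.
have [Ox|NOx] := boolP (x \in O).
  by rewrite (@levelS _ 0 x 1 x) ?rpred1 ?prime1 // expr0.
by apply/idP/idP=> [/levelO|/primeO] Ox; rewrite Ox in NOx.
Qed.

Lemma level_unit P s u x : x \in O -> u \in O -> u \notin P ->
  u * x \in level P s -> x \in level P s.
Proof.
move=> Ox Ou Nu /levelP[_ [v [w [Ov Nv Ow D]]]]; apply/levelP; split=> //.
exists (v * u), w; rewrite -mulrA D rpredM //; split=> //.
by rewrite primeM // negb_or Nv.
Qed.

(** The valuation at P, as a relation: it takes no value at 0. *)
Definition exact_level P s x := (x \in level P s) && (x \notin level P s.+1).

Lemma exact_levelP P s x : reflect (x \in O /\ exists u y,
  [/\ u \in O, u \notin P, y \in O, y \notin P & u * x = unif P ^+ s * y]) (exact_level P s x).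
Proof.
apply: (iffP andP) => [[/levelP[Ox [u [y [Ou Nu Oy D]]]] Nx]|[Ox [u [y [Ou Nu Oy Ny D]]]]].
  by split=> //; exists u, y; split=> //; rewrite -(levelS Ox Ou Nu Oy D).
by rewrite (levelS Ox Ou Nu Oy D); split=> //; apply/levelP; split=> //; exists u, y.
Qed.

Lemma exact_level0 P x : exact_level P 0 x = (x \in O) && (x \notin P).
Proof. by rewrite /exact_level level0 level1. Qed.

Lemma exact_levelM P s t x y : exact_level P s x -> exact_level P t y -> exact_level P (s + t) (x * y).
Proof.
move=> /exact_levelP[Ox1 [u1 [y1 [Ou1 Nu1 Oy1 Ny1 D1]]]] /exact_levelP[Ox2 [u2 [y2 [Ou2 Nu2 Oy2 Ny2 D2]]]].
apply/exact_levelP; split; first exact: rpredM.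
exists (u1 * u2), (y1 * y2); rewrite !rpredM // !primeM // !negb_or Nu1 Nu2 Ny1 Ny2.
by split=> //; rewrite mulrACA D1 D2 exprD mulrACA.
Qed.

Lemma exact_levelX P s x n : exact_level P s x -> exact_level P (n * s) (x ^+ n).
Proof.
move=> Px; elim: n => [|n IHn]; first by rewrite exact_level0 rpred1 prime1.
by rewrite exprS mulSn exact_levelM.
Qed.

Lemma exact_level_prod P s (I : finType) (A : {pred I}) (F : I -> L) :
  (forall i, i \in A -> exact_level P s (F i)) -> exact_level P (#|A| * s) (\prod_(i in A) F i).
Proof.
move=> HF; rewrite -sum1_card big_distrl /=.
elim/big_rec2: _ => [|i m x Ai]; first by rewrite exact_level0 rpred1 prime1.
by rewrite mul1n => Hx; apply: exact_levelM => //; apply: HF.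
Qed.

Lemma exact_level_unif P : exact_level P 1 (unif P).
Proof.
apply/exact_levelP; split; first exact: unif_O.
by exists 1, 1; rewrite rpred1 prime1 expr1 mulrC.
Qed.

Lemma exact_level_le P s t x : exact_level P s x -> x \in level P t -> (t <= s)%N.
Proof.
case/andP=> _ Nx Px; rewrite leqNgt; apply: contra Nx => lt_st.
exact: level_le Px.
Qed.

Lemma exact_level_uniq P s t x : exact_level P s x -> exact_level P t x -> s = t.
Proof.
move=> Ps Pt; have [/andP[Ls _] /andP[Lt _]] := (Ps, Pt).
by apply/eqP; rewrite eqn_leq (exact_level_le Ps Lt) (exact_level_le Pt Ls).
Qed.

Lemma exact_level_ex_of P x : x \in O -> (exists s, x \notin level P s) -> exists s, exact_level P s x.
Proof.
move=> Ox ex_s; case: (ex_minnP ex_s) => [] [|s]; first by rewrite level0 Ox.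
move=> Ns min_s; exists s; rewrite /exact_level Ns andbT.
by apply: contraT => /min_s; rewrite ltnn.
Qed.

(** For a as in [prime_avoid] and n the number of conjugates, (a * unif)^n is
    divisible by p, which bounds the valuation of p by n. *)
Lemma p_exact_level P : exists s, exact_level P s p%:R.
Proof.
apply: exact_level_ex_of; first exact: rpred_nat.
have [a [Oa Na Ha]] := prime_avoid P; set n := #|{: gT}|.
exists n.+1; apply/negP=> /levelP[_ [u [y [Ou Nu Oy D]]]].
have: (a * unif P) ^+ n \in modO p%:R.
  apply: radical_p => [|g]; first by rewrite rpredM ?unif_O.
  by apply: Ha; apply: unif_in.
case/(modOP _ nz_p) => t Ot Dt.
have: u * a ^+ n = unif P * (y * t).
  apply: (mulfI (expf_neq0 n (unif_neq0 P))).
  have: u * (a * unif P) ^+ n = unif P ^+ n.+1 * y * t by rewrite Dt mulrA D.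
  by rewrite exprMn exprSr -!mulrA => <-; rewrite mulrCA (mulrC (a ^+ n)).
move/(congr1 (fun x => x \in P)); rewrite primeM ?rpredX // (negPf Nu) primeX //.
by rewrite (negPf Na) andbF primeMr ?unif_in ?rpredM.
Qed.

(** The valuation of p. *)
Definition ramidx P : nat := sval (boolp.cid (p_exact_level P)).
Lemma ramidxP P : exact_level P (ramidx P) p%:R.
Proof. by rewrite /ramidx; case: boolp.cid. Qed.

Lemma ramidx_gt0 P : (0 < ramidx P)%N.
Proof.
by rewrite lt0n; apply: contraTneq (ramidxP P) => ->; rewrite exact_level0 prime_p andbF.
Qed.

Lemma int_exact_level P (m : int) : m != 0 -> exists s, exact_level P s m%:~R.
Proof.
move=> nz_m; rewrite [m]intEsg rmorphM /=.
have sg_m : exact_level P 0 (sgz m)%:~R.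
  rewrite exact_level0 rpred_int /= prime_int // dvdzE.
  by rewrite absz_sg nz_m /= dvdn1 gtn_eqF // prime_gt1.
set n := `|m|%N; have n_gt0 : (0 < n)%N by rewrite absz_gt0.
have [k p'k Dn] := pfactor_coprime p_pr n_gt0.
exists (0 + (0 + logn p n * ramidx P))%N; apply: exact_levelM => //.
have -> : (n%:~R : L) = k%:R * p%:R ^+ logn p n.
  by rewrite {1}Dn -natrX -natrM.
apply: exact_levelM; last exact/exact_levelX/ramidxP.
by rewrite exact_level0 rpred_nat /= prime_nat // -prime_coprime.
Qed.

(** x divides its norm, a nonzero rational integer, and the valuations of
    rational integers are multiples of that of p. *)
Lemma exact_level_ex P x : x \in O -> x != 0 -> exists s, exact_level P s x.
Proof.
move=> Ox nz_x; apply: exact_level_ex_of => //.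
have [m Dm] := gal_norm_int galL Ox; have [y Oy Dx] := dvd_gal_norm Ox.
have nz_m : m != 0 by rewrite -(intK_eq0 L) -Dm gal_norm_eq0.
have [s Hs] := int_exact_level P nz_m.
exists s.+1; apply: contraL (Hs) => Px; rewrite negb_and negbK orbC.
by rewrite -Dm Dx levelMr.
Qed.

Definition decomp P g := forall x, (g x \in P) = (x \in P).
Definition inertia P g := forall x, x \in O -> g x - x \in P.

Lemma inertia_decomp P g : inertia P g -> decomp P g.
Proof.
move=> Ig x; have [Ox|NOx] := boolP (x \in O).
  by rewrite -[g x](subrK x) rpredDl ?Ig.
by apply/idP/idP=> /primeO; rewrite ?Oint_gal (negPf NOx).
Qed.

Lemma decomp_level P g s x : decomp P g -> (g x \in level P s) = (x \in level P s).
Proof.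
move=> Dg.
suffices levelg h y : decomp P h -> y \in level P s -> h y \in level P s.
  apply/idP/idP=> [Pgx|]; last exact: levelg.
  rewrite -[x](galKV g) levelg // => y.
  by have := Dg ((g^-1)%g y); rewrite galVK => ->.
move=> Dh /levelP[Oy [u [w [Ou Nu Ow D]]]].
have Ph : h (unif P) \in P by rewrite Dh unif_in.
have [v [t [Ov Nv Ot Dt]]] := prime_princ Ph.
apply/levelP; split; first by rewrite Oint_gal.
exists (v ^+ s * h u), (t ^+ s * h w).
rewrite !rpredM ?rpredX ?Oint_gal // primeM ?rpredX ?Oint_gal // primeX // negb_or Dh Nu.
rewrite (negPf Nv) andbF; split=> //.
by rewrite -mulrA -rmorphM D rmorphM rmorphXn mulrA -exprMn Dt exprMn mulrA.
Qed.

Lemma decomp_exact_level P g s x : decomp P g -> exact_level P s (g x) = exact_level P s x.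
Proof. by move=> Dg; rewrite /exact_level !decomp_level. Qed.

(** Each layer of the valuation is a line over the residue field, spanned by the
    power w^s of any uniformizer w. *)
Lemma level_expand P s w x : exact_level P 1 w -> x \in level P s ->
  exists2 c, c \in O & x - c * w ^+ s \in level P s.+1.
Proof.
move=> /(exact_levelX s); rewrite muln1 => /exact_levelP[Ow [v [t [Ov Nv Ot Nt Dw]]]].
case/levelP=> Ox [u [y [Ou Nu Oy Dx]]].
have Nut : u * t \notin P by rewrite primeM // negb_or Nu.
have [b Ob Pb] := prime_inv (rpredM Ou Ot) Nut.
exists (b * (v * y)); first by rewrite !rpredM.
have Oc : b * (v * y) \in O by rewrite !rpredM.
have Oxc : x - b * (v * y) * w ^+ s \in O by rewrite rpredB // rpredM.
have Oy' : y * v - b * (v * y) * (u * t) \in O.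
  by rewrite rpredB // rpredM // rpredM.
have Nuv : u * v \notin P by rewrite primeM // negb_or Nu.
have Duv : u * v * (x - b * (v * y) * w ^+ s)
    = unif P ^+ s * (y * v - b * (v * y) * (u * t)).
  by rewrite expand_identity1 Dx Dw expand_identity2.
rewrite (levelS Oxc (rpredM Ou Ov) Nuv Oy' Duv) expand_identity3 rpredN.
by rewrite primeMl // rpredM.
Qed.

(** Write 1 = u v - t with t in P; expanding the s-th power of t against 1
    expresses y by multiples of u y and t^s y. *)
Lemma Oint_locally P y u s : u \in O -> u \notin P -> u * y \in O ->
  (forall t, t \in P -> t ^+ s * y \in O) -> y \in O.
Proof.
move=> Ou Nu Ouy Py; have [v Ov Pt] := prime_inv Ou Nu.
set t := u * v - 1 in Pt; have Ot := primeO Pt.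
have D1 : 1 = u * v - t by rewrite /t opprB addrC subrK.
have -> : y = (- t) ^+ s * y + ((1 ^+ s) - (- t) ^+ s) * y.
  by rewrite expr1n -mulrDl addrC subrK mul1r.
rewrite rpredD ?Py ?rpredN // {1}D1 subrXX opprK subrK -mulrA mulrC -!mulrA.
have -> : y * (u * v) = v * (u * y) by rewrite [RHS]mulrCA [RHS]mulrA mulrC.
apply: rpredM; last exact: rpredM.
apply: rpred_sum => i _.
by rewrite rpredM ?rpredX ?rpredN // rpredB // rpredM.
Qed.

(** The poles of inv_unif^s at P are cancelled by x, and it has none elsewhere. *)
Lemma level_inv_unif P s x : x \in level P s -> inv_unif P ^+ s * x \in O.
Proof.
case/levelP=> Ox [u [y [Ou Nu Oy D]]].
apply: (@Oint_locally P _ u s) => //.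
  by rewrite mulrCA D mulrA -exprMn rpredM // rpredX ?inv_unifP ?unif_in.
by move=> t Pt; rewrite mulrA -exprMn rpredM // rpredX // mulrC inv_unifP.
Qed.

Lemma inv_unif_level P s x : x \in O -> inv_unif P ^+ s * x \in O -> x \in level P s.
Proof.
move=> Ox Ozx; apply/levelP; split=> //.
have Ou : inv_unif P * unif P \in O by rewrite inv_unifP ?unif_in.
exists ((inv_unif P * unif P) ^+ s), (inv_unif P ^+ s * x).
rewrite rpredX // primeX // (negPf (inv_unif_unif P)) andbF; split=> //.
by rewrite exprMn mulrAC mulrC.
Qed.

Lemma exact_level_inv_unif P s x : exact_level P s x -> exact_level P 0 (inv_unif P ^+ s * x).
Proof.
case/andP=> Px Nx; rewrite exact_level0 level_inv_unif //=; apply: contra Nx => Pzx.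
by rewrite inv_unif_level ?(levelO Px) // exprS -mulrA inv_unifP.
Qed.

End Local.

(** * Inertia and the layers of the valuation *)

Fact clear_denom_identity (F : fieldType) (z p n y : F) : p != 0 ->
  z * p * n * (y / p) = n * (z * y).
Proof. by move=> nz_p; field. Qed.

Fact jump_identity1 (R : comPzRingType) (gx x gc c w : R) :
  gx - x = gx - gc * w - (x - c * w) + (gc - c) * w.
Proof. ring. Qed.

Fact jump_identity2 (R : comPzRingType) (gx x gc c gw w : R) :
  gx - x = gx - gc * gw - (x - c * w) + (gc * (gw - w) + (gc - c) * w).
Proof. ring. Qed.

Section Inertia.
Variable L : splittingFieldType rat.
Hypothesis galL : galois 1 {:L}.
Local Notation gT := (gal_of {:L}).
Local Notation O := (@Oint L).
Implicit Types (x y a : L) (g h : gT).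
Variables (p : nat).
Hypothesis p_pr : prime p.
Let p_gt0 := prime_gt0 p_pr.
Local Notation unif := (unif galL p_pr).
Local Notation inv_unif := (inv_unif galL p_pr).
Local Notation level := (level galL p_pr).
Local Notation exact_level := (exact_level galL p_pr).
Local Notation ramidx := (ramidx galL p_pr).
Implicit Types (P : prime_over L p).

Lemma levelX1 P x n : x \in level P 1 -> x ^+ n \in level P n.
Proof. by rewrite -{2}[n]muln1; apply: levelX. Qed.

Lemma modX a x y n : x \in O -> y \in O -> x - y \in modO a -> x ^+ n - y ^+ n \in modO a.
Proof.
move=> Ox Oy Dxy; rewrite subrXX modOM // rpred_sum // => i _.
by rewrite rpredM // rpredX.
Qed.

Lemma expD_mod x y : x \in O -> y \in O -> (x + y) ^+ p - (x ^+ p + y ^+ p) \in modO p%:R.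
Proof.
move=> Ox Oy; rewrite exprDn -(prednK p_gt0) big_ord_recl big_ord_recr /=.
rewrite subn0 bin0 mulr1n expr0 mulr1 /bump /= add1n prednK // subnn binn expr0 mul1r mulr1n.
rewrite [x ^+ p + (_ + _)]addrCA addrK.
rewrite rpred_sum // => i _; rewrite add1n.
have /dvdnP[k ->] : (p %| 'C(p, i.+1))%N.
  by rewrite prime_dvd_bin //= -ltn_predRL.
rewrite mulrnA -[X in X \in _]mulr_natr; apply: modOMl; first by rewrite rpredMn ?rpredM ?rpredX.
by rewrite modOE mulfV ?rpred1 ?natK_neq0.
Qed.

(** The map x |-> x^p is additive modulo p. *)
Lemma expB_mod i x y : x \in O -> y \in O ->
  (x - y) ^+ (p ^ i) - (x ^+ (p ^ i) - y ^+ (p ^ i)) \in modO p%:R.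
Proof.
move=> Ox Oy; elim: i => [|i IHi]; first by rewrite !expr1 subrr rpred0.
have Oxi : x ^+ (p ^ i) \in O by rewrite rpredX.
have Oyi : y ^+ (p ^ i) \in O by rewrite rpredX.
have := modX p (rpredX _ (rpredB Ox Oy)) (rpredB Oxi Oyi) IHi.
rewrite -!exprM -!expnSr => D1.
rewrite -(subrKA ((x ^+ (p ^ i) - y ^+ (p ^ i)) ^+ p)) rpredD //.
have := expD_mod (rpredB Oxi Oyi) Oyi; rewrite subrK -!exprM -!expnSr.
by move=> D2; rewrite -[X in X \in _]opprK rpredN opprB -addrA -opprD [y ^+ _ + _]addrC.
Qed.

(** The sequence x^(p^i) repeats modulo p; in a field of characteristic p the
    common power can be removed. *)
Lemma residue_perfect P x : x \in O -> exists2 y, y \in O & x - y ^+ p \in P.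
Proof.
move=> Ox; have Oxi i : x ^+ (p ^ i) \in O by rewrite rpredX.
have [i [j [lt_ij Dij]]] := pigeonhole_mod galL p_gt0 Oxi.
exists (x ^+ (p ^ (j - i).-1)); first by rewrite rpredX.
rewrite -exprM -expnSr prednK ?subn_gt0 //.
have Oy : x ^+ (p ^ (j - i)) \in O by rewrite rpredX.
have := expB_mod i Ox Oy; rewrite -exprM -expnD subnK ?(ltnW lt_ij) // => D1.
have: (x - x ^+ (p ^ (j - i))) ^+ (p ^ i) \in P.
  by apply: modO_prime => //; rewrite -[X in X \in _](subrK (x ^+ (p ^ i) - x ^+ (p ^ j))) rpredD.
by rewrite (primeX _ _ (rpredB Ox Oy)) => /andP[].
Qed.

(** The first layer on which g - 1 is not zero. It exists because a nonzero
    integer has a valuation. *)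
Lemma first_jump P g : inertia P g -> g != 1%g -> exists s,
  [/\ (0 < s)%N, forall x, x \in O -> g x - x \in level P s &
      exists2 x, x \in O & g x - x \notin level P s.+1].
Proof.
move=> Ig ntg.
have [x Ox nz_x] : exists2 x, x \in O & g x - x != 0.
  have [x nz_x] : exists x, g x - x != 0.
    apply: boolp.contrapT => nox; case/eqP: ntg; apply: gal_eq => x.
    rewrite gal_id; apply/eqP; rewrite -subr_eq0.
    by apply: boolp.contrapT => /negP nz_x; apply: nox; exists x.
  have [n n_gt0 On] := Oint_denom x; exists (n%:R * x) => //.
  by rewrite rmorphM rmorph_nat -mulrBr mulf_neq0 ?natK_neq0.
pose Q s := boolp.asbool (exists2 x, x \in O & g x - x \notin level P s.+1).
have exQ : exists s, Q s.
  have [s /andP[_ Ns]] := exact_level_ex galL p_pr P (rpredB (etrans (Oint_gal g x) Ox) Ox) nz_x.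
  by exists s; apply/boolp.asboolP; exists x.
case: (ex_minnP exQ) => s /boolp.asboolP[y Oy Ny] min_s; exists s.
have min_level t : (t < s)%N -> forall x, x \in O -> g x - x \in level P t.+1.
  move=> lt_ts x1 Ox1; apply: contraLR lt_ts => Nx1; rewrite -leqNgt.
  by apply: min_s; apply/boolp.asboolP; exists x1.
case: s min_s min_level Ny => [|s] min_s min_level Ny; last by split=> //; [exact: min_level|exists y].
by case/negP: Ny; rewrite level1 Ig.
Qed.

Section FixedElements.
Variables (P : prime_over L p) (J : {group gT}).
Hypothesis IJ : forall g, g \in J -> inertia P g.
Local Notation e := (ramidx P).

Definition pnorm x := \prod_(g in J) g x.

Lemma pnorm_fixed g x : g \in J -> g (pnorm x) = pnorm x.
Proof.
move=> Jg; rewrite /pnorm rmorph_prod [RHS](reindex_inj (mulIg g)) /=.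
by apply: eq_big => [h|h _]; rewrite ?groupMr // galMx.
Qed.

Lemma pnorm_exact_level s x : exact_level P s x -> exact_level P (#|J| * s) (pnorm x).
Proof.
move=> Ps; apply: exact_level_prod => g Jg.
by rewrite decomp_exact_level //; apply: inertia_decomp => //; apply: IJ.
Qed.

(** Dividing by p^q lowers the valuation by q e and preserves invariance under
    J, but creates poles at the other primes above p; they are cancelled by
    powers of the invariant norm of inv_unif^e * p, which has valuation 0 at P. *)
Lemma fixed_adjust y m q : exact_level P m y -> (forall g, g \in J -> g y = y) ->
  (q * e <= m)%N -> exists y', exact_level P (m - q * e) y' /\ forall g, g \in J -> g y' = y'.
Proof.
move=> Py fix_y le_m.
pose w := inv_unif P ^+ e * p%:R; have Pw : exact_level P 0 w by apply/exact_level_inv_unif/ramidxP.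
pose y' := pnorm w ^+ q * (y / p%:R ^+ q).
have fix_y' g : g \in J -> g y' = y'.
  by move=> Jg; rewrite rmorphM rmorphXn /= pnorm_fixed // rmorphM fmorphV rmorphXn rmorph_nat /= fix_y.
have nz_y : y != 0 by apply: contraTneq Py => ->; rewrite /exact_level !rpred0.
have Ow : w \in O by move: Pw; rewrite exact_level0 => /andP[].
have Pnw : exact_level P 0 (pnorm w) by have := pnorm_exact_level Pw; rewrite muln0.
have nz_nw : pnorm w != 0 by apply: contraTneq Pnw => ->; rewrite exact_level0 !rpred0.
have Oy' : y' \in O.
  pose v := \prod_(g in J | g != 1%g) g w.
  have -> : y' = v ^+ q * (inv_unif P ^+ (q * e) * y).
    rewrite /y' /pnorm (bigD1 1%g) //= gal_id -/v exprMn [w ^+ q]exprMn -exprM mulnC.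
    by apply: clear_denom_identity; rewrite expf_neq0 ?natK_neq0.
  rewrite rpredM ?rpredX ?rpred_prod // => [g _|]; first by rewrite Oint_gal.
  by apply: level_inv_unif; case/andP: Py => Py _; apply: level_le Py.
have nz_y' : y' != 0 by rewrite !mulf_neq0 ?invr_eq0 ?expf_neq0 ?natK_neq0.
have [s Ps] := exact_level_ex galL p_pr P Oy' nz_y'; exists y'; split=> //.
suffices Dm : (q * e + s = m)%N by rewrite -Dm addKn.
apply: (exact_level_uniq (exact_levelM (exact_levelX q (ramidxP galL p_pr P)) Ps)).
rewrite /y' mulrCA [p%:R ^+ q * _]mulrC mulfVK ?expf_neq0 ?natK_neq0 //.
by rewrite -[m]add0n -(muln0 q); apply: exact_levelM => //; apply: exact_levelX.
Qed.

End FixedElements.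

(** As e is prime to p, a norm of valuation p and division by p yield a
    uniformizer w fixed by g. On w-adic expansions g - 1 then acts through
    residues only, and on the first layer that it moves it is a derivation of
    the residue field. A derivation kills p-th powers, which are all the
    residues. *)
Lemma ramidx_wild P g : inertia P g -> (g ^+ p)%g = 1%g -> coprime (ramidx P) p -> g = 1%g.
Proof.
move=> Ig gp1 co_e; apply/eqP; apply: contraT => ntg.
have [s [s_gt0 level_s [x0 Ox0 Nx0]]] := first_jump Ig ntg.
have og : #[g]%g = p.
  have : (#[g]%g %| p)%N by rewrite order_dvdn gp1.
  by case/primeP: (p_pr) => _ min_p /min_p; rewrite order_eq1 (negPf ntg) => /eqP.
have Icg h : h \in <[g]>%g -> inertia P h.
  case/cycleP=> i ->{h}; elim: i => [|i IHi] x Ox; first by rewrite expg0 gal_id subrr rpred0.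
  by rewrite expgSr galMx -(subrKA (g x)) -rmorphB rpredD ?Ig // inertia_decomp // IHi.
(* By Bezout, a p - q e = 1 for some a and q. *)
have [w [Pw fix_w]] : exists w, exact_level P 1 w /\ g w = w.
  have [a q Eq _] := egcdnP (ramidx P) p_gt0.
  rewrite gcdnC (eqP co_e) in Eq.
  have Py : exact_level P (a * p) (pnorm <[g]> (unif P) ^+ a).
    apply: exact_levelX; rewrite -[p in exact_level _ p]muln1 -[in X in exact_level _ X]og orderE.
    by apply: pnorm_exact_level => //; apply: exact_level_unif.
  have fix_y h : h \in <[g]>%g -> h (pnorm <[g]> (unif P) ^+ a) = pnorm <[g]> (unif P) ^+ a.
    by move=> Jh; rewrite rmorphXn /= pnorm_fixed.
  have [|w [Pw fix_w]] := fixed_adjust Icg Py fix_y (q := q).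
    by rewrite Eq leq_addr.
  by exists w; rewrite Eq addKn in Pw; split=> //; apply: fix_w; apply: cycle_id.
have Ow : w \in O by case/andP: Pw => /levelO.
have Dg := inertia_decomp Ig.
(* Descending induction along the w-adic expansion of x; the integer t is the
   valuation reached so far. *)
have dP : forall x, x \in P -> g x - x \in level P s.+1.
  suffices dt t : forall k x, (k + t = s.+1)%N -> (0 < t)%N -> x \in level P t ->
      g x - x \in level P s.+1.
    by move=> x; rewrite -(level1 galL p_pr) => Px; apply: (dt 1 s); rewrite ?addn1.
  move=> k; elim: k t => [|k IHk] t x Dk t_gt0 Px.
    by rewrite add0n in Dk; rewrite Dk in Px; rewrite rpredB // decomp_level.
  have [c Oc Pc] := level_expand Pw Px.
  have -> : g x - x = (g (x - c * w ^+ t) - (x - c * w ^+ t)) + (g c - c) * w ^+ t.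
    by rewrite rmorphB rmorphM rmorphXn /= fix_w; apply: jump_identity1.
  rewrite rpredD //; first by apply: IHk Pc; rewrite // addnS -addSn.
  apply: (@level_le _ _ _ _ _ _ (s + t)); first by rewrite -addn1 leq_add2l.
  by apply: levelM; [apply: level_s|by apply: levelX1; case/andP: Pw].
case/negP: Nx0; have [y Oy Pxy] := residue_perfect P Ox0.
rewrite -[x0](subrK (y ^+ p)) rmorphD opprD addrACA rpredD //; first exact: dP.
rewrite rmorphXn subrXX -addn1; apply: levelM; first exact: level_s.
rewrite level1; have Ogy : g y \in O by rewrite Oint_gal.
have -> : \sum_(i < p) g y ^+ (p.-1 - i) * y ^+ i =
  \sum_(i < p) (g y ^+ (p.-1 - i) - y ^+ (p.-1 - i)) * y ^+ i + p%:R * y ^+ p.-1.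
  have -> : p%:R * y ^+ p.-1 = \sum_(i < p) y ^+ p.-1.
    by rewrite sumr_const card_ord mulr_natl.
  rewrite -big_split; apply: eq_bigr => i _ /=.
  by rewrite mulrBl -exprD subnK ?subrK // -ltnS prednK.
rewrite rpredD ?primeMr ?rpredX ?prime_p // rpred_sum // => i _.
rewrite primeMr ?rpredX // subrXX primeMr ?Ig // rpred_sum // => j _.
by rewrite rpredM ?rpredX.
Qed.

(** If g fixes the uniformizer modulo the second layer, it acts trivially on
    each layer. On the first layer where d = g x0 - x0 is not zero, summing the
    conjugates of d over the powers of g gives 0 on the one hand and #[g] d on
    the other. *)
Lemma tame_inj P g : inertia P g -> coprime #[g]%g p -> g (unif P) - unif P \in level P 2 ->
  g = 1%g.
Proof.
move=> Ig co_g Pg; apply/eqP; apply: contraT => ntg.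
have [s [s_gt0 level_s [x0 Ox0 Nx0]]] := first_jump Ig ntg.
have Dg := inertia_decomp Ig.
have Ppi : exact_level P 1 (unif P) by apply: exact_level_unif.
have Pgpi : exact_level P 1 (g (unif P)) by rewrite decomp_exact_level.
have [/andP[Lpi _] /andP[Lgpi _]] := (Ppi, Pgpi).
have ds x : x \in level P s -> g x - x \in level P s.+1.
  move=> Px; have [c Oc Pc] := level_expand Ppi Px.
  have -> : g x - x = (g (x - c * unif P ^+ s) - (x - c * unif P ^+ s))
     + (g c * (g (unif P) ^+ s - unif P ^+ s) + (g c - c) * unif P ^+ s).
    rewrite rmorphB rmorphM rmorphXn; apply: jump_identity2.
  apply: rpredD; first by rewrite rpredB // decomp_level.
  apply: rpredD.
    rewrite subrXX; apply: levelMl; first by rewrite Oint_gal.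
    have -> : (s.+1 = 2 + s.-1)%N by rewrite add2n prednK.
    apply: levelM => //; rewrite rpred_sum // => i _.
    apply: (@level_le _ _ _ _ _ _ (s.-1 - i + i)); first by rewrite subnK // -ltnS prednK.
    by apply: levelM; apply: levelX1.
  apply: (@level_le _ _ _ _ _ _ (s + s)); first by rewrite -addn1 leq_add2l.
  by apply: levelM; [apply: level_s|exact: levelX1].
case/negP: Nx0; set d := g x0 - x0.
have Pd : d \in level P s by apply: level_s.
have Od := levelO Pd.
have gi i : (g ^+ i)%g d - d \in level P s.+1.
  elim: i => [|i IHi]; first by rewrite expg0 gal_id subrr rpred0.
  by rewrite expgSr galMx -(subrKA (g d)) -rmorphB rpredD ?ds // decomp_level.
have tel i : \sum_(j < i) (g ^+ j)%g d = (g ^+ i)%g x0 - x0.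
  elim: i => [|i IHi]; first by rewrite big_ord0 expg0 gal_id subrr.
  rewrite big_ord_recr /= IHi /d rmorphB /= -galMx -expgS addrC.
  by rewrite subrKA.
have := tel #[g]%g; rewrite expg_order gal_id subrr => sum0.
apply: (@level_unit _ _ _ _ _ _ (#[g]%g)%:R) => //; first exact: rpred_nat.
  by rewrite prime_nat // -prime_coprime // coprime_sym.
have -> : #[g]%g%:R * d = - \sum_(j < #[g]%g) ((g ^+ j)%g d - d).
  by rewrite sumrB sum0 sub0r opprK sumr_const card_ord mulr_natl.
by rewrite rpredN rpred_sum // => i _; apply: gi.
Qed.

End Inertia.

(** * Ramification indices as valuations *)

Fact ideal_dvd_identity (R : comPzRingType) (a p xe z c yj : R) :
  xe * (z * yj) * c * (a * p) = xe * yj * (z * p * (a * c)).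
Proof. ring. Qed.

Section Ideals.
Local Open Scope classical_set_scope.
Local Open Scope ring_scope.
Variable L : splittingFieldType rat.
Hypothesis galL : galois 1 {:L}.
Local Notation gT := (gal_of {:L}).
Local Notation O := (@Oint L).
Implicit Types (x y a : L) (g h : gT).
Variables (p : nat).
Hypothesis p_pr : prime p.
Let p_gt0 := prime_gt0 p_pr.
Let nz_p : (p%:R : L) != 0 := natK_neq0 L p_gt0.
Local Notation unif := (unif galL p_pr).
Local Notation inv_unif := (inv_unif galL p_pr).
Local Notation level := (level galL p_pr).
Local Notation exact_level := (exact_level galL p_pr).
Local Notation ramidx := (ramidx galL p_pr).
Implicit Types (P : prime_over L p).

Lemma prime_over_ideal P : is_prime_ideal [set x | x \in P] /\ lies_above [set x | x \in P] p.
Proof.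
split; last by move=> m; rewrite /= prime_int.
split=> /=; last by move=> x y /OintP Ox /OintP Oy; rewrite primeM // => /orP.
  split=> /=; [by move=> x /primeO /OintP | exact: rpred0 | by move=> x y; apply: rpredD |].
  by move=> a x /OintP; apply: primeMl.
exact/negP/prime1.
Qed.

Lemma ideal_prime_over (I : set L) : is_prime_ideal I -> lies_above I p ->
  exists P, I = [set x | x \in P].
Proof.
case=> [[IO I0 ID IM] I1 Ipr] Ip; pose P : {pred L} := fun x => boolp.asbool (I x).
have specP : prime_over_spec P p.
  split.
  - split=> [|x y /boolp.asboolP Ix /boolp.asboolP Iy]; apply/boolp.asboolP => //.
    apply: ID => //; rewrite -mulN1r; apply: IM => //; apply/OintP.
    by rewrite rpredN rpred1.
  - by move=> x /boolp.asboolP /IO /OintP.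
  - by move=> a x /OintP Oa /boolp.asboolP Ix; apply/boolp.asboolP/IM.
  - move=> x y /OintP Ox /OintP Oy /boolp.asboolP Ixy.
    by case: (Ipr x y Ox Oy Ixy) => ?; [left|right]; apply/boolp.asboolP.
  - split; first exact/boolp.asboolP.
    by apply/boolp.asboolP; apply/(Ip p).
exists (PrimeOver specP); apply/seteqP; split=> x /=; first by move=> ?; apply/boolp.asboolP.
by move/boolp.asboolP.
Qed.

Lemma ideal_exp_level P e x : ideal_exp [set x | x \in P] e x -> x \in level P e.
Proof.
elim: e x => [|e IHe] x /=; first by move/OintP; rewrite level0.
case=> s Hs ->; rewrite big_seq rpred_sum // => u /Hs[/= Pu1 /IHe Pu2].
by rewrite -add1n; apply: levelM => //; rewrite level1.
Qed.

Lemma exp_ideal_exp P (a b : nat) x y : x \in P -> y \in P ->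
  ideal_exp [set x | x \in P] (a + b) (x ^+ a * y ^+ b).
Proof.
move=> Px Py; have mulP e u v : u \in P -> ideal_exp [set x | x \in P] e v ->
    ideal_exp [set x | x \in P] e.+1 (u * v).
  by move=> Pu Ev; exists [:: (u, v)]; rewrite ?big_seq1 // => w; rewrite inE => /eqP->.
elim: a => [|a IHa]; last by rewrite exprS -mulrA; apply: mulP.
rewrite mul1r add0n; elim: b => [|b IHb]; first exact/OintP/rpred1.
by rewrite exprS; apply: mulP.
Qed.

(** P and the ideal inv_unif * P are coprime. *)
Lemma inv_unif_split P : exists x y, [/\ x \in P, y \in P & 1 = x + inv_unif P * y].
Proof.
have Ozpi : inv_unif P * unif P \in O by rewrite inv_unifP ?unif_in.
have [v Ov Pv] := prime_inv galL p_pr Ozpi (inv_unif_unif galL p_pr P).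
exists (- (inv_unif P * unif P * v - 1)), (unif P * v).
by rewrite rpredN primeMr ?unif_in // opprB mulrA subrK.
Qed.

(** When p has valuation at least e, the cofactor of P^e is the ideal of all a
    such that a P^e is contained in p O. Expanding the e-th power of 1 = x +
    inv_unif * y writes p as a sum of products of elements of P^e and of that ideal. *)
Lemma ideal_dvd_level P e :
  ideal_dvd (ideal_exp [set x | x \in P] e) (principal_ideal p%:R) <-> p%:R \in level P e.
Proof.
split=> [[A [AO _ _ _] DA]|Pe].
  have : principal_ideal (p%:R : L) p%:R.
    by exists 1; rewrite ?mul1r //; apply/OintP/rpred1.
  rewrite DA => [[s Hs ->]]; rewrite big_seq rpred_sum // => u /Hs[/ideal_exp_level Pu1 /AO/OintP].
  by move=> Ou2; apply: levelMr.
pose A := [set a | a \in O /\ forall x, ideal_exp [set x | x \in P] e x -> a * x \in modO p%:R].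
exists A.
  split=> /=.
  - by move=> a [/OintP].
  - by split=> [|x _]; rewrite ?mul0r rpred0.
  - move=> a b [Oa Aa] [Ob Ab]; split=> [|x Ex]; first exact: rpredD.
    by rewrite mulrDl rpredD ?Aa ?Ab.
  - move=> a x /OintP Oa [Ox Ax]; split=> [|y Ey]; first exact: rpredM.
    by rewrite -mulrA modOMl ?Ax.
apply/seteqP; split=> [_ [a /OintP Oa <-]|_ [s Hs ->]]; last first.
  have : \sum_(u <- s) u.1 * u.2 \in modO p%:R.
    by rewrite big_seq rpred_sum // => u /Hs[Eu [_ Au]]; rewrite mulrC; apply: Au.
  by case/(modOP _ nz_p) => y /OintP Oy ->; exists y; rewrite // mulrC.
have [x [y [Px Py D1]]] := inv_unif_split P.
have levelj j : (j <= e)%N -> forall t, t \in level P e -> inv_unif P ^+ j * t \in O.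
  by move=> le_je t Pt; apply/level_inv_unif/(level_le le_je).
have Aj j : (j <= e)%N -> A (inv_unif P ^+ j * p%:R).
  move=> le_je; split=> [|t /ideal_exp_level Pt]; first exact: levelj.
  by rewrite mulrAC modOMl ?levelj // modOE mulfV ?rpred1.
pose w (j : 'I_e.+1) := (x ^+ (e - j) * y ^+ j, inv_unif P ^+ j * p%:R * (a *+ 'C(e, j))).
exists [seq w j | j <- enum 'I_e.+1] => [_ /mapP[j _ ->] /=|].
  have le_je : (j <= e)%N by rewrite -ltnS.
  split; first by rewrite -{1}(subnK le_je); apply: exp_ideal_exp.
  have [OA HA] := Aj j le_je; split=> [|t Et]; first by rewrite rpredM ?rpredMn.
  by rewrite mulrAC modOM ?rpredMn ?HA.
have D1e : 1 = \sum_(j < e.+1) x ^+ (e - j) * (inv_unif P * y) ^+ j *+ 'C(e, j).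
  by rewrite -exprDn -D1 expr1n.
rewrite big_map big_enum -[LHS]mul1r [X in X * _ = _]D1e mulr_suml.
apply: eq_big => // j _ /=; rewrite exprMn.
by rewrite -[X in X * _ = _]mulr_natr -[a *+ _]mulr_natr; apply: ideal_dvd_identity.
Qed.

Lemma ramification_indexE P e :
  is_ramification_index [set x | x \in P] p e <-> e = ramidx P.
Proof.
have Pe := ramidxP galL p_pr P; split=> [[/ideal_dvd_level Pe1 Ne1]|->].
  apply: exact_level_uniq Pe => //; rewrite /exact_level Pe1 /=.
  by apply/negP => /ideal_dvd_level.
case/andP: Pe => P1 P2; split; first exact/ideal_dvd_level.
by move/ideal_dvd_level; apply/negP.
Qed.

End Ideals.

Lemma tamely_ramifiedP (L : splittingFieldType rat) (galL : galois 1 {:L}) :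
  tamely_ramified L <->
  forall p (p_pr : prime p) (P : prime_over L p), coprime (ramidx galL p_pr P) p.
Proof.
split=> [tame p p_pr P|tame p I e p_pr prI abI].
  have [prI abI] := prime_over_ideal p_pr P.
  by apply: tame prI abI _ => //; apply/(ramification_indexE galL).
have [P DI] := ideal_prime_over prI abI; rewrite DI.
by move/(ramification_indexE galL p_pr) => ->.
Qed.

(** * Independence of characters modulo a prime ideal *)

Fact dedekind_identity (R : comPzRingType) (agh ag ghy gy g0y : R) :
  agh * (ghy - g0y) - ag * (gy - g0y) = (agh - ag) * (gy - g0y) + agh * (ghy - gy).
Proof. ring. Qed.

Section Dedekind.
Variable L : splittingFieldType rat.
Hypothesis galL : galois 1 {:L}.
Local Notation gT := (gal_of {:L}).
Local Notation O := (@Oint L).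
Implicit Types (x y a : L) (g h : gT).
Variables (p : nat).
Hypothesis p_pr : prime p.
Implicit Types (P : prime_over L p).

Lemma primeD P x y : x \in P -> y \in P -> x + y \in P.
Proof. exact: rpredD. Qed.

Definition inertia_set P := [set g : gT | boolp.asbool (inertia P g)]%SET.

Lemma inertiaP P g : reflect (inertia P g) (g \in inertia_set P).
Proof. by rewrite inE; apply: boolp.asboolP. Qed.

Lemma inertia_group P : group_set (inertia_set P).
Proof.
apply/group_setP; split; first by apply/inertiaP=> x Ox; rewrite gal_id subrr rpred0.
move=> g h /inertiaP Ig /inertiaP Ih; apply/inertiaP => x Ox.
rewrite galMx -(subrKA (h x)) -rmorphB rpredD ?Ih //.
by rewrite (inertia_decomp Ih) Ig.
Qed.
Canonical inertia_gr P := Group (inertia_group P).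
Local Notation I P := (inertia_gr P).

Lemma inertia_class P g h x : x \in O -> h \in I P -> (g * h)%g x - g x \in P.
Proof. by move=> Ox /inertiaP Ih; rewrite galMx Ih // Oint_gal. Qed.

(** The proof is the usual one for independence of characters: g1 y - g0 y kills
    the coset of g0 in a relation and spares that of g1. A relation supported on
    one coset, evaluated at 1, reads #|I| a(g0) = 0 modulo P. *)
Lemma dedekind_mod P (a : gT -> L) : coprime #|I P| p -> (forall g, a g \in O) ->
  (forall g h, h \in I P -> a (g * h)%g - a g \in P) ->
  (forall x, x \in O -> \sum_g a g * g x \in P) -> forall g, a g \in P.
Proof.
move=> co_I; pose S (b : gT -> L) := [set g : gT | b g \notin P]%SET.
have [k] := ubnP #|S a|; elim: k a => // k IHk a lt_k Oa Ia sum_a g0.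
apply: contraT => Ng0.
have Ncl g h : h \in I P -> (a (g * h)%g \in P) = (a g \in P).
  by move=> Ih; rewrite -[a (g * h)%g](subrK (a g)) rpredDl ?Ia.
pose C := (g0 *: I P)%g.
have [|no_out] := boolP [exists g1, (a g1 \notin P) && (g1 \notin C)].
  case/existsP=> g1 /andP[Ng1 ne_g01].
  have [y Oy Ny] : exists2 y, y \in O & g1 y - g0 y \notin P.
    have : ~ inertia P (g0^-1 * g1)%g.
      by move/inertiaP; rewrite -mem_lcoset -/C (negPf ne_g01).
    move/boolp.existsNP=> [x /boolp.not_implyP[Ox /negP Nx]].
    exists ((g0^-1)%g x); first by rewrite Oint_gal.
    by rewrite -!galMx mulVg gal_id.
  pose a' g := a g * (g y - g0 y).
  have Oa' g : a' g \in O by rewrite rpredM ?rpredB ?Oint_gal.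
  case/negP: Ny; suffices : a' g1 \in P.
    by rewrite /a' primeM ?(negPf Ng1) // rpredB ?Oint_gal.
  apply: (IHk a') => // [|g h Ih|x Ox].
  - apply: leq_trans (_ : #|S a'| < #|S a|)%N _ => //.
    apply/proper_card/properP; split.
      apply/fintype.subsetP=> g; rewrite !inE; apply: contra => Pa.
      by rewrite primeMr // rpredB ?Oint_gal.
    by exists g0; rewrite inE // negbK /a' subrr mulr0 rpred0.
  - have -> : a' (g * h)%g - a' g
        = (a (g * h)%g - a g) * (g y - g0 y) + a (g * h)%g * ((g * h)%g y - g y).
      exact: dedekind_identity.
    apply: primeD; last by apply: primeMl; [apply: Oa | apply: inertia_class].
    by apply: primeMr; [rewrite rpredB ?Oint_gal | apply: Ia].
  have -> : \sum_g a' g * g x = \sum_g a g * g (y * x) - g0 y * \sum_g a g * g x.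
    rewrite mulr_sumr -sumrB; apply: eq_bigr => g _.
    by rewrite /a' rmorphM mulrBr mulrBl -!mulrA [g0 y * _]mulrCA.
  by rewrite rpredB ?sum_a ?rpredM // primeMl ?sum_a ?Oint_gal.
have:= sum_a 1 (rpred1 _).
rewrite (bigID (fun g => g \in C)) /= rpredDr; last first.
  rewrite rpred_sum // => g Ng; rewrite rmorph1 mulr1.
  move: no_out; rewrite negb_exists => /forallP/(_ g); rewrite Ng andbT negbK //.
have -> : \sum_(g in C) a g * g 1 =
   \sum_(g in C) (a g - a g0) + #|I P|%:R * a g0.
  have -> : #|I P|%:R * a g0 = \sum_(g in C) a g0.
    by rewrite sumr_const card_lcoset mulr_natl.
  by rewrite -big_split; apply: eq_bigr => g _; rewrite rmorph1 mulr1 /= subrK.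
rewrite rpredDl; last first.
  by rewrite rpred_sum // => g /lcosetP[h Ih ->]; apply: Ia.
by rewrite primeM ?rpred_nat // (negPf Ng0) orbF prime_nat //;
  move: co_I; rewrite coprime_sym prime_coprime // => /negPf ->.
Qed.

(** Induction on m: with m - 1 of the x_j chosen, expanding along the remaining
    column gives a relation with a coefficient outside P. *)
Lemma det_indep P m (chi : 'I_m -> L -> L) :
  (forall i x, x \in O -> chi i x \in O) ->
  (forall c : 'I_m -> L, (forall i, c i \in O) ->
     (forall x, x \in O -> \sum_i c i * chi i x \in P) -> forall i, c i \in P) ->
  exists2 x : 'I_m -> L, (forall j, x j \in O) & \det (\matrix_(i, j) chi i (x j)) \notin P.
Proof.
elim: m chi => [|m IHm] chi Ochi indep.
  by exists (fun _ => 0) => [j|]; rewrite ?rpred0 // det_mx00 prime1.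
have [|c Oc sum_c i|x Ox Nx] := IHm (fun i => chi (lift ord0 i)).
- by move=> i y; apply: Ochi.
- pose c' (i : 'I_m.+1) := if unlift ord0 i is Some j then c j else 0.
  have := indep c' _ _ (lift ord0 i); rewrite /c' liftK; apply=> [j|y Oy].
    by case: unliftP => [k _|_]; rewrite ?rpred0.
  rewrite big_ord_recl unlift_none mul0r add0r.
  by rewrite (eq_bigr (fun i => c i * chi (lift ord0 i) y)) ?sum_c // => k _; rewrite liftK.
pose X (y : L) (j : 'I_m.+1) := if unlift ord0 j is Some k then x k else y.
pose M y := \matrix_(i, j) chi i (X y j).
pose c i := cofactor (M 0) i ord0.
have OX y j : y \in O -> X y j \in O by move=> Oy; rewrite /X; case: unliftP.
have Oc i : c i \in O.
  rewrite /c /cofactor rpredM ?rpredX ?rpredN ?rpred1 // rpred_sum // => s _.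
  by rewrite rpredMsign rpred_prod // => j _; rewrite !mxE Ochi ?OX ?rpred0.
have DM y : \det (M y) = \sum_i c i * chi i y.
  rewrite (expand_det_col _ ord0); apply: eq_bigr => i _.
  rewrite mxE /X unlift_none mulrC; congr (_ * _).
  rewrite /c /cofactor; congr (_ * \det _); apply/matrixP=> k l.
  by rewrite !mxE /X liftK.
have [y Oy Ny] : exists2 y, y \in O & \det (M y) \notin P.
  apply: boolp.contrapT => noy; case/negP: Nx.
  suffices : c ord0 \in P.
    rewrite /c /cofactor addn0 expr0 mul1r; congr (\det _ \in P).
    by apply/matrixP=> i j; rewrite !mxE /X liftK.
  apply: indep => // y Oy; rewrite -DM; apply: boolp.contrapT => /negP Ny.
  by apply: noy; exists y.
by exists (X y) => // j; apply: OX.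
Qed.

End Dedekind.

(** * Tame ramification in abelian extensions *)

Fact unif_identity (R : comPzRingType) (sa a b gb pi spi gpi gspi : R) :
  (sa - a) * b * pi = sa * (b * pi - spi) + (sa * spi - gspi)
    + (gspi - gb * gpi) + (gb - b) * gpi + b * (gpi - a * pi).
Proof. ring. Qed.

Section Tame.
Variable L : splittingFieldType rat.
Hypothesis galL : galois 1 {:L}.
Local Notation gT := (gal_of {:L}).
Local Notation O := (@Oint L).
Implicit Types (x y a : L) (g h : gT).
Hypothesis cGG : forall g h, (g * h = h * g)%g.
Variables (p : nat).
Hypothesis p_pr : prime p.
Let p_gt0 := prime_gt0 p_pr.
Local Notation unif := (unif galL p_pr).
Local Notation inv_unif := (inv_unif galL p_pr).
Local Notation level := (level galL p_pr).
Local Notation exact_level := (exact_level galL p_pr).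
Local Notation ramidx := (ramidx galL p_pr).
Implicit Types (P : prime_over L p).
Local Notation I P := (inertia_gr P).

(** t is 1 at P and vanishes at the conjugates of P other than P, which have no
    inclusion between them. *)
Lemma prime_separate P : exists t, [/\ t \in O, t - 1 \in P &
  forall g, t \in conj_prime P g \/ decomp P g].
Proof.
have ex_t g : exists t, [/\ t \in O, t \notin P & t \in conj_prime P g \/ decomp P g].
  have [[t [Gt Nt]]|not_] := boolp.EM (exists t, t \in conj_prime P g /\ t \notin P).
    by exists t; split=> //; [exact: primeO Gt|left].
  exists 1; rewrite rpred1 prime1; split=> //; right => x.
  have sGP y : y \in P -> g y \in P.
    move=> Py; apply: boolp.contrapT => /negP Ny; apply: not_; exists (g y); split=> //.
    by rewrite conj_primeE galKV.
  apply/idP/idP=> [Pgx|]; last exact: sGP.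
  apply: boolp.contrapT => /negP Nx; have Ox : x \in O by have := primeO Pgx; rewrite Oint_gal.
  have [y Oy Pxy] := prime_inv galL p_pr Ox Nx; apply: (negP (prime1 P)).
  rewrite -[1](subKr (g (x * y))) rpredB //.
    by rewrite rmorphM primeMr // Oint_gal.
  by have := sGP _ Pxy; rewrite rmorphB rmorph1.
have [t Ht] := boolp.choice ex_t.
pose u := \prod_g t g.
have Ou : u \in O by apply: rpred_prod => g _; case: (Ht g).
have Nu : u \notin P by apply: prime_prod => g; case: (Ht g).
have [v Ov Puv] := prime_inv galL p_pr Ou Nu.
exists (u * v); split=> //; first exact: rpredM.
move=> g; have [_ _ [Gt|Dg]] := Ht g; [left|by right].
rewrite /u (bigD1 g) // primeMr // primeMr // rpred_prod // => h _; by case: (Ht h).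
Qed.

(** Suppose r < e. Multiply y so that it is divisible by p at the other primes
    above p. For every integer x the trace of y x is then a rational integer in
    P, hence of valuation at least e. Divided by the r-th power of the
    uniformizer it stays in P: this is a relation between the conjugations whose
    coefficients are constant on cosets of the inertia group, so the coefficient
    at 1, of valuation 0, is in P. *)
Lemma ramidx_le_fixed P y r : coprime #|I P| p -> (forall h, h \in I P -> h y = y) ->
  exact_level P r y -> (0 < r)%N -> (ramidx P <= r)%N.
Proof.
move=> co_I fix_y Py r_gt0; set e := ramidx P.
rewrite leqNgt; apply/negP => lt_re.
have [t [Ot Pt Ht]] := prime_separate P.
have IJ h : h \in I P -> inertia P h by move/inertiaP.
pose N := pnorm (I P) t; pose y1 := y * N ^+ e.
have Oy : y \in O by case/andP: Py => /levelO.
have Nt : t \notin P.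
  by apply: contra (prime1 P) => Pt'; rewrite -[1](subKr t) rpredB.
have P0N : exact_level P 0 N.
  by rewrite -(muln0 #|I P|); apply: pnorm_exact_level; rewrite // exact_level0 Ot.
have Py1 : exact_level P r y1.
  by rewrite -[r]addn0 -(muln0 e); apply: exact_levelM => //; apply: exact_levelX.
have fix_y1 h : h \in I P -> h y1 = y1.
  by move=> Ih; rewrite rmorphM rmorphXn /= fix_y // pnorm_fixed.
have Oy1 : y1 \in O by case/andP: Py1 => /levelO.
(* Where g moves P, the factor N^e makes g y1 divisible by p at P. *)
have Dr g : exact_level P r (g y1) \/ g y1 \in level P e.
  have [Dg|NDg] := boolp.EM (decomp P g); first by left; rewrite decomp_exact_level.
  right; rewrite rmorphM levelMl ?Oint_gal // rmorphXn levelX1 // level1.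
  have [Gt|DgV] := Ht (g^-1)%g; last first.
    by case: NDg => x; rewrite -(DgV (g x)) galKV.
  rewrite conj_primeE invgK in Gt.
  by rewrite /N /pnorm (bigD1 1%g) //= gal_id rmorphM primeMr // rmorph_prod rpred_prod // => h _; rewrite !Oint_gal.
clearbody y1; pose b g := inv_unif P ^+ r * g y1.
have Ob g : b g \in O.
  case: (Dr g) => [/andP[Pg _]|Pg]; apply: level_inv_unif => //.
  by apply: level_le Pg; apply: ltnW.
have : b 1%g \in P.
  apply: (@dedekind_mod L p p_pr P b) => // [g h Ih|x Ox].
    by rewrite /b cGG galMx fix_y1 ?subrr ?rpred0.
  have -> : \sum_g b g * g x = inv_unif P ^+ r * gal_trace (y1 * x).
    by rewrite /gal_trace mulr_sumr; apply: eq_bigr => g _; rewrite /b rmorphM mulrA.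
  have [m Dm] := gal_trace_int galL (rpredM Oy1 Ox).
  have Pg g : g y1 \in P.
    case: (Dr g) => [/andP[Pg _]|Pg]; rewrite -(level1 galL p_pr); apply: level_le Pg => //.
    exact: leq_trans lt_re.
  have : gal_trace (y1 * x) \in P.
    rewrite rpred_sum // => g _; rewrite rmorphM.
    by apply: primeMr; [rewrite Oint_gal | apply: Pg].
  rewrite Dm prime_int // => /dvdzP[q ->]; rewrite intrM mulrCA.
  apply: primeMl; first exact: rpred_int.
  rewrite -(level1 galL p_pr); apply: inv_unif_level.
    apply: level_inv_unif; case/andP: (ramidxP galL p_pr P) => Pe _.
    by apply: level_le Pe; apply: ltnW.
  rewrite mulrA -exprD; apply: level_inv_unif; case/andP: (ramidxP galL p_pr P) => Pe _.
  exact: level_le Pe.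
by rewrite /b gal_id; have := exact_level_inv_unif Py1; rewrite exact_level0 => /andP[_ /negP].
Qed.

(** The ramification index even divides #|I|: the norm over I of a uniformizer
    is fixed by I and has valuation #|I|, which [fixed_adjust] reduces modulo e,
    so [ramidx_le_fixed] makes the remainder 0. *)
Lemma ramidx_tame P : coprime #|I P| p -> coprime (ramidx P) p.
Proof.
move=> co_I; set e := ramidx P; apply: coprime_dvdl (co_I).
have IJ h : h \in I P -> inertia P h by move/inertiaP.
have P1 := exact_level_unif galL p_pr P; have := pnorm_exact_level IJ P1; rewrite muln1 => PN.
have fixN h : h \in I P -> h (pnorm (I P) (unif P)) = pnorm (I P) (unif P).
  exact: pnorm_fixed.
have [y [Py fix_y]] := fixed_adjust IJ PN fixN (leq_divM #|I P| e).
have Dr : (#|I P| - #|I P| %/ e * e = #|I P| %% e)%N.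
  by rewrite {1}(divn_eq #|I P| e) addKn.
rewrite Dr in Py; rewrite /dvdn; apply: contraTT isT => nz_r; rewrite -lt0n in nz_r.
have := ramidx_le_fixed co_I fix_y Py nz_r.
by rewrite leqNgt ltn_pmod // ramidx_gt0.
Qed.

(** An element of order p in the inertia group would contradict [ramidx_wild]. *)
Lemma inertia_tame P : coprime (ramidx P) p -> coprime #|I P| p.
Proof.
move=> co_e; rewrite coprime_sym prime_coprime //; apply/negP => dv_p.
have [g Ig og] := Cauchy p_pr dv_p.
have := ramidx_wild (elimT (inertiaP P g) Ig) _ co_e; rewrite -og expg_order.
by move/(_ erefl)=> g1; move: (p_pr); rewrite -og g1 order1.
Qed.

(** On a coset of the inertia group the terms of the trace agree modulo P, and
    their number is a multiple of p. *)
Lemma gal_trace_wild P x : ~~ coprime #|I P| p -> x \in O -> gal_trace x \in P.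
Proof.
rewrite coprime_sym prime_coprime // negbK => dv_p Ox.
have -> : gal_trace x = \sum_(g in [set: gT]) g x by apply: eq_bigl => g; rewrite inE.
rewrite (set_partition_big _ (rcosets_partition (finset.subsetT (I P)))).
rewrite rpred_sum // => _ /rcosetsP[c _ ->].
have -> : \sum_(g in (I P :* c)%g) g x =
   \sum_(g in (I P :* c)%g) (g x - c x) + #|I P|%:R * c x.
  have -> : #|I P|%:R * c x = \sum_(g in (I P :* c)%g) c x.
    by rewrite sumr_const card_rcoset mulr_natl.
  by rewrite -big_split; apply: eq_bigr => g _; rewrite /= subrK.
apply: primeD; last by rewrite primeMr ?Oint_gal // prime_nat.
by rewrite rpred_sum // => g /rcosetP[h Ih ->]; rewrite cGG; apply: inertia_class.
Qed.

Lemma coprime_ramidx_trace P : (exists2 x, x \in O & gal_trace x \notin P) -> coprime (ramidx P) p.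
Proof.
case=> x Ox Nx; apply: ramidx_tame; apply: contraR Nx => w; exact: gal_trace_wild.
Qed.

Lemma level2_unif P x : x \in O -> (x * unif P \in level P 2) = (x \in P).
Proof.
move=> Ox; apply: (@levelS _ _ _ _ _ 1 _ 1); rewrite ?rpred1 ?prime1 //.
  by rewrite rpredM ?unif_O.
by rewrite mul1r expr1 mulrC.
Qed.

Lemma exp_sum_mod n (y : nat -> L) : (forall i, y i \in O) ->
  (\sum_(i < n) y i) ^+ p - \sum_(i < n) y i ^+ p \in modO p%:R.
Proof.
move=> Oy; elim: n => [|n IHn]; first by rewrite !big_ord0 expr0n gtn_eqF // subrr rpred0.
have OS : \sum_(i < n) y i \in O by rewrite rpred_sum.
rewrite !big_ord_recr /= -(subrKA ((\sum_(i < n) y i) ^+ p + y n ^+ p)).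
by rewrite rpredD ?expD_mod // opprD addrACA subrr addr0.
Qed.

Lemma fermat_int (m : int) : (m%:~R : L) ^+ p - m%:~R \in modO p%:R.
Proof.
pose r := `|(m %% p)%Z|%N.
have Dr : (m%:~R : L) - r%:R \in modO p%:R.
  rewrite -[r%:R]/((r%:Z)%:~R) -rmorphB modO_int // /r abszE ger0_norm ?modz_ge0 -?lt0n //.
  by rewrite {1}(divz_eq m p) addrK dvdz_mull.
have Or : (r%:R : L) \in O by rewrite rpred_nat.
rewrite -(subrKA (r%:R ^+ p)) rpredD //; first by rewrite modX ?rpred_int.
rewrite -(subrKA (r%:R)) rpredD //; last by rewrite -opprB rpredN.
have le_r : (r <= r ^ p)%N.
  by have [->|r_gt0] := posnP r; rewrite // -{1}[r]expn1 leq_pexp2l.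
rewrite -natrX -natrB // -[_%:R]/((_%:Z)%:~R) modO_int // dvdzE /=.
by rewrite -eqn_mod_dvd // fermat_little.
Qed.

(** a^p is a root modulo P of the polynomial whose roots are the conjugates of
    a, since its coefficients are rational integers and a is a root. *)
Lemma frob_conj P a : a \in O -> exists s : gT, a ^+ p - s a \in P.
Proof.
move=> Oa; apply: boolp.contrapT => nos.
pose f : {poly L} := \prod_(s : gT) ('X - (s a)%:P).
have fE x : f.[x] = \prod_(s : gT) (x - s a).
  by rewrite /f horner_prod; apply: eq_bigr => s _; rewrite hornerXsubC.
have : f.[a ^+ p] \notin P.
  rewrite fE; apply: prime_prod => s; first by rewrite rpredB ?rpredX ?Oint_gal.
  by apply/negP=> Ps; apply: nos; exists s.
apply/negP; rewrite negbK; apply: (modO_prime P p_pr).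
have fa0 : f.[a] = 0 by rewrite fE (bigD1 1%g) //= gal_id subrr mul0r.
have int_f i : exists m : int, f`_i = m%:~R.
  apply: Oint1v.
    apply: gal_fix1 => // g; rewrite -coef_map; congr ((polyseq _)`_i).
    rewrite /f rmorph_prod [RHS](reindex_inj (mulIg g)); apply: eq_bigr => h _.
    by rewrite rmorphB /= map_polyX map_polyC /= galMx.
  move: i; apply/polyOverP.
  by apply: rpred_prod => s _; rewrite polyOverXsubC Oint_gal.
have Of i : f`_i \in O by have [m ->] := int_f i; rewrite rpred_int.
have := exp_sum_mod (size f) (fun i => rpredM (Of i) (rpredX i Oa)).
rewrite -horner_coef fa0 expr0n gtn_eqF // sub0r rpredN => Df.
rewrite -[f.[_]](subrK (\sum_(i < size f) (f`_i * a ^+ i) ^+ p)) rpredD //.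
rewrite horner_coef -sumrB rpred_sum // => i _.
rewrite exprMn -!exprM mulnC -mulrBl; apply: modOM; first by rewrite rpredX.
by have [m ->] := int_f i; rewrite -opprB rpredN fermat_int.
Qed.

(** Otherwise 0, ..., p - 1 and a would be p + 1 roots of X^p - X that are
    distinct modulo P: their Vandermonde determinant is outside P, although its
    last row is congruent to that of exponent 1. *)
Lemma roots_Fp P a : a \in O -> a ^+ p - a \in P -> exists i : 'I_p, a - i%:R \in P.
Proof.
move=> Oa Pa; apply: boolp.contrapT => noi.
pose r : 'rV[L]_p.+1 := \row_j (if (j < p)%N then j%:R else a).
pose V := Vandermonde p.+1 r.
have VE i j : V i j = r 0 j ^+ i by rewrite mxE.
have Or j : r 0 j \in O by rewrite mxE; case: ifP => *; rewrite ?rpred_nat.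
have rp j : r 0 j ^+ p - r 0 j \in P.
  by rewrite mxE; case: ifP => // _; apply: (modO_prime P p_pr); apply: (fermat_int j).
have /negP : \det V \notin P.
  have Or2 i j : r 0 j - r 0 i \in O by rewrite rpredB.
  rewrite /V det_Vandermonde; apply: prime_prod => i; first by apply: rpred_prod => j _; apply: Or2.
  rewrite big_mkcond; apply: prime_prod => j; case: ifP => lt_ij; rewrite ?rpred1 ?prime1 //.
  rewrite !mxE; have lt_ip : (i < p)%N by apply: leq_trans lt_ij _; rewrite -ltnS.
  rewrite lt_ip; case: ifP => lt_jp; last first.
    by apply/negP=> Pai; apply: noi; exists (Ordinal lt_ip).
  rewrite -natrB ?(ltnW lt_ij) // prime_nat // gtnNdvd ?subn_gt0 //.
  exact: leq_ltn_trans (leq_subr _ _) lt_jp.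
apply; pose k1 : 'I_p.+1 := inord 1.
have k1E : k1 = 1%N :> nat by rewrite inordK // ltnS ltnW // prime_gt1.
have ne_k1 : ord_max != k1.
  by rewrite -val_eqE /= k1E gtn_eqF // prime_gt1.
pose V' := \matrix_(i, j) (if i == ord_max then V k1 j else V i j).
have detV' : \det V' = 0.
  apply: (determinant_alternate ne_k1) => j.
  by rewrite !mxE eqxx eq_sym (negPf ne_k1).
have -> : \det V = \det V - \det V' by rewrite detV' subr0.
rewrite !(expand_det_row _ ord_max) -sumrB rpred_sum // => j _.
have -> : cofactor V' ord_max j = cofactor V ord_max j.
  rewrite /cofactor; congr (_ * \det _); apply/matrixP=> k l.
  by rewrite !mxE eq_sym (negPf (neq_lift _ _)).
rewrite -mulrBl; apply: primeMr.
  rewrite /cofactor rpredM ?rpredX ?rpredN ?rpred1 // rpred_sum // => s _.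
  by rewrite rpredMsign rpred_prod // => k _; rewrite 2!mxE VE rpredX ?Or.
by rewrite [V' _ _]mxE eqxx !VE k1E expr1.
Qed.

(** The residue a of g unif / unif does not depend on the uniformizer, and the
    group is abelian, so a is fixed by the decomposition group modulo P; that
    group contains an element acting as the p-th power, so a lies in the prime
    field. *)
Lemma inertia_unif P g : g \in I P ->
  exists i : 'I_p, g (unif P) - i%:R * unif P \in level P 2.
Proof.
move=> /inertiaP Ig; have Dg := inertia_decomp Ig.
have P1 := exact_level_unif galL p_pr P; have /andP[L1 _] := P1.
have Pg : exact_level P 1 (g (unif P)) by rewrite decomp_exact_level.
have /andP[Lg Ng] := Pg.
have [a Oa Da] := level_expand P1 Lg; rewrite expr1 in Da.
have Na : a \notin P.
  apply: contra Ng => Pa; rewrite -[g _](subrK (a * unif P)) rpredD //.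
  by rewrite level2_unif.
have fix_a s : decomp P s -> s a - a \in P.
  move=> Ds; have Ls : exact_level P 1 (s (unif P)) by rewrite decomp_exact_level.
  have /andP[Ls1 Ns2] := Ls.
  have [b Ob Db] := level_expand P1 Ls1; rewrite expr1 in Db.
  have Nb : b \notin P.
    apply: contra Ns2 => Pb; rewrite -[s _](subrK (b * unif P)) rpredD //.
    by rewrite level2_unif.
  have: (s a - a) * b * unif P \in level P 2.
    have -> : (s a - a) * b * unif P =
       s a * (b * unif P - s (unif P)) + (s a * s (unif P) - s (g (unif P)))
       + (g (s (unif P)) - g b * g (unif P)) + (g b - b) * g (unif P)
       + b * (g (unif P) - a * unif P).
      have -> : s (g (unif P)) = g (s (unif P)) by rewrite -!galMx cGG.
      exact: unif_identity.
    apply: rpredD; last exact: levelMl.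
    apply: rpredD; last first.
      by apply: (@levelM _ galL _ p_pr P 1 1) => //; rewrite level1 Ig.
    apply: rpredD; last by rewrite -rmorphM -rmorphB decomp_level.
    apply: rpredD; last by rewrite -opprB rpredN -rmorphM -rmorphB decomp_level.
    by apply: levelMl; rewrite ?Oint_gal // -opprB rpredN.
  have Osa : s a - a \in O by rewrite rpredB ?Oint_gal.
  by rewrite level2_unif ?rpredM // primeM // (negPf Nb) orbF.
have [t [Ot Pt Ht]] := prime_separate P.
(* Multiplying by t forces the conjugation of [frob_conj] into the decomposition
   group. *)
pose a1 := t * a.
have Oa1 : a1 \in O by rewrite rpredM.
have Paa1 : a1 - a \in P.
  by rewrite /a1 -[X in _ - X]mul1r -mulrBl; apply: primeMr.
have Na1 : a1 \notin P by apply: contra Na => Pa1; rewrite -(subKr a1 a) rpredB.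
have [s Ps] := frob_conj P Oa1.
have Ds : decomp P s.
  have [|DsV] := Ht (s^-1)%g; last by move=> x; rewrite -(DsV (s x)) galKV.
  rewrite conj_primeE invgK => Pst; case/negP: Na1.
  have : a1 ^+ p \in P.
    rewrite -[a1 ^+ p](subrK (s a1)); apply: primeD => //.
    by rewrite /a1 rmorphM; apply: primeMr => //; rewrite Oint_gal.
  by rewrite primeX // => /andP[].
have Pap : a ^+ p - a \in P.
  have -> : a ^+ p - a = (a ^+ p - a1 ^+ p) + (a1 ^+ p - s a1) + (s (a1 - a)) + (s a - a).
    by rewrite rmorphB addrA subrKA subrKA subrK.
  apply: primeD; last exact: fix_a.
  apply: primeD; last by rewrite Ds.
  apply: primeD => //; rewrite -opprB rpredN subrXX; apply: primeMr => //.
  by rewrite rpred_sum // => i _; rewrite rpredM ?rpredX.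
have [i Pi] := roots_Fp Oa Pap; exists i.
rewrite -(subrKA (a * unif P)) -mulrBl; apply: rpredD => //.
by rewrite level2_unif // (primeO Pi).
Qed.

(** By [tame_inj] the inertia group embeds in the multiplicative group of the
    prime field. *)
Lemma inertia_bound P : coprime #|I P| p -> (#|I P| <= p.-1)%N.
Proof.
move=> co_I.
have ex_c g : exists i : 'I_p, g \in I P -> g (unif P) - i%:R * unif P \in level P 2.
  have [Ig|NIg] := boolP (g \in I P); last by exists (Ordinal p_gt0).
  by have [i Hi] := inertia_unif Ig; exists i.
have [c Hc] := fin_all_exists ex_c.
have L1 := exact_level_unif galL p_pr P.
have inj_c : {in I P &, injective c}.
  move=> g h Ig Ih eq_c; apply/eqP; rewrite eq_mulgV1; apply/eqP.
  have Igh : (g * h^-1)%g \in I P by rewrite groupM ?groupV.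
  apply: (tame_inj (elimT (inertiaP _ _) Igh)).
    by apply: coprime_dvdl co_I; apply: order_dvdG.
  have /inertiaP/inertia_decomp DhV : (h^-1)%g \in I P by rewrite groupV.
  have -> : (g * h^-1)%g (unif P) - unif P = (h^-1)%g (g (unif P) - h (unif P)).
    by rewrite rmorphB /= galKV galMx.
  rewrite decomp_level // -(subrKA ((c g)%:R * unif P)); apply: rpredD; first exact: Hc.
  by rewrite -opprB rpredN eq_c; apply: Hc.
have nz_c g : g \in I P -> c g != Ordinal p_gt0.
  move=> Ig; apply/eqP=> c0; have := Hc g Ig; rewrite c0 mul0r subr0.
  have Dg := inertia_decomp (elimT (inertiaP _ _) Ig).
  by rewrite decomp_level //; case/andP: L1 => _ /negP.
have -> : p.-1 = #|predC1 (Ordinal p_gt0)| by rewrite cardC1 card_ord.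
rewrite -(card_in_imset inj_c).
by apply/subset_leq_card/fintype.subsetP=> _ /imsetP[g Ig ->]; rewrite inE nz_c.
Qed.

Section Unramified.
Variables (P : prime_over L p) (H : {group gT}) (m : nat).
Variables (c : 'I_m -> gT) (idx : gT -> 'I_m).
Hypothesis sIH : I P \subset H.
Hypothesis co_I : coprime #|I P| p.
Hypothesis idxP : forall g i, (g \in H :* c i)%g = (idx g == i).

(** As H contains the inertia group, the cosets of H are distinct as characters
    modulo P of the field fixed by H. In other words P does not divide the
    discriminant of that field. *)
Lemma unramified_det : exists2 x : 'I_m -> L, (forall j, x j \in O) &
  \det (\matrix_(i, j) c i (\sum_(h in H) h (x j))) \notin P.
Proof.
have [i x Ox|a Oa sum_a i|x Ox Nx] :=
    @det_indep L p P m (fun i x => c i (\sum_(h in H) h x)).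
- by rewrite Oint_gal rpred_sum // => h _; rewrite Oint_gal.
- have := @dedekind_mod L p p_pr P (fun g => a (idx g)) co_I _ _ _ (c i).
  have idx_c j : idx (c j) = j by apply/eqP; rewrite -idxP rcoset_refl.
  rewrite idx_c; apply=> [g|g h Ih|x Ox] //.
    suffices -> : idx (g * h)%g = idx g by rewrite subrr rpred0.
    apply/eqP; rewrite -idxP cGG mem_rcoset -mulgA groupM //.
      exact: (fintype.subsetP sIH).
    by rewrite -mem_rcoset idxP.
  rewrite (partition_big idx predT) //=.
  rewrite (eq_bigr (fun i => a i * c i (\sum_(h in H) h x))) ?sum_a // => j _.
  rewrite rmorph_sum mulr_sumr (reindex_inj (mulIg (c j))) /=.
  have idx_h h : (idx (h * c j)%g == j) = (h \in H) by rewrite -idxP mem_rcoset mulgK.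
  apply: eq_big => // h; first by rewrite galMx => /eqP->.
by exists x.
Qed.

End Unramified.

End Tame.

(** * Small values of unimodular linear forms *)

Lemma absz_unit_int (z : int) : z \is a GRing.unit -> `|z|%N = 1%N.
Proof. by rewrite qualifE => /orP[] /eqP->. Qed.

Lemma dist_ord_le (a b s : nat) : (a <= s)%N -> (b <= s)%N -> (`|a%:Z - b%:Z| <= s)%N.
Proof.
move=> le_as le_bs; have [le_ab|/ltnW le_ba] := leqP a b.
  by rewrite IntDist.distnEr // (leq_trans (leq_subr _ _)).
by rewrite IntDist.distnEl // (leq_trans (leq_subr _ _)).
Qed.

(** By the Smith normal form the image of B has index |det B| in Z^n, fewer than
    the number of vectors with coordinates in 0, ..., s. Two such vectors are
    congruent, and their difference is the image of m. *)
Lemma lattice_pigeonhole n (B : 'M[int]_n) (s : nat) : \det B != 0 ->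
  (`|\det B| < s.+1 ^ n)%N ->
  exists2 m : 'cV[int]_n, m != 0 & forall i, (`|(B *m m) i ord0| <= s)%N.
Proof.
move=> nz_B ltBs; have [L uL [R uR [d _ DB]]] := int_Smith_normal_form B.
set D := \matrix_(i, j) _ in DB.
pose e (i : 'I_n) : int := d`_i.
have detD : \det D = \prod_(i < n) e i.
  have -> : D = diag_mx (\row_i d`_i).
    by apply/matrixP=> i j; rewrite !mxE.
  by rewrite det_diag; apply: eq_bigr => i _; rewrite mxE.
have absB : `|\det B|%N = (\prod_(i < n) `|e i|)%N.
  have [uL1 uR1] : \det L \is a GRing.unit /\ \det R \is a GRing.unit by rewrite -!unitmxE.
  rewrite DB !det_mulmx !abszM (absz_unit_int uL1) (absz_unit_int uR1) muln1 mul1n detD.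
  exact: (big_morph absz abszM absz1).
have nz_d (i : 'I_n) : e i != 0.
  apply: contraNneq nz_B => d0; rewrite DB !det_mulmx detD (bigD1 i) //= d0.
  by rewrite mul0r mulr0 mul0r.
pose N := (\sum_(i < n) `|e i|)%N.
pose vec (v : {ffun 'I_n -> 'I_s.+1}) : 'cV[int]_n := \col_i (v i : nat)%:Z.
pose w v := invmx L *m vec v.
pose f v : {ffun 'I_n -> 'I_N.+1} := [ffun i => inord `|(w v i ord0 %% e i)%Z|%N].
have lt_mod v i : (`|(w v i ord0 %% e i)%Z| < `|e i|)%N.
  by rewrite -ltz_nat !abszE ger0_norm ?modz_ge0 // ltz_mod.
have le_dN (i : 'I_n) : (`|e i| <= N)%N by rewrite /N (bigD1 i) //= leq_addr.
have fE v i : f v i = `|(w v i ord0 %% e i)%Z|%N :> nat.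
  by rewrite ffunE inordK // (leq_trans (lt_mod v i)) // (leq_trans (le_dN i)).
pose F (i : 'I_n) := [pred k : 'I_N.+1 | (k < `|e i|)%N].
have cardF : #|family F| = `|\det B|%N.
  rewrite card_family foldrE big_map big_enum /= absB; apply: eq_bigr => i _.
  rewrite -sum1_card (big_ord_narrow (leqW (le_dN i))) /=.
  by rewrite sum_nat_const card_ord muln1.
have [v [v' [ne_v eq_f]]] : exists v v', v != v' /\ f v = f v'.
  have [/injectiveP inj|/injectivePn[v [v' ne_v eq_f]]] := boolP (injectiveb f); last by exists v, v'.
  suffices : (#|{: {ffun 'I_n -> 'I_s.+1}}| <= #|family F|)%N.
    by rewrite cardF card_ffun !card_ord leqNgt ltBs.
  rewrite -(card_image inj); apply/subset_leq_card/fintype.subsetP=> _ /fintype.imageP[u _ ->].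
  by apply/familyP=> i; rewrite inE fE.
have /fin_all_exists[q Dq] i : exists q, w v i ord0 - w v' i ord0 = q * e i.
  apply/dvdzP; rewrite -eqz_mod_dvd; apply/eqP.
  have := congr1 Posz (fE v i); rewrite eq_f fE.
  by rewrite !abszE !ger0_norm ?modz_ge0.
pose y : 'cV[int]_n := \col_i q i.
have DBm : B *m (invmx R *m y) = vec v - vec v'.
  rewrite DB -!mulmxA (mulmxA R) mulmxV // mul1mx.
  have -> : D *m y = w v - w v'.
    apply/matrixP=> i j; rewrite ord1 !mxE (bigD1 i) //= big1 ?addr0 => [|k ne_k].
      by rewrite !mxE eqxx -mulr_natr mulr1; have := Dq i; rewrite !mxE => ->; rewrite mulrC.
    by rewrite !mxE eq_sym (negPf (ne_k : k != i :> nat)) mulr0n mul0r.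
  by rewrite mulmxBr !mulmxA mulmxV // !mul1mx.
exists (invmx R *m y).
  apply: contraNneq ne_v => m0; have /matrixP E := DBm; apply/eqP/ffunP=> i.
  have := E i ord0; rewrite m0 mulmx0 !mxE => /esym/eqP; rewrite subr_eq0 => /eqP[].
  exact: val_inj.
move=> i; rewrite DBm !mxE.
by apply: dist_ord_le; rewrite -ltnS.
Qed.

Section Minkowski.
Variable R : realType.
Implicit Types (f g : nat -> R) (l k : R).

Definition tends_to f l := forall eps, 0 < eps -> exists N, forall n, (N <= n)%N -> `|f n - l| < eps.

Lemma tends_cst l : tends_to (fun=> l) l.
Proof. by move=> eps e_gt0; exists 0%N => n _; rewrite subrr normr0. Qed.

Lemma tends_ext f g l : f =1 g -> tends_to f l -> tends_to g l.
Proof. by move=> eq_fg Tf e /Tf[N HN]; exists N => n /HN; rewrite eq_fg. Qed.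

Lemma tendsD f g l k : tends_to f l -> tends_to g k -> tends_to (fun n => f n + g n) (l + k).
Proof.
move=> Tf Tg e e_gt0; have e2 : 0 < e / 2 by rewrite divr_gt0.
have [N HN] := Tf _ e2; have [M HM] := Tg _ e2.
exists (maxn N M) => n; rewrite geq_max => /andP[/HN h1 /HM h2].
rewrite opprD addrACA (le_lt_trans (ler_normD _ _)) //; lra.
Qed.

Lemma tendsM f g l k : tends_to f l -> tends_to g k -> tends_to (fun n => f n * g n) (l * k).
Proof.
move=> Tf Tg e e_gt0; pose c := `|l| + `|k| + 1.
have l_ge0 := normr_ge0 l; have k_ge0 := normr_ge0 k.
have c_gt0 : 0 < c by rewrite /c; lra.
pose e1 := Num.min 1 (e / (2 * c)).
have e1_gt0 : 0 < e1 by rewrite lt_min ltr01 divr_gt0 // mulr_gt0.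
have e1_le1 : e1 <= 1 by rewrite ge_min lexx.
have e1_c : e1 * c <= e / 2.
  rewrite -ler_pdivlMr // [leRHS](_ : _ = e / (2 * c)) ?ge_min ?lexx ?orbT //.
  by rewrite invfM mulrA.
have [N HN] := Tf _ e1_gt0; have [M HM] := Tg _ e1_gt0.
exists (maxn N M) => n; rewrite geq_max => /andP[/HN h1 /HM h2].
have -> : f n * g n - l * k = (f n - l) * (g n - k) + (f n - l) * k + l * (g n - k) by ring.
apply: le_lt_trans (ler_normD _ _) _; rewrite normrM.
apply: le_lt_trans (lerD (ler_normD _ _) (lexx _)) _; rewrite !normrM.
set x := `|f n - l| in h1 *; set y := `|g n - k| in h2 *.
have x_ge0 : 0 <= x by apply: normr_ge0.
have y_ge0 : 0 <= y by apply: normr_ge0.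
have : x * y <= e1 by rewrite -[e1]mulr1; apply: ler_pM => //; [apply: ltW | apply: le_trans (ltW h2) _].
have : x * `|k| <= e1 * `|k| by rewrite ler_wpM2r // ltW.
have : `|l| * y <= `|l| * e1 by rewrite ler_wpM2l // ltW.
move: e1_c; rewrite /c; nra.
Qed.

Lemma tends_sum (I : Type) (r : seq I) (F : I -> nat -> R) (l : I -> R) :
  (forall i, tends_to (F i) (l i)) -> tends_to (fun n => \sum_(i <- r) F i n) (\sum_(i <- r) l i).
Proof.
move=> TF; elim: r => [|i r IHr].
  by rewrite big_nil; apply: tends_ext (tends_cst 0) => n; rewrite big_nil.
by rewrite big_cons; apply: tends_ext (tendsD (TF i) IHr) => n; rewrite big_cons.
Qed.

Lemma tends_prod (I : Type) (r : seq I) (F : I -> nat -> R) (l : I -> R) :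
  (forall i, tends_to (F i) (l i)) -> tends_to (fun n => \prod_(i <- r) F i n) (\prod_(i <- r) l i).
Proof.
move=> TF; elim: r => [|i r IHr].
  by rewrite big_nil; apply: tends_ext (tends_cst 1) => n; rewrite big_nil.
by rewrite big_cons; apply: tends_ext (tendsM (TF i) IHr) => n; rewrite big_cons.
Qed.

Lemma tends_det n (M : nat -> 'M[R]_n) (A : 'M[R]_n) :
  (forall i j, tends_to (fun q => M q i j) (A i j)) -> tends_to (fun q => \det (M q)) (\det A).
Proof.
move=> TM; apply: tends_sum => s; apply: tendsM; first exact: tends_cst.
exact: tends_prod.
Qed.

Lemma tends_adj n (M : nat -> 'M[R]_n) (A : 'M[R]_n) :
  (forall i j, tends_to (fun q => M q i j) (A i j)) ->
  forall i j, tends_to (fun q => (\adj (M q)) i j) ((\adj A) i j).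
Proof.
move=> TM i j; rewrite mxE; apply: (@tends_ext (fun q => cofactor (M q) j i)).
  by move=> q; rewrite mxE.
apply: tendsM; first exact: tends_cst.
by apply: tends_det => k l; rewrite !mxE; apply: tends_ext (TM _ _) => q; rewrite !mxE.
Qed.

Lemma tends_fin (I : finType) (f : I -> nat -> R) (l : I -> R) eps : 0 < eps ->
  (forall i, tends_to (f i) (l i)) ->
  exists N, forall i n, (N <= n)%N -> `|f i n - l i| < eps.
Proof.
move=> e_gt0 Tf; have /fin_all_exists[N HN] i := Tf i eps e_gt0.
exists (\max_i N i) => i n le_n; apply: HN; apply: leq_trans le_n.
exact: (leq_bigmax i).
Qed.

(** The linear forms theorem of Minkowski, up to eps. The forms are approximated
    by the integral forms floor(q A), to which the pigeonhole applies, and A m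
    is recovered from its approximation with the adjugate matrix. *)
Lemma minkowski n (A : 'M[R]_n) (eps : R) : (0 < n)%N -> `|\det A| = 1 -> 0 < eps <= 1 ->
  exists2 m : 'I_n -> int, (exists i, m i != 0) &
    forall i, `|\sum_j A i j * (m j)%:~R| <= 1 + eps.
Proof.
move=> n_gt0 detA /andP[e_gt0 e_le1].
pose M q : 'M[R]_n := \matrix_(i, j) ((Num.floor (q.+1%:R * A i j))%:~R / q.+1%:R).
have TM i j : tends_to (fun q => M q i j) (A i j).
  move=> d d_gt0; exists (Num.bound d^-1) => q le_q.
  rewrite mxE; have q_gt0 : 0 < q.+1%:R :> R by rewrite ltr0n.
  have /andP[h1 h2] := floor_itv (q.+1%:R * A i j).
  rewrite distrC ger0_norm; last first.
    by rewrite subr_ge0 ler_pdivrMr // [leRHS]mulrC.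
  have : A i j - (Num.floor (q.+1%:R * A i j))%:~R / q.+1%:R <= q.+1%:R^-1.
    rewrite lerBlDr -[X in _ <= X + _]mul1r -mulrDl ler_pdivlMr // [leLHS]mulrC addrC.
    by rewrite ltW // -[1]/(1%:~R) -intrD.
  move/le_lt_trans; apply; rewrite invf_plt ?posrE //.
  apply: le_lt_trans (_ : (Num.bound d^-1)%:R < _); last by rewrite ltr_nat ltnS.
  have := archi_boundP (ltW (_ : 0 < d^-1)); rewrite invr_gt0 => /(_ d_gt0) h.
  exact: ltW h.
(* Room for an error eta in the determinant, in the bound s / q and in each of
   the n entries of A times the adjugate. *)
pose eta := eps / (2 * n + 3)%:R.
have n3_gt0 : 0 < (2 * n + 3)%:R :> R by rewrite ltr0n addn3.
have eta_gt0 : 0 < eta by rewrite divr_gt0.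
have Deta : (2 * n%:R + 3) * eta = eps.
  by rewrite /eta natrD natrM mulrC mulfVK // -natrM -natrD gt_eqF.
have n_ge1 : 1 <= n%:R :> R by rewrite ler1n.
have eta_lt1 : eta < 1 by nra.
have [N1 HN1] := tends_det TM eta_gt0.
have [N2 HN2] : exists N, forall (ij : 'I_n * 'I_n) q, (N <= q)%N ->
    `|(A *m \adj (M q)) ij.1 ij.2 - (A *m \adj A) ij.1 ij.2| < eta.
  apply: (@tends_fin _ (fun ij q => (A *m \adj (M q)) ij.1 ij.2)) => // ij.
  rewrite mxE; apply: (@tends_ext (fun q => \sum_k A ij.1 k * (\adj (M q)) k ij.2)).
    by move=> q; rewrite mxE.
  by apply: tends_sum => k; apply: tendsM; [apply: tends_cst|apply: tends_adj].
pose q := maxn N1 N2; have {HN1} := HN1 q (leq_maxl _ _).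
have {}HN2 ij := HN2 ij q (leq_maxr _ _).
set Aq := M q in HN2 * => Hdet; set Q : R := q.+1%:R.
have Q_gt0 : 0 < Q by rewrite ltr0n.
pose B : 'M[int]_n := \matrix_(i, j) Num.floor (Q * A i j).
have DB : map_mx intr B = Q *: Aq.
  by apply/matrixP=> i j; rewrite !mxE [RHS]mulrC divfK // gt_eqF.
have detB : (\det B)%:~R = Q ^+ n * \det Aq.
  by rewrite -detZ -DB det_map_mx.
have detAq1 : `|\det Aq| < 1 + eta.
  by rewrite -detA -[\det Aq](subrK (\det A)) (le_lt_trans (ler_normD _ _)) // addrC ltrD2l.
have detAq2 : 1 - eta < `|\det Aq|.
  rewrite -detA ltrBlDl -[\det A](subKr (\det Aq)) -opprB opprB.
  by rewrite (le_lt_trans (ler_normB _ _)) // addrC ltrD2r.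
pose s := Num.truncn (Q * (1 + eta)).
have Q1 : 0 <= Q * (1 + eta) by rewrite mulr_ge0 ?ltW // addr_gt0.
have /andP[s1 s2] := truncn_itv Q1; rewrite -/s in s1 s2.
have [||m nz_m Hm] := @lattice_pigeonhole n B s.
- rewrite -(intr_eq0 R) detB mulf_neq0 //; first by rewrite expf_neq0 // lt0r_neq0.
  by rewrite -normr_gt0; apply: lt_trans detAq2; rewrite subr_gt0.
- rewrite -(ltr_nat R) natrX natr_absz intr_norm detB normrM gtr0_norm ?exprn_gt0 //.
  apply: le_lt_trans (_ : (Q * (1 + eta)) ^+ n < _); last first.
    by rewrite ltrXn2r ?gtn_eqF // -?lt0n // ltW // (le_lt_trans _ s2).
  rewrite exprMn ler_wpM2l ?exprn_ge0 ?(ltW Q_gt0) // (le_trans (ltW detAq1)) //.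
  by rewrite -{1}[1 + eta]expr1 ler_weXn2l //; lra.
exists (fun i => m i ord0).
  by case/cV0Pn: nz_m => i nz_mi; exists i.
pose mR : 'cV[R]_n := map_mx intr m; pose t := Aq *m mR.
have Dt i : `|t i ord0| <= 1 + eta.
  have -> : t i ord0 = Q^-1 * ((B *m m) i ord0)%:~R.
    have -> : ((B *m m) i ord0)%:~R = (map_mx intr (B *m m)) i ord0 :> R by rewrite [RHS]mxE.
    by rewrite map_mxM DB -scalemxAl [in RHS]mxE mulKf // gt_eqF.
  rewrite normrM gtr0_norm ?invr_gt0 // ler_pdivrMl // (le_trans _ s1) //.
  by rewrite -intr_norm -abszE -[(absz _)%:~R]/((absz _)%:R) ler_nat.
move=> i; have -> : \sum_j A i j * (m j ord0)%:~R = (A *m mR) i ord0.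
  by rewrite mxE; apply: eq_bigr => j _; rewrite mxE.
have Dm : \det Aq *: (A *m mR) = (A *m \adj Aq) *m t.
  by rewrite /t -!mulmxA (mulmxA (\adj Aq)) mul_adj_mx mul_scalar_mx -scalemxAr.
have : `|\det Aq| * `|(A *m mR) i ord0| <= (1 + n%:R * eta) * (1 + eta).
  rewrite -normrM -[X in `|X|](_ : (\det Aq *: (A *m mR)) i ord0 = _); last by rewrite mxE.
  rewrite Dm mxE (le_trans (ler_norm_sum _ _ _)) //.
  apply: le_trans (_ : \sum_j ((i == j)%:R + eta) * (1 + eta) <= _).
    apply: ler_sum => j _; rewrite normrM ler_pM //.
    have := HN2 (i, j); rewrite /= mul_mx_adj mxE.
    move/ltW => h; have -> : (i == j)%:R = `|(\det A *+ (i == j))| :> R.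
      by case: (i == j); rewrite ?mulr1n ?mulr0n ?detA ?normr0.
    rewrite -[X in `|X|](subrK (\det A *+ (i == j))) (le_trans (ler_normD _ _)) //.
    by rewrite [leRHS]addrC lerD2r; move: h; rewrite mxE.
  rewrite -mulr_suml ler_wpM2r ?addr_ge0 // ?(ltW eta_gt0) //.
  rewrite big_split /= (bigD1 i) //= eqxx big1 ?addr0 => [|j ne_j]; last first.
    by rewrite eq_sym (negPf ne_j).
  by rewrite lerD2l sumr_const card_ord mulr_natl.
set X := `|(A *m mR) i ord0|; have X_ge0 : 0 <= X by apply: normr_ge0.
move=> HX.
have : (1 - eta) * X <= (1 + n%:R * eta) * (1 + eta).
  by apply: le_trans HX; rewrite ler_wpM2r // ltW.
rewrite leNgt => /negP h; rewrite leNgt; apply/negP => h'; apply: h.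
apply: lt_le_trans (_ : (1 - eta) * (1 + eps) <= _); last first.
  by rewrite ler_wpM2l // ltW //; lra.
nra.
Qed.

End Minkowski.

(** * Homomorphisms between number fields *)

Section Homs.
Variable K : fieldExtType rat.

Lemma primitive_element : exists theta : K, <<1; theta>>%VS = {:K}%VS.
Proof.
exists (separable_generator 1%AS {:K}%AS).
rewrite -eq_adjoin_separable_generator ?sub1v //.
apply/separableP => y _; apply: pcharf0_separable.
by move=> p; rewrite !inE; apply/negbTE/andP=> -[/prime_gt0/(natK_neq0 K)/negPf->].
Qed.

Variables (F : fieldType) (phi : {rmorphism rat -> F}) (theta : K) (z : F).
Hypothesis gen_theta : <<1; theta>>%VS = {:K}%VS.
Variable mu : {poly rat}.
Hypothesis Dmu : minPoly 1 theta = map_poly (in_alg K) mu.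
Hypothesis mu_z : root (map_poly phi mu) z.

Let horn_ex x : exists q : {poly rat}, (map_poly (in_alg K) q).[theta] = x.
Proof.
have /Fadjoin_polyP[q /polyOver1P[r ->] ->] : x \in <<1; theta>>%VS by rewrite gen_theta memvf.
by exists r.
Qed.

Let rep x : {poly rat} := sval (sig_eqW (horn_ex x)).
Let repE x : (map_poly (in_alg K) (rep x)).[theta] = x.
Proof. by rewrite /rep; case: sig_eqW. Qed.

Let rep0 q : (map_poly (in_alg K) q).[theta] = 0 -> (map_poly phi q).[z] = 0.
Proof.
move=> q0; have: minPoly 1 theta %| map_poly (in_alg K) q.
  by apply: minPoly_dvdp; [apply/polyOver1P; exists q | apply/rootP].
rewrite Dmu dvdp_map => /dvdpP[r ->].
by rewrite rmorphM hornerM (rootP mu_z) mulr0.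
Qed.

Let rep_eq q x : (map_poly (in_alg K) q).[theta] = x -> (map_poly phi q).[z] = (map_poly phi (rep x)).[z].
Proof.
move=> Dq; apply/eqP; rewrite -subr_eq0 -hornerN -hornerD -rmorphB; apply/eqP/rep0.
by rewrite rmorphB hornerD hornerN Dq repE subrr.
Qed.

(** K is the quotient of the rational polynomials by the minimal polynomial of
    theta. *)
Lemma extend_hom : exists f : {rmorphism K -> F}, f theta = z.
Proof.
pose f x := (map_poly phi (rep x)).[z].
have fB : zmod_morphism f.
  move=> x y; rewrite /f -hornerN -hornerD -rmorphB; apply/esym/rep_eq.
  by rewrite rmorphB hornerD hornerN !repE.
have fM : monoid_morphism f.
  split=> [|x y].
    by rewrite /f -(@rep_eq 1) ?rmorph1 ?hornerC.
  rewrite /f -hornerM -rmorphM; apply/esym/rep_eq.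
  by rewrite rmorphM hornerM !repE.
pose fA := GRing.isZmodMorphism.Build K F f fB.
pose fMm := GRing.isMonoidMorphism.Build K F f fM.
pose fR : {rmorphism K -> F} := HB.pack f fA fMm.
exists fR; rewrite /fR /= /f -(@rep_eq 'X) ?map_polyX ?hornerX //.
Qed.

End Homs.

Lemma embedding_exists (C : numClosedFieldType) (K : fieldExtType rat) : inhabited {rmorphism K -> C}.
Proof.
have [theta gen] := primitive_element K.
have /polyOver1P[mu Dmu] := minPolyOver 1%AS theta.
have /closed_rootP[z mu_z] : size (map_poly (ratr : rat -> C) mu) != 1%N.
  rewrite size_map_poly; have := size_minPoly 1%AS theta; rewrite Dmu size_map_poly => ->.
  by [].
by have [f _] := extend_hom gen Dmu mu_z; constructor.
Qed.

(** f' theta is a root of the image under f of the product of the X - g theta, a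
    rational polynomial. *)
Lemma embedding_gal (L : splittingFieldType rat) (F : fieldType) (f f' : {rmorphism L -> F}) :
  galois 1 {:L} -> exists g : gal_of {:L}, forall x, f' x = f (g x).
Proof.
move=> galL; have [theta gen] := primitive_element L.
pose p := \prod_(g : gal_of {:L}) ('X - (g theta)%:P).
have /polyOver1P[q Dq] : p \is a polyOver 1%VS.
  apply/polyOverP=> i; apply: (gal_fix1 galL) => g; rewrite -coef_map /=.
  congr (_`_i); rewrite /p rmorph_prod /=; congr polyseq.
  rewrite [RHS](reindex_inj (mulIg g)) /=; apply: eq_bigr => h _.
  by rewrite rmorphB /= map_polyX map_polyC /= galMx.
have f_alg (a : rat) : f a%:A = f' a%:A.
  by rewrite !alg_num_field !fmorph_rat.
have /eqP : (map_poly f p).[f' theta] = 0.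
  have -> : map_poly f p = map_poly f' p.
    rewrite Dq -!map_poly_comp; apply: eq_map_poly => a; exact: f_alg.
  rewrite horner_map /p horner_prod (bigD1 1%g) //= !hornerE gal_id subrr mul0r rmorph0 //.
rewrite rmorph_prod horner_prod => /prodf_eq0[/= g _].
rewrite rmorphB /= map_polyX map_polyC /= !hornerE subr_eq0 => /eqP Dg.
exists g => x; have /Fadjoin_polyP[r /polyOver1P[s ->] ->] : x \in <<1; theta>>%VS by rewrite gen memvf.
rewrite -!horner_map /= -!map_poly_comp Dg; congr (_.[_]).
by apply: eq_map_poly => a /=; rewrite !rmorph_alg f_alg.
Qed.

(** * Unramified extensions of prime degree *)

Section Small.
Variable R : realFieldType.

Lemma bernoulli (e : R) k : 0 <= e <= 1 -> 1 - k%:R * e <= (1 - e) ^+ k.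
Proof.
move=> /andP[e_ge0 e_le1]; elim: k => [|k IHk]; first by rewrite mul0r subr0.
rewrite exprS; have h : (1 - e) * (1 - k%:R * e) <= (1 - e) * (1 - e) ^+ k.
  by rewrite ler_wpM2l // subr_ge0.
apply: le_trans h; rewrite -natr1; have := ler0n R k; nra.
Qed.

(** The product being at least 1, x_0 is nearly at least 2 in absolute value, so
    x_0^2 - 4 is nearly 0 while the other factors are at most 4. *)
Lemma prod_small n (x : 'I_n -> R) (i0 i1 : 'I_n) (e : R) : i0 != i1 ->
  0 < e -> 8 * n.+1%:R * 4 ^+ n * e < 1 ->
  `|x i0| <= 2 * (1 + e) -> `|x i1| <= (1 + e) / 2 ->
  (forall i, i != i0 -> i != i1 -> `|x i| <= 1 + e) ->
  1 <= \prod_i `|x i| -> \prod_i `|x i ^+ 2 - 4| < 1.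
Proof.
move=> ne01 e_gt0 e_small x0 x1 xi N1.
have n1 : 2 <= n.+1%:R :> R by rewrite ler_nat ltnS (leq_ltn_trans _ (ltn_ord i0)).
have p4 : 1 <= 4 ^+ n :> R by rewrite exprn_ege1 // ler1n.
pose a := n.+1%:R * e; have a_gt0 : 0 < a by rewrite mulr_gt0 ?ltr0n.
have e_le_a : 2 * e <= a by rewrite /a ler_wpM2r // ltW.
have a_small : 8 * a * 4 ^+ n < 1 by rewrite /a; apply: le_lt_trans e_small; rewrite le_eqVlt; apply/orP; left; apply/eqP; ring.
have a_lt1 : 8 * a < 1.
  by apply: le_lt_trans a_small; rewrite ler_peMr // mulr_ge0 // ltW.
have x0_ge : 2 * (1 - a) <= `|x i0|.
  have le_e : \prod_(i | i != i0) `|x i| <= (1 + e) ^+ n.+1 / 2.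
    rewrite (bigD1 i1) 1?eq_sym //= exprS mulrAC ler_pM ?prodr_ge0 //.
    apply: le_trans (_ : \prod_(i | (i != i0) && (i != i1)) (1 + e) <= _).
      by apply: ler_prod => i /andP[h1 h2]; rewrite normr_ge0 xi.
    rewrite prodr_const ler_weXn2l ?lerDl ?ltW //.
    by rewrite -[X in (_ <= X)%N]card_ord max_card.
  have h : 1 <= `|x i0| * ((1 + e) ^+ n.+1 / 2).
    by apply: le_trans N1 _; rewrite (bigD1 i0) //= ler_wpM2l.
  have b : 1 - a <= (1 - e) ^+ n.+1 by apply: bernoulli; lra.
  have c : (1 - e) ^+ n.+1 * (1 + e) ^+ n.+1 <= 1.
    rewrite -exprMn exprn_ile1 //; nra.
  have d : 0 <= (1 - e) ^+ n.+1 by rewrite exprn_ge0 //; lra.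
  have := ler_wpM2l d h; rewrite mulr1.
  move: ((1 - e) ^+ n.+1) ((1 + e) ^+ n.+1) b c d => u v b c d h'.
  have : `|x i0| * (u * v) <= `|x i0| by rewrite ler_piMr.
  have -> : `|x i0| * (u * v) = 2 * (u * (`|x i0| * (v / 2))) by field.
  lra.
have y0 : `|x i0 ^+ 2 - 4| <= 8 * a.
  rewrite -real_normK ?num_real // ler_norml.
  have h1 : 0 <= (2 * (1 + e) - `|x i0|) * (2 * (1 + e) + `|x i0|).
    by rewrite mulr_ge0 // ?subr_ge0 // addr_ge0 // mulr_ge0 //; lra.
  have h2 : 0 <= (`|x i0| - 2 * (1 - a)) * (`|x i0| + 2 * (1 - a)).
    by rewrite mulr_ge0 // ?subr_ge0 // addr_ge0 // mulr_ge0 //; lra.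
  by move: `|x i0| h1 h2 => u h1 h2; apply/andP; split; nra.
have yi i : i != i0 -> `|x i ^+ 2 - 4| <= 4.
  move=> ne0; have [->|ne1] := eqVneq i i1.
    rewrite -real_normK ?num_real // ler_norml; move: `|_| (normr_ge0 (x i1)) x1 => u u0 u1.
    apply/andP; split; nra.
  rewrite -real_normK ?num_real // ler_norml; move: `|_| (normr_ge0 (x i)) (xi i ne0 ne1) => u u0 u1.
  apply/andP; split; nra.
rewrite (bigD1 i0) //=; apply: le_lt_trans a_small; rewrite ler_pM ?prodr_ge0 //.
apply: le_trans (_ : \prod_(i | i != i0) 4 <= _).
  by apply: ler_prod => i ne_i; rewrite normr_ge0 yi.
rewrite prodr_const ler_weXn2l ?ler1n //.
by rewrite -[X in (_ <= X)%N]card_ord max_card.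
Qed.

End Small.

Lemma absz1_cases (N : int) : `|N|%N = 1%N -> N = 1 \/ N = -1.
Proof. by case: N => [[|[|n]]|[|n]] //= _; [left | right]. Qed.

Lemma square_mod4 (t n : int) : t ^+ 2 - 4 * n != -1.
Proof.
apply/eqP => /(congr1 (fun z => (z %% 4)%Z)).
have -> : t ^+ 2 - 4 * n = - n * 4 + t ^+ 2 by ring.
rewrite modzMDl -modzXm.
have : (0 <= (t %% 4)%Z < 4) by rewrite modz_ge0 // ltz_pmod.
by case: ((t %% 4)%Z) => [[|[|[|[|k]]]]|k].
Qed.

Fact disc_identity (T : comPzRingType) (a b : T) : (a - b) ^+ 2 = (a + b) ^+ 2 - 4 * (a * b).
Proof. ring. Qed.

Section UnramifiedField.
Variable L : splittingFieldType rat.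
Hypothesis galL : galois 1 {:L}.
Local Notation gT := (gal_of {:L}).
Local Notation O := (@Oint L).
Hypothesis cGG : forall g h : gT, (g * h = h * g)%g.
Variables (H : {group gT}) (m : nat) (c : 'I_m -> gT) (idx : gT -> 'I_m).
Hypothesis idxP : forall g i, (g \in H :* c i)%g = (idx g == i).
Local Notation F := (fixedField H).
Hypothesis unram : forall p, prime p ->
  exists P : prime_over L p, (inertia_gr P \subset H) && coprime #|inertia_gr P| p.
Variable w : 'I_m -> L.
Hypotheses (Fw : forall i, w i \in F) (Ow : forall i, w i \in O).
Hypothesis gen_w : forall x, x \in F -> x \in O ->
  exists a : 'I_m -> int, x = \sum_i w i *~ a i.

Lemma fixF x h : x \in F -> h \in H -> h x = x.
Proof. by move=> /mem_fixedFieldP[_ fx] Hh; apply: fx. Qed.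

Lemma idx_c j : idx (c j) = j.
Proof. by apply/eqP; rewrite -idxP rcoset_refl. Qed.

Lemma gal_idx (g : gT) x : x \in F -> g x = c (idx g) x.
Proof.
move=> Fx; have : (g \in H :* c (idx g))%g by rewrite idxP.
by case/rcosetP=> h Hh Dg; rewrite {1}Dg galMx (fixF Fx Hh).
Qed.

Let s (g : gT) i := idx (c i * g)%g.

Lemma gal_row (g : gT) i x : x \in F -> g (c i x) = c (s g i) x.
Proof. by move=> Fx; rewrite -galMx gal_idx. Qed.

Lemma row_inj g : injective (s g).
Proof.
move=> i j eq_s; have e1 : (c i * g \in H :* c (s g i))%g by rewrite idxP.
have e2 : (c j * g \in H :* c (s g i))%g by rewrite eq_s idxP.
apply/eqP; rewrite -{1}(idx_c i) -idxP mem_rcoset.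
move: e1 e2; rewrite !mem_rcoset => e1 /groupVr e2; have := groupM e1 e2.
by rewrite !invMg invgK !mulgA mulgKV mulgK.
Qed.

Let M := \matrix_(i, j) c i (w j).
Let delta := \det M.

Lemma gal_delta (g : gT) : g delta = (-1) ^+ perm (@row_inj g) * delta.
Proof.
rewrite /delta -det_map_mx -[X in _ = X * _]det_perm -det_mulmx -row_permE.
by congr (\det _); apply/matrixP=> i j; rewrite !mxE permE; apply: gal_row.
Qed.

Lemma delta_Oint : delta \in O.
Proof.
apply: rpred_sum => g _; apply: rpredM; first by rewrite rpredX // rpredN rpred1.
by apply: rpred_prod => i _; rewrite mxE Oint_gal.
Qed.

(** The square of delta is the discriminant of F, a rational integer that no
    prime divides by [unramified_det]. *)
Lemma delta_sqr : delta ^+ 2 = 1 \/ delta ^+ 2 = -1.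
Proof.
have [N DN] : exists N : int, delta ^+ 2 = N%:~R.
  apply: Oint1v; last by rewrite rpredX ?delta_Oint.
  by apply: (gal_fix1 galL) => g; rewrite rmorphXn /= gal_delta exprMn sqrr_sign mul1r.
suffices N1 : `|N|%N = 1%N.
  rewrite DN; have [->|->] := absz1_cases N1; first by left.
  by right; rewrite rmorphN.
apply/eqP/negPn/negP => N1.
have [p p_pr pN] : exists2 p, prime p & (p %| `|N|)%N.
  have [->|nz_N] := eqVneq `|N|%N 0%N; first by exists 2%N; rewrite ?dvdn0.
  by exists (pdiv `|N|); [apply: pdiv_prime; rewrite ltn_neqAle eq_sym N1 lt0n | apply: pdiv_dvd].
have [P /andP[sIH co_I]] := unram p_pr.
have [x Ox] := unramified_det cGG p_pr sIH co_I idxP.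
have Fx j : \sum_(h in H) h (x j) \in F.
  apply/fixedFieldP=> [|h Hh]; first exact: memvf.
  rewrite rmorph_sum (reindex_inj (mulIg h^-1%g)) /=.
  apply: eq_big => [k|k _]; first by rewrite groupMr ?groupV.
  by rewrite -galMx mulgKV.
have Osx j : \sum_(h in H) h (x j) \in O by apply: rpred_sum => h _; rewrite Oint_gal.
have /fin_all_exists[a Da] j := gen_w (Fx j) (Osx j).
have -> : \matrix_(i, j) c i (\sum_(h in H) h (x j)) = M *m \matrix_(k, j) (a j k)%:~R.
  apply/matrixP=> i j; rewrite !mxE Da rmorph_sum /=; apply: eq_bigr => k _.
  by rewrite !mxE rmorphMz /= mulrzr.
rewrite det_mulmx => /negP; apply; apply: primeMr.
  by apply: rpred_sum => g _; rewrite rpredM ?rpredX ?rpredN ?rpred1 // rpred_prod // => i _; rewrite mxE rpred_int.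
have : delta ^+ 2 \in P by rewrite DN prime_int.
by rewrite primeX //; apply: delta_Oint.
Qed.

Lemma gal_norm_F x : x \in F -> gal_norm x = (\prod_i c i x) ^+ #|H|.
Proof.
move=> Fx; rewrite /gal_norm (partition_big idx predT) //= -prodrXl.
apply: eq_bigr => i _; rewrite (eq_bigr (fun=> c i x)).
  rewrite prodr_const; congr (_ ^+ _); rewrite -(card_rcoset H (c i)).
  by apply: eq_card => g; rewrite [RHS]idxP.
by move=> g /eqP <-; rewrite -gal_idx.
Qed.

End UnramifiedField.

Section UnramifiedPrime.
Variable L : splittingFieldType rat.
Hypothesis galL : galois 1 {:L}.
Local Notation gT := (gal_of {:L}).
Local Notation O := (@Oint L).
Hypothesis cGG : forall g h : gT, (g * h = h * g)%g.
Variables (H : {group gT}).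
Local Notation F := (fixedField H).
Hypothesis unram : forall p, prime p ->
  exists P : prime_over L p, (inertia_gr P \subset H) && coprime #|inertia_gr P| p.

Lemma coset_system m : #|[set: gT] : H|%g = m ->
  exists (c : 'I_m -> gT) (idx : gT -> 'I_m), forall g i, (g \in H :* c i)%g = (idx g == i).
Proof.
rewrite /indexg => <-.
have Rg g : (H :* g)%g \in rcosets H [set: gT] by apply/rcosetsP; exists g.
pose c (i : 'I_#|rcosets H [set: gT]|) := repr (enum_val i).
exists c, (fun g => enum_rank_in (Rg 1%g) (H :* g)%g) => g i.
have Dc : (H :* c i)%g = enum_val i.
  by have /rcosetsP[x _ Dx] := enum_valP i; rewrite /c Dx rcoset_repr.
apply/idP/eqP => [/rcoset_eqP Dg|<-].
  by rewrite Dg Dc enum_valK_in.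
by rewrite /c enum_rankK_in // rcoset_repr rcoset_refl.
Qed.

Lemma integral_basis_index m : #|[set: gT] : H|%g = m ->
  exists w : 'I_m -> L, [/\ forall i, w i \in F, forall i, w i \in O &
    forall x, x \in F -> x \in O -> exists a : 'I_m -> int, x = \sum_i w i *~ a i].
Proof.
move=> Dm; have <- : \dim F = m.
  rewrite -Dm -divgS ?finset.subsetT // cardsT (card_gal galL).
  rewrite (dim_sup_field (subvf F)) -(dim_fixedField H) mulKn ?cardG_gt0 //.
have [b [[Fb Ob _] genb]] := integral_basis galL F.
by exists b; split.
Qed.

(** Following Stickelberger, the discriminant is t^2 - 4 n, hence 1 since -1 is
    not a square modulo 4; its square root delta is then rational, whereas
    conjugation changes its sign. *)
Lemma unram_index2 : #|[set: gT] : H|%g = 2 -> False.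
Proof.
move=> iH; have [c [idx idxP]] := coset_system iH.
have [w [Fw Ow gen_w]] := integral_basis_index iH.
have D2 := delta_sqr galL cGG idxP unram Fw Ow gen_w.
set d := \det _ in D2.
have Dd : d = c ord0 (w ord0) * c ord_max (w ord_max) - c ord0 (w ord_max) * c ord_max (w ord0).
  rewrite /d (expand_det_row _ ord0) big_ord_recl big_ord1 /cofactor !det_mx11 !mxE /=.
  have -> : lift ord0 0 = ord_max :> 'I_2 by apply: val_inj.
  have -> : lift ord_max 0 = ord0 :> 'I_2 by apply: val_inj.
  by rewrite addn0 expr0 expr1 !mul1r mulN1r mulrN.
pose a := c ord0 (w ord0) * c ord_max (w ord_max).
pose b := c ord0 (w ord_max) * c ord_max (w ord0).
have ord2 (i : 'I_2) : i = ord0 \/ i = ord_max by case: i => [[|[|k]] lt_k] //; [left | right]; apply: val_inj.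
have ne01 : ord0 != ord_max :> 'I_2 by [].
have swap (g : gT) : (g a = a /\ g b = b) \/ (g a = b /\ g b = a).
  have row i j := gal_row idxP g i (Fw j).
  have inj := @row_inj _ H _ c idx idxP g.
  rewrite /a /b !rmorphM /= !row.
  have [e0|e0] := ord2 (idx (c ord0 * g)%g); have [e1|e1] := ord2 (idx (c ord_max * g)%g).
  - by case/eqP: ne01; apply: inj; rewrite e0 e1.
  - by left; rewrite e0 e1.
  - by right; rewrite e0 e1; split; rewrite mulrC.
  - by case/eqP: ne01; apply: inj; rewrite e0 e1.
have Oa : a \in O by rewrite rpredM ?Oint_gal.
have Ob : b \in O by rewrite rpredM ?Oint_gal.
have [t Dt] : exists t : int, a + b = t%:~R.
  apply: Oint1v; last by rewrite rpredD.
  apply: (gal_fix1 galL) => g; rewrite rmorphD /=.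
  by have [[-> ->]|[-> ->]] := swap g; rewrite // addrC.
have [n Dn] : exists n : int, a * b = n%:~R.
  apply: Oint1v; last by rewrite rpredM.
  apply: (gal_fix1 galL) => g; rewrite rmorphM /=.
  by have [[-> ->]|[-> ->]] := swap g; rewrite // mulrC.
have Ddisc : d ^+ 2 = (t ^+ 2 - 4 * n)%:~R.
  by rewrite Dd disc_identity -/a -/b Dt Dn intrB intrM !expr2 intrM.
have d1 : d ^+ 2 = 1.
  case: D2 => // D2; case/eqP: (square_mod4 t n); apply: (@intK_inj L).
  by rewrite -Ddisc D2 rmorphN.
have fix_d (g : gT) : g d = d.
  have /eqP := d1; rewrite sqrf_eq1 => /orP[]/eqP->; first exact: rmorph1.
  by rewrite rmorphN rmorph1.
pose g := ((c ord0)^-1 * c ord_max)%g.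
have Dg0 : idx (c ord0 * g)%g = ord_max by rewrite mulKVg (idx_c idxP).
have ga : g a = b.
  have row i j := gal_row idxP g i (Fw j).
  have inj := @row_inj _ H _ c idx idxP g.
  rewrite /a /b !rmorphM /= !row Dg0.
  have [->|e1] := ord2 (idx (c ord_max * g)%g); first by rewrite mulrC.
  by case/eqP: ne01; apply: inj; rewrite Dg0 e1.
have gb : g b = a.
  have [[ga' gb']|[]//] := swap g.
  by rewrite gb' -ga ga'.
have : d = - d by rewrite -{1}(fix_d g) Dd rmorphB /= -/a -/b ga gb opprB.
move/eqP; rewrite -addr_eq0 -mulr2n -mulr_natl mulf_eq0 (negPf (natK_neq0 L _)) //= => /eqP d0.
by have /eqP := d1; rewrite d0 expr0n eq_sym oner_eq0.
Qed.

Section Odd.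
Variables (R : realType) (iota : {rmorphism L -> R[i]}).

Lemma conj_gal : exists g : gT, forall x, Num.conj (iota x) = iota (g x).
Proof.
by have [g Dg] := embedding_gal iota (Num.conj \o iota) galL; exists g.
Qed.

(** Complex conjugation is an element of order at most 2 of the Galois group,
    and H has odd index. *)
Lemma real_fixed x : odd #|[set: gT] : H|%g -> x \in F -> (complex.Re (iota x))%:C%C = iota x.
Proof.
move=> odd_i Fx; have [g Dg] := conj_gal.
have gg : (g * g = 1)%g.
  by apply: gal_eq => y; apply: (fmorph_inj iota); rewrite galMx -!Dg conjCK gal_id.
have nH : [set: gT] \subset 'N(H)%g.
  by apply: cents_norm; apply/centsP=> k _ h _; apply: cGG.
have Hg : g \in H.
  apply: coset_idr; first by rewrite (fintype.subsetP nH) ?inE.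
  have ng : (g \in 'N(H))%g by rewrite (fintype.subsetP nH) ?inE.
  apply/eqP; rewrite -order_eq1 -dvdn1.
  have /eqP<- : coprime 2 #|[set: gT] : H|%g by rewrite coprime2n.
  rewrite dvdn_gcd order_dvdn expgS expg1 -morphM //= gg morph1 eqxx /=.
  by rewrite -card_quotient // order_dvdG // mem_quotient ?inE.
have : Num.conj (iota x) = iota x by rewrite Dg; have /mem_fixedFieldP[_ ->] := Fx.
case: (iota x) => u v /eqP; rewrite eq_complex /= => /andP[_].
by rewrite eq_sym -addr_eq0 -mulr2n mulrn_eq0 /= => /eqP->.
Qed.

(** F is totally real of discriminant 1. By Minkowski it contains a nonzero
    integer x with one conjugate bounded by 2, another one by 1/2 and the others
    by 1, up to a factor close to 1. The norm of x is at least 1 and, by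
    [prod_small], that of x^2 - 4 is less than 1. So x^2 = 4, which the
    conjugate near 1/2 or below excludes. *)
Lemma unram_odd : odd #|[set: gT] : H|%g -> (1 < #|[set: gT] : H|%g)%N -> False.
Proof.
move=> odd_i; set n := #|[set: gT] : H|%g => n_gt1; have iH : #|[set: gT] : H|%g = n by [].
have [c [idx idxP]] := coset_system iH.
have [w [Fw Ow gen_w]] := integral_basis_index iH.
have D2 := delta_sqr galL cGG idxP unram Fw Ow gen_w.
set M := \matrix_(i, j) _ in D2.
have Fc (g : gT) x : x \in F -> g x \in F.
  move=> Fx; apply/fixedFieldP=> [|h Hh]; first exact: memvf.
  by rewrite -galMx -cGG galMx (fixF Fx Hh).
pose re i x := complex.Re (iota (c i x)).
have reE i x : x \in F -> (re i x)%:C%C = iota (c i x).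
  by move=> Fx; apply: real_fixed => //; apply: Fc.
have norm_ge1 x : x \in F -> x \in O -> x != 0 -> 1 <= \prod_i `|re i x|.
  move=> Fx Ox nz_x; have [N DN] := gal_norm_int galL Ox.
  have := gal_norm_F idxP Fx; rewrite DN => /(congr1 iota).
  rewrite rmorph_int rmorphXn rmorph_prod /=.
  have -> : \prod_i iota (c i x) = (\prod_i re i x)%:C%C.
    by rewrite [RHS]rmorph_prod; apply: eq_bigr => i _; apply/esym/reE.
  rewrite -[RHS]rmorphXn -(rmorph_int (real_complex R)) => /(fmorph_inj (real_complex R)) DR.
  have nz_N : N != 0 by rewrite -(intK_eq0 L) -DN gal_norm_eq0.
  rewrite -normr_prod leNgt; apply/negP => lt1.
  have : `|\prod_i re i x| ^+ #|H| < 1 by rewrite exprn_ilt1 // -lt0n cardG_gt0.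
  by rewrite -normrX -DR -intr_norm -[1]/(1%:~R) ltr_int ltNge -gtz0_ge1 normr_gt0 nz_N.
pose A : 'M[R]_n := \matrix_(i, j) re i (w j).
have detA : `|\det A| = 1.
  have DdA : (\det A)%:C%C = iota (\det M).
    rewrite -!det_map_mx; congr (\det _); apply/matrixP=> i j.
    by rewrite !mxE; apply: reE.
  have [h|h] : (\det A) ^+ 2 = 1 \/ (\det A) ^+ 2 = -1.
  - have inj := fmorph_inj (real_complex R).
    by case: D2 => D2; [left|right]; apply: inj; rewrite rmorphXn /= DdA -rmorphXn D2 ?rmorphN !rmorph1.
  - by move/eqP: h; rewrite sqrf_eq1 => /orP[]/eqP->; rewrite ?normrN normr1.
  by have := sqr_ge0 (\det A); rewrite h oppr_ge0 ler10.
pose i0 : 'I_n := Ordinal (ltnW n_gt1); pose i1 : 'I_n := Ordinal n_gt1.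
(* The product of the scaling factors is 1, so the forms stay unimodular. *)
pose sc (i : 'I_n) : R := if i == i0 then 2^-1 else if i == i1 then 2 else 1.
pose B : 'M[R]_n := diag_mx (\row_i sc i) *m A.
have detB : `|\det B| = 1.
  rewrite det_mulmx normrM detA mulr1 det_diag (bigD1 i0) //= (bigD1 i1) //= big1; last first.
    by move=> i /andP[h0 h1]; rewrite mxE /sc (negPf h0) (negPf h1).
  by rewrite !mxE /sc /= mulr1 mulVf ?normr1 // pnatr_eq0.
pose D : R := 8 * n.+1%:R * 4 ^+ n.
have D_gt0 : 0 < D by rewrite !mulr_gt0 ?exprn_gt0 ?ltr0n.
(* Small enough for [prod_small]. *)
pose e := (D + 1)^-1.
have e_gt0 : 0 < e by rewrite invr_gt0 addr_gt0.
have e_le1 : e <= 1 by rewrite invf_le1 ?lerDr ?ltW // addr_gt0.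
have De : D * e < 1 by rewrite ltr_pdivrMr ?addr_gt0 // mul1r ltrDl.
have [a [k nz_a] Ha] := minkowski (ltnW n_gt1) detB (introT andP (conj e_gt0 e_le1)).
pose x := \sum_j w j *~ a j.
have Fx : x \in F by apply: rpred_sum => j _; rewrite rpredMz.
have Ox : x \in O by apply: rpred_sum => j _; rewrite rpredMz.
have rex i : `|re i x| <= (sc i)^-1 * (1 + e).
  have sc_gt0 : 0 < sc i by rewrite /sc; case: ifP => _; [rewrite invr_gt0 ltr0n | case: ifP].
  rewrite mulrC ler_pdivlMr // mulrC -{1}(gtr0_norm sc_gt0) -normrM.
  apply: le_trans (Ha i); rewrite le_eqVlt; apply/orP; left; apply/eqP; congr (`|_|).
  have inj := fmorph_inj (real_complex R).
  have -> : re i x = \sum_j re i (w j) * (a j)%:~R.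
    apply: inj; rewrite [LHS]reE // [RHS]rmorph_sum !rmorph_sum; apply: eq_bigr => j _.
    by rewrite [RHS]rmorphM [X in X * _]reE // [in RHS]rmorph_int rmorphMz /= rmorphMz mulrzr.
  rewrite mulr_sumr; apply: eq_bigr => j _; rewrite mulrA; congr (_ * _).
  by rewrite /B mul_diag_mx !mxE.
have nz_x : x != 0.
  apply/eqP => x0; have wfree : M *m \col_j (a j)%:~R = 0.
    apply/matrixP=> i j; rewrite mxE [RHS]mxE; transitivity (c i x); last by rewrite x0 rmorph0.
    rewrite rmorph_sum.
    by apply: eq_bigr => l _; rewrite !mxE rmorphMz /= mulrzr.
  have uM : M \in unitmx.
    rewrite unitmxE unitfE; apply: contraTneq isT => d0.
    by case: D2; rewrite d0 expr0n => /eqP; rewrite eq_sym ?oppr_eq0 oner_eq0.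
  have /matrixP/(_ k ord0) := congr1 (mulmx (invmx M)) wfree.
  by rewrite mulKmx // mulmx0 !mxE => /eqP; rewrite intK_eq0 (negPf nz_a).
have ne01 : i0 != i1 by [].
have re0 : `|re i0 x| <= 2 * (1 + e) by have := rex i0; rewrite /sc eqxx invrK.
have re1 : `|re i1 x| <= (1 + e) / 2 by have := rex i1; rewrite /sc /= mulrC.
have rei i : i != i0 -> i != i1 -> `|re i x| <= 1 + e.
  by move=> h0 h1; have := rex i; rewrite /sc (negPf h0) (negPf h1) invr1 mul1r.
have small := prod_small ne01 e_gt0 De re0 re1 rei (norm_ge1 x Fx Ox nz_x).
pose y := x ^+ 2 - 4.
have Fy : y \in F by rewrite rpredB ?rpredX // rpredMn // rpred1.
have Oy : y \in O by rewrite rpredB ?rpredX // rpredMn // rpred1.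
have rey i : re i y = re i x ^+ 2 - 4.
  apply: (fmorph_inj (real_complex R)); rewrite [LHS]reE // [RHS]rmorphB [X in X - _]rmorphXn.
  by rewrite [X in X ^+ 2]reE // /y !rmorphB !rmorphXn /= !rmorph_nat.
have y0 : y = 0.
  apply/eqP; apply: contraTT small => /(norm_ge1 y Fy Oy); rewrite -leNgt.
  by under eq_bigr do rewrite rey.
have : re i1 x ^+ 2 = 4.
  apply/eqP; rewrite -subr_eq0 -rey y0 /re.
  by rewrite (rmorph0 (c i1)) (rmorph0 iota).
rewrite -real_normK ?num_real // => sq4.
have : `|re i1 x| ^+ 2 <= 1 ^+ 2.
  rewrite lerXn2r ?nnegrE ?normr_ge0 // (le_trans re1) // ler_pdivrMr ?ltr0n // mul1r.
  by rewrite -[leRHS]/(1 + 1) lerD2l.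
by rewrite sq4 expr1n -[1]/(1%:R) ler_nat.
Qed.

End Odd.

(** A case of the theorem that the rationals have no unramified extension other
    than themselves. *)
Lemma unram_prime_index (R : realType) : prime #|[set: gT] : H|%g -> False.
Proof.
move=> pr_i; have [iota] := embedding_exists R[i] L.
have [/unram_index2//|odd_i] := even_prime pr_i.
exact: (@unram_odd R iota odd_i (prime_gt1 pr_i)).
Qed.

End UnramifiedPrime.

(** * Integers of cyclotomic fields of squarefree conductor *)

Lemma prim_rootM (F : fieldType) m n (u v : F) : coprime m n ->
  m.-primitive_root u -> n.-primitive_root v -> (m * n).-primitive_root (u * v).
Proof.
move=> co_mn pu pv; have mn_gt0 : (0 < m * n)%N by rewrite muln_gt0 !(prim_order_gt0 pu, prim_order_gt0 pv).
have uv1 : (u * v) ^+ (m * n) = 1.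
  by rewrite exprMn exprM (prim_expr_order pu) expr1n mulnC exprM (prim_expr_order pv) expr1n mulr1.
have [k pk dv_k] := prim_order_exists mn_gt0 uv1.
suffices -> : (m * n = k)%N by [].
apply/eqP; rewrite eqn_dvd dv_k andbT Gauss_dvd //.
have uvk : (u * v) ^+ k = 1 by apply: prim_expr_order pk.
rewrite -(@Gauss_dvdl m k n) // -[(n %| k)%N](@Gauss_dvdr n m k) 1?coprime_sym // 1?mulnC.
rewrite (prim_order_dvd pu) (prim_order_dvd pv).
have := congr1 (fun z => z ^+ n) uvk; have := congr1 (fun z => z ^+ m) uvk.
rewrite /= !expr1n !exprMn -!exprM ![(k * _)%N]mulnC ![v ^+ (n * k)]exprM ![u ^+ (m * k)]exprM.
by rewrite (prim_expr_order pu) (prim_expr_order pv) !expr1n mul1r mulr1 => -> ->; rewrite eqxx.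
Qed.

Section Span.
Variable L : splittingFieldType rat.
Hypothesis galL : galois 1 {:L}.
Local Notation gT := (gal_of {:L}).
Local Notation O := (@Oint L).

(** Only primitive roots are allowed: for squarefree n they are the conjugates
    of one of them, and it is on these that the integers have unique
    coordinates. *)
Definition prim_zspan n (x : L) := exists s : seq (L * int),
  (forall u, u \in s -> n.-primitive_root u.1) /\ x = \sum_(u <- s) u.1 *~ u.2.

Definition unity_qspan n (x : L) := exists s : seq (L * rat),
  (forall u, u \in s -> u.1 ^+ n = 1) /\ x = \sum_(u <- s) u.2 *: u.1.

Lemma prim_zspan0 n : prim_zspan n 0.
Proof. by exists [::]; rewrite big_nil. Qed.

Lemma prim_zspanD n x y : prim_zspan n x -> prim_zspan n y -> prim_zspan n (x + y).
Proof.
move=> [s [Ps ->]] [t [Pt ->]]; exists (s ++ t); rewrite big_cat; split=> // u.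
by rewrite mem_cat => /orP[/Ps|/Pt].
Qed.

Lemma prim_zspanM m n x y : coprime m n -> prim_zspan m x -> prim_zspan n y -> prim_zspan (m * n) (x * y).
Proof.
move=> co_mn [s [Ps ->]] [t [Pt ->]]; rewrite mulr_suml.
elim: s Ps => [|u s IHs] Ps; first by rewrite big_nil; apply: prim_zspan0.
rewrite big_cons; apply: prim_zspanD; last by apply: IHs => v sv; apply: Ps; rewrite inE sv orbT.
exists [seq (u.1 * v.1, u.2 * v.2) | v <- t]; split=> [_ /mapP[v tv ->]|] /=; last first.
  rewrite big_map mulr_sumr; apply: eq_bigr => v _ /=.
  by rewrite mulrzAl mulrzAr -mulrzA [X in _ *~ X]mulrC.
have Pu : m.-primitive_root u.1 by apply: Ps; rewrite mem_head.
by apply: prim_rootM => //; apply: Pt.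
Qed.

Lemma unity_qspan0 n : unity_qspan n 0.
Proof. by exists [::]; rewrite big_nil. Qed.

Lemma unity_qspanD n x y : unity_qspan n x -> unity_qspan n y -> unity_qspan n (x + y).
Proof.
move=> [s [Ps ->]] [t [Pt ->]]; exists (s ++ t); rewrite big_cat; split=> // u.
by rewrite mem_cat => /orP[/Ps|/Pt].
Qed.

Lemma unity_qspanZ n (a : rat) x : unity_qspan n x -> unity_qspan n (a *: x).
Proof.
move=> [s [Ps ->]]; exists [seq (u.1, a * u.2) | u <- s]; split.
  by move=> _ /mapP[u su ->] /=; apply: Ps.
by rewrite big_map scaler_sumr; apply: eq_bigr => u _; rewrite scalerA.
Qed.

Lemma unity_qspanN n x : unity_qspan n x -> unity_qspan n (- x).
Proof. by move/(unity_qspanZ (-1)); rewrite scaleN1r. Qed.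

Lemma root1_Oint n x : (0 < n)%N -> x ^+ n = 1 -> x \in O.
Proof. by move=> n_gt0 xn1; apply: (Oint_rootX n_gt0); rewrite xn1 rpred1. Qed.

Lemma expr_inj_mod n (x : L) a b : x ^+ n = 1 -> a = b %[mod n] -> x ^+ a = x ^+ b.
Proof. by move=> x1 ab; rewrite -(expr_mod a x1) -(expr_mod b x1) ab. Qed.

Section Frob.
Variable p : nat.
Hypothesis p_pr : prime p.

Lemma frob_zspan n (s : seq (L * int)) : (0 < n)%N -> (forall u, u \in s -> u.1 ^+ n = 1) ->
  (\sum_(u <- s) u.1 *~ u.2) ^+ p - \sum_(u <- s) u.1 ^+ p *~ u.2 \in modO p%:R.
Proof.
move=> n_gt0; elim: s => [|u s IHs] Ps.
  by rewrite !big_nil expr0n gtn_eqF ?prime_gt0 // subrr rpred0.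
have Ou v : v \in u :: s -> v.1 \in O by move/Ps; apply: root1_Oint.
have {}IHs := IHs (fun v sv => Ps v (mem_behead (s := u :: s) sv)).
rewrite !big_cons; set x := \sum_(v <- s) v.1 *~ v.2 in IHs *; set y := \sum_(v <- s) _ in IHs *.
have Ox : x \in O.
  by rewrite /x big_seq rpred_sum // => v sv; rewrite rpredMz // Ou // inE sv orbT.
have Ou1 : u.1 \in O by rewrite Ou ?mem_head.
have D1 := expD_mod p_pr (rpredMz u.2 Ou1) Ox.
have D2 : (u.1 *~ u.2) ^+ p - u.1 ^+ p *~ u.2 \in modO p%:R.
  rewrite -(mulrzr u.1) -(mulrzr (u.1 ^+ p)) exprMn -mulrBr.
  by apply: modOMl; [rewrite rpredX | apply: fermat_int].
set A := (_ + _) ^+ p in D1 *; set B := (_ ^+ p) in D1 D2.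
have -> : A - (u.1 ^+ p *~ u.2 + y) = (A - (B + x ^+ p)) + ((B - u.1 ^+ p *~ u.2) + (x ^+ p - y)).
  by rewrite [X in _ = _ + X]addrACA -[in RHS](opprD (u.1 ^+ p *~ u.2)) subrKA.
by apply: rpredD => //; apply: rpredD.
Qed.

Lemma frob_zspanX n (s : seq (L * int)) k : (0 < n)%N -> (forall u, u \in s -> u.1 ^+ n = 1) ->
  (\sum_(u <- s) u.1 *~ u.2) ^+ (p ^ k) - \sum_(u <- s) u.1 ^+ (p ^ k) *~ u.2 \in modO p%:R.
Proof.
move=> n_gt0 Ps; elim: k => [|k IHk].
  by rewrite expr1 (eq_bigr (fun u => u.1 *~ u.2)) ?subrr ?rpred0.
have Osum (t : seq (L * int)) : (forall u, u \in t -> u.1 ^+ n = 1) -> \sum_(u <- t) u.1 *~ u.2 \in O.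
  move=> Pt; rewrite big_seq rpred_sum // => v /Pt v1.
  by rewrite rpredMz // (root1_Oint n_gt0).
pose t := [seq (u.1 ^+ (p ^ k), u.2) | u <- s].
have Pt u : u \in t -> u.1 ^+ n = 1 by case/mapP=> v /Ps v1 -> /=; rewrite exprAC v1 expr1n.
have Ot := Osum t Pt; have Os := Osum s Ps.
have D2 := frob_zspan n_gt0 Pt; rewrite !big_map /= in Ot D2.
have OX : (\sum_(u <- s) u.1 *~ u.2) ^+ (p ^ k) \in O by rewrite rpredX.
have := modX p OX Ot IHk; rewrite -exprM -expnSr => D1.
have -> : \sum_(u <- s) u.1 ^+ (p ^ k.+1) *~ u.2 = \sum_(u <- s) u.1 ^+ (p ^ k) ^+ p *~ u.2.
  by apply: eq_bigr => u _; rewrite expnSr exprM.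
by have := rpredD D1 D2; rewrite addrA subrK.
Qed.

End Frob.

Section Cyclotomic.
Variables (N : nat) (z : L).
Hypothesis N_gt0 : (0 < N)%N.
Hypothesis prim_z : N.-primitive_root z.
Hypothesis sqfree : forall p, prime p -> ~~ (p ^ 2 %| N)%N.
Hypothesis gal_pow : forall a, coprime a N ->
  exists g : gT, forall u, u ^+ N = 1 -> g u = u ^+ a.

Lemma sum_root_pow p (w : L) m : prime p -> p.-primitive_root w ->
  \sum_(0 <= i < p) w ^+ (i * m) = if (p %| m)%N then p%:R else 0.
Proof.
move=> p_pr prim_w; case: ifP => dv.
  rewrite (eq_big_nat _ _ (F2 := fun=> 1)) => [|i _]; first by rewrite big_const_nat iter_addr subn0 addr0.
  by apply/eqP; rewrite -(prim_order_dvd prim_w) dvdn_mull.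
have nz : w ^+ m - 1 != 0 by rewrite subr_eq0 -(prim_order_dvd prim_w) dv.
apply: (mulfI nz); rewrite mulr0 big_mkord.
under eq_bigr do rewrite mulnC exprM.
by rewrite -subrX1 -exprM mulnC exprM (prim_expr_order prim_w) expr1n subrr.
Qed.

Lemma cyclo_aut p i : prime p -> (p %| N)%N -> (0 < i < p)%N ->
  exists g : gT, (forall u, u ^+ (N %/ p) = 1 -> g u = u) /\ (forall w, w ^+ p = 1 -> g w = w ^+ i).
Proof.
move=> p_pr pN /andP[i_gt0 lt_ip]; set M := (N %/ p)%N.
have DN : N = (M * p)%N by rewrite divnK.
have co_Mp : coprime M p.
  rewrite coprime_sym prime_coprime //; apply: contra (sqfree p_pr) => pM.
  by rewrite DN expnS expn1 dvdn_mul.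
pose a := chinese M p 1 i.
have aM : a = 1 %[mod M] by apply: chinese_modl.
have ap : a = i %[mod p] by apply: chinese_modr.
have co_a : coprime a N.
  rewrite DN coprimeMr -coprime_modl aM coprime_modl coprime1n /=.
  by rewrite -coprime_modl ap coprime_modl coprime_sym prime_coprime // gtnNdvd.
have [g Dg] := gal_pow co_a; exists g; split=> [u u1|w w1].
  rewrite Dg; last by rewrite DN exprM u1 expr1n.
  by rewrite (expr_inj_mod u1 aM) expr1.
rewrite Dg; last by rewrite DN mulnC exprM w1 expr1n.
exact: (expr_inj_mod w1 ap).
Qed.

Lemma root_decomp p n (w u : L) : prime p -> coprime p n -> p.-primitive_root w ->
  u ^+ (p * n) = 1 -> exists (j : 'I_p) v, v ^+ n = 1 /\ u = w ^+ j * v.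
Proof.
move=> p_pr co_pn prim_w u1.
pose e := chinese p n 0 1.
have ep : e = 0 %[mod p] by apply: chinese_modl.
have en : e = 1 %[mod n] by apply: chinese_modr.
pose f := chinese p n 1 0.
have fp : f = 1 %[mod p] by apply: chinese_modl.
have fn : f = 0 %[mod n] by apply: chinese_modr.
have [j Dj] : {j : 'I_p | u ^+ f = w ^+ j}.
  apply: (prim_rootP prim_w); rewrite -exprM.
  have /dvdnP[q ->] : (n %| f)%N by rewrite /dvdn fn mod0n.
  by rewrite -mulnA [(n * p)%N]mulnC mulnC exprM u1 expr1n.
exists j, (u ^+ e); split.
  rewrite -exprM; have /dvdnP[q ->] : (p %| e)%N by rewrite /dvdn ep mod0n.
  by rewrite -mulnA mulnC exprM u1 expr1n.
rewrite -Dj -exprD -[LHS]expr1; apply: (expr_inj_mod u1).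
apply/eqP; rewrite chinese_remainder //; apply/andP; split.
  by rewrite -modnDmr ep modnDmr addn0 fp.
by rewrite -modnDml fn modnDml add0n en.
Qed.

Lemma unity_qspan_decomp p n (w x : L) : prime p -> coprime p n -> p.-primitive_root w ->
  unity_qspan (p * n) x ->
  exists a : 'I_p -> L, (forall j, unity_qspan n (a j)) /\ x = \sum_j a j * w ^+ j.
Proof.
move=> p_pr co_pn prim_w [s [Ps ->]]; elim: s Ps => [|u s IHs] Ps.
  by exists (fun=> 0); split=> [j|]; [apply: unity_qspan0 | rewrite big_nil big1 // => j _; rewrite mul0r].
have [v sv|a [qa Da]] := IHs; first by apply: Ps; rewrite inE sv orbT.
have [j [v [v1 Du]]] := root_decomp p_pr co_pn prim_w (Ps u (mem_head _ _)).
exists (fun k => (if k == j then u.2 *: v else 0) + a k); split=> [k|].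
  apply: unity_qspanD => //; case: ifP => _; last exact: unity_qspan0.
  by exists [:: (v, u.2)]; rewrite big_seq1; split=> // _ /[1!inE]/eqP->.
under [RHS]eq_bigr do rewrite mulrDl; rewrite big_split /= -Da big_cons; congr (_ + _).
rewrite (bigD1 j) //= eqxx big1 ?addr0 => [|k /negPf->]; last by rewrite mul0r.
by rewrite Du -scalerAl mulrC.
Qed.

Lemma unity_qspan_fix n p (g : gT) x : (n %| N %/ p)%N -> (forall u, u ^+ (N %/ p) = 1 -> g u = u) ->
  unity_qspan n x -> g x = x.
Proof.
move=> nN fixg [s [Ps ->]]; rewrite rmorph_sum [LHS]big_seq [RHS]big_seq; apply: eq_bigr => u /Ps u1.
rewrite fmorph_numZ /= fixg //; by have /dvdnP[q ->] := nN; rewrite mulnC exprM u1 expr1n.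
Qed.

(** Write x as the sum of a_j w^j with w of order p. Conjugating w alone, p (a_j
    - a_0) is the sum of the products of sigma x by sigma w^(-j) - 1, hence a
    multiple of w - 1, and its p-th power is a multiple of p. By induction it is
    a combination of n-th roots of unity, which are fixed by some power of x |->
    x^p, additive modulo p. Therefore it is itself a multiple of p and a_j - a_0
    is an integer. Finally the w^j sum to 0, so the coefficients may be shifted
    by a_0. *)
Lemma cyclo_step p n x : prime p -> (p * n %| N)%N -> coprime p n ->
  (forall y, y \in O -> unity_qspan n y -> prim_zspan n y) ->
  x \in O -> unity_qspan (p * n) x -> prim_zspan (p * n) x.
Proof.
move=> p_pr dvN co_pn IH Ox qx; have p_gt0 := prime_gt0 p_pr.
have pN : (p %| N)%N by apply: dvdn_trans dvN; apply: dvdn_mulr.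
have nM : (n %| N %/ p)%N by rewrite dvdn_divRL // mulnC.
have n_gt0 : (0 < n)%N.
  by rewrite lt0n; apply: contraTneq dvN => ->; rewrite muln0 dvd0n -lt0n.
pose w := z ^+ (N %/ p); have prim_w : p.-primitive_root w by apply: dvdn_prim_root.
have w1 := prim_expr_order prim_w.
have Ow : w \in O by apply: root1_Oint w1.
have [a [qa Da]] := unity_qspan_decomp p_pr co_pn prim_w qx.
pose j0 : 'I_p := Ordinal p_gt0.
pose X i := \sum_k a k * w ^+ (i * k).
have OX (i : 'I_p) : i != j0 -> X i \in O.
  move=> nz_i; have [|g [fixg powg]] := @cyclo_aut p i p_pr pN.
    by rewrite ltn_ord andbT lt0n.
  suffices -> : X i = g x by rewrite Oint_gal.
  rewrite Da rmorph_sum; apply: eq_bigr => k _.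
  by rewrite rmorphM /= rmorphXn /= (powg w w1) (unity_qspan_fix nM fixg (qa k)) exprM.
(* The terms of index i = 0 vanish; including them completes the sums over all
   the p-th roots of unity. *)
have Dc j : p%:R * (a j - a j0) = \sum_(i < p) X i * (w ^+ (i * (p - j)) - 1).
  have -> : \sum_(i < p) X i * (w ^+ (i * (p - j)) - 1)
      = \sum_k a k * (\sum_(0 <= i < p) w ^+ (i * (k + (p - j))) - \sum_(0 <= i < p) w ^+ (i * k)).
    under [LHS]eq_bigr do rewrite mulr_suml.
    rewrite exchange_big; apply: eq_bigr => k _ /=; rewrite !big_mkord -sumrB mulr_sumr.
    apply: eq_bigr => i _; rewrite -mulrA mulrBr mulr1 -exprD -mulnDr //.
  under [RHS]eq_bigr do rewrite !(sum_root_pow _ p_pr prim_w) mulrBr.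
  have dv0 (k : 'I_p) : (p %| k)%N = (k == j0).
    by apply/idP/eqP => [|->]; rewrite ?dvdn0 // => dv; apply: val_inj; apply/eqP; rewrite -[_ == _]negbK -lt0n; apply/negP => k_gt0; have := dvdn_leq k_gt0 dv; rewrite leqNgt ltn_ord.
  have dvj (k : 'I_p) : (p %| k + (p - j))%N = (k == j).
    rewrite addnBA ?(ltnW (ltn_ord j)) // -eqn_mod_dvd ?modnDr; last by rewrite ltnW // ltn_addl.
    by rewrite !modn_small.
  rewrite sumrB (bigD1 j) //= dvj eqxx [X in _ + X - _]big1 ?addr0; last first.
    by move=> k /negPf nk; rewrite dvj nk mulr0.
  rewrite (bigD1 j0) // dv0 eqxx [X in _ - (_ + X)]big1 ?addr0; last first.
    by move=> k /negPf nk; rewrite dv0 nk mulr0.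
  by rewrite mulrBr ![p%:R * _]mulrC.
have Oc j : exists2 y, y \in O & p%:R * (a j - a j0) = (w - 1) * y.
  exists (\sum_(i < p) if i == j0 then 0 else X i * (\sum_(k < i * (p - j)) w ^+ k)).
    rewrite rpred_sum // => i _; case: eqVneq => [_|ni]; first exact: rpred0.
    by rewrite rpredM ?OX // rpred_sum // => k _; rewrite rpredX.
  rewrite Dc mulr_sumr; apply: eq_bigr => i _; case: eqVneq => [->|ni].
    by rewrite mul0n expr0 subrr !mulr0.
  by rewrite subrX1 mulrCA.
have nz_p : p%:R != 0 :> L by apply: natK_neq0.
have qb j : unity_qspan n (a j - a j0) by apply: unity_qspanD (qa j) (unity_qspanN (qa j0)).
have zb j : prim_zspan n (a j - a j0).
  apply: (IH) => //; have [y Oy Dy] := Oc j.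
  set c := p%:R * _ in Dy; suffices : c \in modO p%:R by rewrite modOE /c mulrC mulKf.
  have OcO : c \in O by rewrite Dy rpredM // rpredB ?rpred1.
  have cp : c ^+ p \in modO p%:R.
    rewrite Dy exprMn modOM ?rpredX //.
    by have := expB_mod p_pr 1 Ow (rpred1 O); rewrite expn1 w1 expr1n subrr subr0.
  have [|s [Ps Ds]] := IH c OcO.
    by rewrite /c mulr_natl -scaler_nat; apply: unity_qspanZ.
  have Ps1 u : u \in s -> u.1 ^+ n = 1 by move/Ps/prim_expr_order.
  have := frob_zspanX p_pr (totient n) n_gt0 Ps1; rewrite -Ds.
  have -> : \sum_(u <- s) u.1 ^+ (p ^ totient n) *~ u.2 = c.
    rewrite Ds !big_seq; apply: eq_bigr => u su; congr (_ *~ _).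
    by rewrite (expr_inj_mod (Ps1 u su) (Euler_exp_totient co_pn)) expr1.
  have : c ^+ (p ^ totient n) \in modO p%:R.
    have := totient_gt0 n; rewrite n_gt0; case: (totient n) => // k _.
    rewrite expnS exprM; have : (0 < p ^ k)%N by rewrite expn_gt0 p_gt0.
    by case: (p ^ k)%N => // l _; rewrite exprS modOM // !rpredX.
  by move=> h1 h2; have := rpredB h1 h2; rewrite subKr.
have -> : x = \sum_(j < p) w ^+ j * (a j - a j0).
  have S0 : \sum_(j < p) w ^+ j = 0.
    move: (sum_root_pow 1 p_pr prim_w); rewrite dvdn1 gtn_eqF ?prime_gt1 // big_mkord => S1.
    by rewrite -[RHS]S1; apply: eq_bigr => i _; rewrite muln1.
  under [RHS]eq_bigr do rewrite mulrBr; rewrite sumrB -mulr_suml S0 mul0r subr0 Da.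
  by apply: eq_bigr => j _; rewrite mulrC.
elim/big_rec: _ => [|j y _]; first exact: prim_zspan0.
apply: prim_zspanD; have [->|nj] := eqVneq j j0; first by rewrite subrr mulr0; apply: prim_zspan0.
apply: prim_zspanM => //; exists [:: (w ^+ j, 1)]; rewrite big_seq1; split=> // _ /[1!inE]/eqP-> /=.
rewrite prim_root_exp_coprime // coprime_sym prime_coprime // gtnNdvd ?lt0n //.
Qed.

Lemma cyclo_integers n x : (n %| N)%N -> x \in O -> unity_qspan n x -> prim_zspan n x.
Proof.
elim/ltn_ind: n x => n IHn x dvN Ox qx.
have n_gt0 : (0 < n)%N by apply: dvdn_gt0 dvN.
have [n_le1|n_gt1] := leqP n 1.
  have n1 : n = 1%N by apply/eqP; rewrite eqn_leq n_le1.
  rewrite n1 in qx *; have [|m ->] := @Oint1v L x _ Ox.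
    have [s [Ps ->]] := qx; rewrite big_seq rpred_sum // => u /Ps.
    by rewrite expr1 => ->; rewrite rpredZ ?mem1v.
  exists [:: (1, m)]; rewrite big_seq1; split=> // _ /[1!inE]/eqP-> /=.
  by have [k pk] := prim_order_exists (ltn0Sn 0) (expr1n L 1); rewrite dvdn1 => /eqP <-.
have p_pr := pdiv_prime n_gt1; set p := pdiv n in p_pr.
have Dn : n = (p * (n %/ p))%N by rewrite mulnC divnK // pdiv_dvd.
rewrite Dn; apply: cyclo_step => //; rewrite -?Dn //.
  rewrite prime_coprime //; apply: contra (sqfree p_pr) => pn.
  by apply: dvdn_trans dvN; rewrite Dn expnS expn1 dvdn_mul.
move=> y Oy qy; apply: IHn => //; first by rewrite ltn_Pdiv ?prime_gt1.
by apply: dvdn_trans dvN; rewrite [X in (_ %| X)%N]Dn dvdn_mull.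
Qed.

Lemma cyclo_basis x : <<1; z>>%VS = {:L}%VS -> x \in O ->
  exists a : gT -> int, x = \sum_(g : gT) g z *~ a g.
Proof.
move=> gen_z Ox; have /cyclo_integers[]// : unity_qspan N x.
  have /Fadjoin_polyP[q /polyOver1P[r ->] ->] : x \in <<1; z>>%VS by rewrite gen_z memvf.
  rewrite horner_coef; elim/big_rec: _ => [|i y _]; first exact: unity_qspan0.
  apply: unity_qspanD; exists [:: (z ^+ i, r`_i)]; rewrite big_seq1; split.
    by move=> _ /[1!inE]/eqP-> /=; rewrite exprAC (prim_expr_order prim_z) expr1n.
  by rewrite coef_map /= mulr_algl.
move=> s [Ps ->]; elim: s Ps => [|u s IHs] Ps.
  by exists (fun=> 0); rewrite big_nil big1 // => g _; rewrite mulr0z.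
have [v sv|a Da] := IHs; first by apply: Ps; rewrite inE sv orbT.
have Pu : N.-primitive_root u.1 by apply: Ps; rewrite mem_head.
have [k Dk] := prim_rootP prim_z (prim_expr_order Pu).
have [|g Dg] := @gal_pow k; first by rewrite -(prim_root_exp_coprime k prim_z) -Dk.
exists (fun h => (if h == g then u.2 else 0) + a h).
under [RHS]eq_bigr do rewrite mulrzDr; rewrite big_split /= -Da big_cons; congr (_ + _).
rewrite (bigD1 g) //= eqxx big1 ?addr0 => [|h /negPf->]; last by rewrite mulr0z.
by rewrite Dg ?(prim_expr_order prim_z) // Dk.
Qed.

End Cyclotomic.

End Span.

(** * Normal integral generators *)

Lemma galois_rat (L : splittingFieldType rat) : galois 1 {:L}.
Proof.
apply/and3P; split; [exact: sub1v | | exact: normalFieldf].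
apply/separableP=> y _; apply: pcharf0_separable.
by move=> p; rewrite !inE; apply/negbTE/andP=> -[/prime_gt0/(natK_neq0 L)/negPf->].
Qed.

Section NormalBasis.
Variable L : splittingFieldType rat.
Local Notation gT := (gal_of {:L}).
Local Notation O := (@Oint L).
Let galL : galois 1 {:L} := galois_rat L.

(** The conjugates of t are as many as the rank of the ring of integers, so that
    spanning it makes them an integral basis. *)
Definition normal_gen (t : L) := t \in O /\
  forall x, x \in O -> exists a : gT -> int, x = \sum_(g : gT) g t *~ a g.

(** The conjugates of t span L, of dimension the number of conjugations. *)
Lemma normal_gen_free_rat t (c : gT -> rat) : normal_gen t -> \sum_(g : gT) c g *: g t = 0 -> c =1 (fun=> 0).
Proof.
move=> [Ot normal_gen_t] c0.
pose X : #|{: gT}|.-tuple L := [tuple (enum_val i) t | i < #|{: gT}|].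
have XE (i : 'I_#|{: gT}|) : X`_i = (enum_val i) t by rewrite -tnth_nth tnth_mktuple.
have sumX (k : gT -> rat) : \sum_(i < #|{: gT}|) k (enum_val i) *: X`_i = \sum_(g : gT) k g *: g t.
  rewrite [RHS](reindex (@enum_val _ {: gT})) /=; last exact: onW_bij (enum_val_bij _).
  by apply: eq_bigr => i _; rewrite XE.
have freeX : free X.
  apply: (@basis_free _ _ {:L}%VS); rewrite basisEdim; apply/andP; split; last by rewrite size_tuple (card_gal galL).
  apply/subvP=> x _; have [n n_gt0 /normal_gen_t[a Da]] := Oint_denom x.
  have -> : x = n%:R^-1 *: (\sum_(g : gT) (a g)%:~R *: g t).
    rewrite (eq_bigr (fun g : gT => g t *~ a g)) => [|g _]; last by rewrite scaler_int.
    by rewrite -Da mulr_natl -scaler_nat scalerA mulVf ?scale1r // pnatr_eq0 -lt0n.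
  rewrite memvZ // -sumX rpred_sum // => i _.
  by rewrite memvZ // memv_span // mem_nth // size_tuple.
move=> g; have /freeP := freeX; move/(_ (fun i => c (enum_val i))).
by rewrite sumX => /(_ c0)/(_ (enum_rank g)); rewrite enum_rankK.
Qed.

Lemma normal_gen_free t (a b : gT -> int) : normal_gen t ->
  \sum_(g : gT) g t *~ a g = \sum_(g : gT) g t *~ b g -> a =1 b.
Proof.
move=> normal_gen_t eq_ab g; apply/eqP; rewrite -subr_eq0 -(intr_eq0 rat); apply/eqP.
apply: (normal_gen_free_rat (c := fun g => (a g - b g)%:~R) normal_gen_t).
rewrite (eq_bigr (fun g : gT => g t *~ a g - g t *~ b g)) => [|h _].
  by rewrite sumrB eq_ab subrr.
by rewrite scaler_int mulrzBr.
Qed.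

(** By uniqueness of the coordinates, those of an element fixed by h are
    invariant under translation by h. *)
Lemma normal_gen_coef_fix t (a : gT -> int) (h : gT) x : normal_gen t -> x = \sum_(g : gT) g t *~ a g ->
  h x = x -> forall g, a (g * h)%g = a g.
Proof.
move=> normal_gen_t Dx hx g; have /(normal_gen_free normal_gen_t)/(_ (g * h)%g) :
    \sum_(g : gT) g t *~ a (g * h^-1)%g = \sum_(g : gT) g t *~ a g.
  rewrite -Dx -hx Dx rmorph_sum /= (reindex_inj (mulIg h)) /=.
  by apply: eq_bigr => k _; rewrite rmorphMz /= -galMx mulgK.
by rewrite mulgK.
Qed.

(** The coordinates of 1 are all equal to some a, so that 1 is a times the trace
    of t. *)
Lemma normal_gen_gal_trace t : normal_gen t -> gal_trace t = 1 \/ gal_trace t = -1.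
Proof.
move=> normal_gen_t; have [a Da] := normal_gen_t.2 1 (rpred1 _).
have cst (h : gT) : a h = a 1%g.
  by rewrite -[h]mul1g (normal_gen_coef_fix normal_gen_t Da) ?rmorph1.
have D1 : 1 = gal_trace t *~ a 1%g.
  by rewrite Da /gal_trace mulrz_suml; apply: eq_bigr => g _; rewrite cst.
have [m Dm] := gal_trace_int galL normal_gen_t.1.
have : (m * a 1%g)%:~R = 1%:~R :> L by rewrite intrM mulrzr -Dm -D1.
move/intK_inj => E; have m1 : `|m|%N = 1%N.
  by apply/eqP; have /eqP := congr1 absz E; rewrite abszM muln_eq1 => /andP[].
by rewrite Dm; have [->|->] := absz1_cases m1; [left | right; rewrite rmorphN].
Qed.

(** A unit trace lies in no prime ideal, whereas wild ramification puts all
    traces of integers in P. *)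
Lemma normal_gen_tame t : (forall g h : gT, g * h = h * g)%g -> normal_gen t -> tamely_ramified L.
Proof.
move=> cGG normal_gen_t; apply/(tamely_ramifiedP galL) => p p_pr P.
apply: coprime_ramidx_trace => //; exists t; first by case: normal_gen_t.
by have [->|->] := normal_gen_gal_trace normal_gen_t; rewrite ?rpredN prime1.
Qed.

End NormalBasis.

Section Descent.
Variables (K M : splittingFieldType rat) (f : {rmorphism K -> M}).
Local Notation gK := (gal_of {:K}).
Local Notation gM := (gal_of {:M}).

Lemma gal_restrict (g : gM) : exists g' : gK, forall x, g (f x) = f (g' x).
Proof. exact: (embedding_gal f (g \o f) (galois_rat K)). Qed.

Lemma gal_fixed_image y : (forall g : gM, (forall x, g (f x) = f x) -> g y = y) ->
  exists x, y = f x.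
Proof.
move=> fix_y; have [t gen_t] := primitive_element K.
have : y \in <<1; f t>>%VS.
  have galE : galois <<1; f t>>%AS {:M}.
    by apply: galoisS (galois_rat M); rewrite sub1v subvf.
  rewrite -(galois_fixedField galE); apply/fixedFieldP; first exact: memvf.
  move=> g Gg; apply: fix_y => x; apply: (fixed_gal (subvf _) Gg).
  have /Fadjoin_polyP[q /polyOver1P[r ->] ->] : x \in <<1; t>>%VS by rewrite gen_t memvf.
  rewrite -horner_map /= -map_poly_comp; apply/mempx_Fadjoin/polyOver1P; exists r.
  by apply: eq_map_poly => a; rewrite /= !alg_num_field fmorph_rat.
case/Fadjoin_polyP=> q /polyOver1P[r ->] ->; exists (map_poly (in_alg K) r).[t].
rewrite -horner_map /= -map_poly_comp; congr (_.[_]).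
by apply: eq_map_poly => a; rewrite /= !alg_num_field fmorph_rat.
Qed.

(** The relative trace of w is such a generator: the coordinates in M of an
    integer of K are constant on the cosets of the subgroup fixing K. *)
Lemma normal_gen_descend (w : M) : normal_gen w -> exists t : K, normal_gen t.
Proof.
move=> normal_gen_w; have /fin_all_exists[r Dr] := gal_restrict.
pose N := [pred h : gM | r h == 1%g].
have rN h : N h -> forall x, h (f x) = f x by move=> /eqP rh x; rewrite Dr rh gal_id.
have rM g h : r (g * h)%g = (r g * r h)%g.
  by apply: gal_eq => x; apply: (fmorph_inj f); rewrite -Dr !galMx !Dr.
have [t Dt] : exists t, \sum_(h | N h) h w = f t.
  apply: gal_fixed_image => g fix_g.
  have rg : r g = 1%g.
    by apply: gal_eq => x; apply: (fmorph_inj f); rewrite -Dr fix_g gal_id.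
  rewrite rmorph_sum [RHS](reindex_inj (mulIg g)) /=.
  by apply: eq_big => [h|h _]; rewrite ?galMx //= rM rg mulg1.
have Ot : t \in @Oint K.
  by rewrite -(Oint_rmorph f) -Dt rpred_sum // => h _; rewrite Oint_gal normal_gen_w.1.
exists t; split=> // x Ox; have := Ox; rewrite -(Oint_rmorph f) => /normal_gen_w.2[a Da].
have aN (g h : gM) : N h -> a (g * h)%g = a g.
  move=> Nh; apply: (normal_gen_coef_fix normal_gen_w Da); exact: rN.
pose b (k : gK) := if [pick g | r g == k] is Some g then a g else 0.
exists b; apply: (fmorph_inj f); rewrite Da (partition_big r predT) //= rmorph_sum.
apply: eq_bigr => k _; rewrite rmorphMz /= /b; case: pickP => [g0 /eqP rg0|no]; last first.
  by rewrite mulr0z big1 // => g; rewrite no.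
have rV g : r g^-1%g = (r g)^-1%g.
  by apply: (mulgI (r g)); rewrite -rM !mulgV; apply/gal_eq=> y; apply: (fmorph_inj f); rewrite -Dr !gal_id.
rewrite -rg0 -Dr -Dt rmorph_sum mulrz_suml (reindex_inj (mulIg g0)) /=.
apply: eq_big => [h|h].
  by rewrite rM -[X in _ == X]mul1g (inj_eq (mulIg _)).
rewrite rM -[X in _ == X]mul1g (inj_eq (mulIg _)) => Nh.
rewrite galMx; congr (_ *~ _).
have -> : (h * g0 = g0 * (h ^ g0))%g by rewrite conjgE mulKVg.
by apply: aN; rewrite /N /= conjgE !rM rV (eqP Nh) mul1g mulVg.
Qed.

End Descent.

(** * Cyclotomic Galois groups and composita *)

(** This transfers the irreducibility of cyclotomic polynomials from the
    algebraic complex numbers to an arbitrary number field. *)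
Lemma minPoly_minCpoly (K : fieldExtType rat) (j : {rmorphism K -> algC}) x :
  map_poly j (minPoly 1 x) = minCpoly (j x).
Proof.
have [q Dq] := polyOver1P (minPolyOver 1%AS x).
have mapj (s : {poly rat}) : map_poly j (map_poly (in_alg K) s) = map_poly ratr s.
  by rewrite -map_poly_comp; apply: eq_map_poly => a; rewrite /= alg_num_field fmorph_rat.
have [p [Dp mon_p] rootp] := minCpolyP (j x).
have mon_q : q \is monic by have := monic_minPoly 1%AS x; rewrite Dq map_monic.
rewrite Dp Dq mapj; congr (map_poly _ _); apply/eqP; rewrite -eqp_monic // /eqp -rootp -mapj.
rewrite fmorph_root -Dq root_minPoly andbT -(dvdp_map (in_alg K)) -Dq minPoly_dvdp //.
  by apply/polyOver1P; exists p.
by rewrite -(fmorph_root j) mapj -Dp root_minCpoly.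
Qed.

Section CyclotomicField.
Variables (K : fieldExtType rat) (n : nat) (z : K).
Hypothesis prim_z : n.-primitive_root z.

Lemma dim_cyclo : \dim <<1; z>> = totient n.
Proof.
have [j] := embedding_exists algC K; have prim_jz : n.-primitive_root (j z) by rewrite fmorph_primitive_root.
rewrite dim_Fadjoin dimv1 muln1; apply: succn_inj.
by rewrite -size_minPoly -(size_map_poly j) minPoly_minCpoly (minCpoly_cyclotomic prim_jz) size_cyclotomic.
Qed.

Lemma cyclo_conj a : coprime a n -> root (minPoly 1 z) (z ^+ a).
Proof.
have [j] := embedding_exists algC K; have prim_jz : n.-primitive_root (j z) by rewrite fmorph_primitive_root.
move=> co_a; rewrite -(fmorph_root j) minPoly_minCpoly (minCpoly_cyclotomic prim_jz) root_cyclotomic //.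
by rewrite fmorph_primitive_root prim_root_exp_coprime.
Qed.

End CyclotomicField.

Section CyclotomicGalois.
Variables (L : splittingFieldType rat) (n : nat) (z : L).
Local Notation gT := (gal_of {:L}).
Hypothesis prim_z : n.-primitive_root z.

Lemma gal_root_pow (g : gT) : exists2 k, coprime k n & forall u, u ^+ n = 1 -> g u = u ^+ k.
Proof.
have [k co_k gz] := aut_prim_rootP g prim_z; exists k => // u u1.
by have [i ->] := prim_rootP prim_z u1; rewrite rmorphXn /= gz exprAC.
Qed.

Hypothesis gen_z : <<1; z>>%VS = {:L}%VS.

Lemma cyclo_gal_pow a : coprime a n -> exists g : gT, forall u, u ^+ n = 1 -> g u = u ^+ a.
Proof.
move=> co_a; have [q Dq] := polyOver1P (minPolyOver 1%AS z).
have [|f fz] := extend_hom (phi := in_alg L) (z := z ^+ a) gen_z Dq.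
  by rewrite -Dq (cyclo_conj prim_z).
have [g Dg] := embedding_gal idfun f (galois_rat L); exists g => u u1.
have {Dg}gz : g z = z ^+ a by rewrite -fz; apply/esym/Dg.
by have [i ->] := prim_rootP prim_z u1; rewrite rmorphXn /= gz exprAC.
Qed.

Lemma cyclo_gal_inj (g h : gT) : g z = h z -> g = h.
Proof.
move=> eq_gh; apply: gal_eq => x.
have /Fadjoin_polyP[q /polyOver1P[r ->] ->] : x \in <<1; z>>%VS by rewrite gen_z memvf.
rewrite -!horner_map /= -!map_poly_comp eq_gh; congr (_.[_]).
by apply: eq_map_poly => a; rewrite /= !alg_num_field !fmorph_rat.
Qed.

Lemma cyclo_normal_gen : (forall p, prime p -> ~~ (p ^ 2 %| n)%N) -> normal_gen z.
Proof.
move=> sqf; have n_gt0 := prim_order_gt0 prim_z.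
split; first exact: root1_Oint (prim_expr_order prim_z).
by move=> x Ox; apply: (cyclo_basis n_gt0 prim_z sqf cyclo_gal_pow).
Qed.

End CyclotomicGalois.

Section Unramified.
Variables (R : realType) (L : splittingFieldType rat).
Local Notation gT := (gal_of {:L}).
Hypothesis cGG : forall g h : gT, (g * h = h * g)%g.

Lemma abel_gal (A : {set gT}) : abelian A.
Proof. by apply/centsP=> g _ h _; apply: cGG. Qed.

(** A proper subgroup of an abelian group is contained in one of prime index. *)
Lemma unram_full (H : {group gT}) :
  (forall p, prime p -> exists P : prime_over L p,
     (inertia_gr P \subset H) && coprime #|inertia_gr P| p) ->
  H = [set: gT]%SET :> {set gT}.
Proof.
move=> unram; apply/eqP; rewrite finset.eqEsubset finset.subsetT /=.
apply/negPn/negP => pH; have {}pH : H \proper [set: gT] by rewrite properE finset.subsetT.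
have [M maxM sHM] := @maxgroup_exists _ (fun G => G \proper [set: gT]) H pH.
have nM (G : {group gT}) : [set: gT] \subset 'N(G)%g.
  by apply: cents_norm; apply/centsP=> g _ h _; apply: cGG.
have nsM : (M <| [set: gT])%g by rewrite /normal finset.subsetT nM.
apply: (@unram_prime_index L (galois_rat L) cGG M _ R).
  by move=> p /unram[P /andP[sI co]]; exists P; rewrite (fintype.subset_trans sI).
rewrite -card_quotient ?nM //; apply: simple_sol_prime.
  by apply/abelian_sol/quotient_abelian/abel_gal.
rewrite quotient_simple //; apply/maxgroupP; split.
  by have /maxgroupp -> := maxM; rewrite nM.
by move=> G /andP[pG _] sMG; have /maxgroupP[_] := maxM; apply.
Qed.

End Unramified.

(** M is a splitting field of the product of X^n - 1 and of the polynomial whose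
    roots are the conjugates of t. *)
Lemma compositum_cyclo (K : splittingFieldType rat) (t : K) n : <<1; t>>%VS = {:K}%VS -> (0 < n)%N ->
  exists (M : splittingFieldType rat) (f : {rmorphism K -> M}) (w : M),
    n.-primitive_root w /\ <<1 & [:: f t; w]>>%VS = {:M}%VS.
Proof.
move=> gen_t n_gt0; have [j] := embedding_exists algC K.
have [z prim_z] := C_prim_root_exists n_gt0.
have [M [e [[|t' [|w []]] // [Dt' Dw] gen]]] := num_field_exists [:: j t; z].
have prim_w : n.-primitive_root w by rewrite -(fmorph_primitive_root e) Dw.
have [q Dq] := polyOver1P (minPolyOver 1%AS t).
have [|f ft] := extend_hom (phi := in_alg M) (z := t') gen_t Dq.
  rewrite -(fmorph_root e) -map_poly_comp.
  rewrite (eq_map_poly (g := j \o in_alg K)) => [|a]; last by rewrite /= !alg_num_field !fmorph_rat.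
  by rewrite map_poly_comp -Dq Dt' fmorph_root root_minPoly.
pose p := \prod_(g : gal_of {:K}) ('X - (f (g t))%:P) * ('X^n - 1).
have Kp : \prod_(g : gal_of {:K}) ('X - (g t)%:P) \is a polyOver 1%VS.
  apply/polyOverP=> i; apply: (gal_fix1 (galois_rat K)) => g; rewrite -coef_map /=.
  congr (_`_i); rewrite rmorph_prod /=; congr polyseq.
  rewrite [RHS](reindex_inj (mulIg g)) /=; apply: eq_bigr => h _.
  by rewrite rmorphB /= map_polyX map_polyC /= galMx.
have Mp : p \is a polyOver 1%AS.
  rewrite rpredM ?rpredB ?rpred1 ?rpredX ?polyOverX //.
  have /polyOver1P[r Dr] := Kp; apply/polyOver1P; exists r.
  transitivity (map_poly f (map_poly (in_alg K) r)).
    rewrite -Dr rmorph_prod; apply: eq_bigr => g _.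
    by rewrite rmorphB /= map_polyX map_polyC.
  by rewrite -map_poly_comp; apply: eq_map_poly => a; rewrite /= !alg_num_field !fmorph_rat.
have splitp : splittingFieldFor 1 p {:M}.
  pose r1 := [seq f (g t) | g : gal_of {:K}]; pose r2 := codom (fun i : 'I_n => w ^+ i).
  have Dr : p = \prod_(y <- r1 ++ r2) ('X - y%:P).
    rewrite big_cat /p -(factor_Xn_sub_1 prim_w) big_mkord; congr (_ * _).
      by rewrite big_image.
    by rewrite big_image.
  exists (r1 ++ r2); first by rewrite -Dr eqpxx.
  apply/eqP; rewrite eqEsubv subvf -gen adjoin_seqSr //; apply/allP=> /=.
  rewrite andbT !mem_cat; apply/andP; split; apply/orP; [left|right].
    by rewrite -ft; apply/mapP; exists 1%g; rewrite ?mem_enum ?gal_id.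
  by apply/codomP; exists (Ordinal (ltn_pmod 1 n_gt0)); rewrite /= (prim_expr_mod prim_w) expr1.
have M_ax : FieldExt_isSplittingField _ M by constructor; exists p.
exists (HB.pack_for (splittingFieldType rat) M M_ax), f, w; split=> //.
by rewrite ft.
Qed.

(** * Tame abelian fields have a normal integral generator *)

Lemma generator_gal_inj (L : splittingFieldType rat) (s : seq L) (g h : gal_of {:L}) :
  <<1 & s>>%VS = {:L}%VS -> {in s, g =1 h} -> g = h.
Proof.
move=> gen_s eq_gh; apply: gal_eq => x; apply: (can_inj (galVK h)); rewrite galKV.
have : x \in fixedField [set (g * h^-1)%g]%SET.
  have : x \in <<1 & s>>%VS by rewrite gen_s memvf.
  apply: subvP x; apply/Fadjoin_seqP; split; first exact: sub1v.
  move=> x sx; apply/fixedFieldP=> [|k /set1P->]; first exact: memvf.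
  by rewrite galMx eq_gh // galKV.
case/mem_fixedFieldP=> _ /(_ _ (set11 _)); by rewrite galMx.
Qed.

Lemma int_primitive (K : fieldExtType rat) : exists2 t : K, t \in @Oint K & <<1; t>>%VS = {:K}%VS.
Proof.
have [t gen_t] := primitive_element K; have [n n_gt0 Ont] := Oint_denom t.
exists (n%:R * t) => //; apply/eqP; rewrite eqEsubv subvf -gen_t.
apply/FadjoinP; split; first exact: subv_adjoin.
rewrite -[X in X \in _](mulKf (natK_neq0 K n_gt0)) memvM ?memv_adjoin //.
by rewrite memvV rpred_nat // mem1v.
Qed.

Lemma sqfree_prod_primes m p : prime p -> ~~ (p ^ 2 %| \prod_(q <- primes m) q)%N.
Proof.
move=> p_pr; apply/negP => dv2; have dv1 := dvdn_trans (dvdn_exp2l p (ltn0Sn 1)) dv2.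
have dv_prod (s : seq nat) : all prime s -> (p %| \prod_(q <- s) q)%N -> p \in s.
  elim: s => [|q s IHs] /=; first by rewrite big_nil dvdn1 gtn_eqF ?prime_gt1.
  move=> /andP[q_pr /IHs IH]; rewrite big_cons Euclid_dvdM // inE dvdn_prime2 //.
  by case/orP=> [->//|/IH->]; rewrite orbT.
have all_pr : all prime (primes m) by apply/allP => q; rewrite mem_primes => /and3P[].
have pm := dv_prod _ all_pr dv1.
move: dv2; rewrite (bigD1_seq p) ?primes_uniq //= expnS expn1 dvdn_pmul2l ?prime_gt0 //.
rewrite -big_filter => /dv_prod; rewrite mem_filter eqxx => H; suffices /H : all prime [seq q <- primes m | q != p] by [].
by rewrite all_filter; apply: sub_all all_pr => q q_pr; apply/implyP => _.
Qed.

Section InertiaRoots.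
Variables (M : splittingFieldType rat) (p : nat) (P : prime_over M p).
Hypothesis p_pr : prime p.

(** Roots of unity of order prime to p are distinct modulo P. *)
Lemma inertia_root n (g : gal_of {:M}) (u : M) : g \in inertia_gr P -> (0 < n)%N ->
  u ^+ n = 1 -> ~~ (p %| n)%N -> g u = u.
Proof.
move=> /inertiaP Ig n_gt0 u1 ndv; have Ou := root1_Oint n_gt0 u1.
have nz_u : u != 0 by apply: contra_eq_neq u1 => ->; rewrite expr0n gtn_eqF // eq_sym oner_eq0.
have OuV : u^-1 \in @Oint M by apply: (root1_Oint n_gt0); rewrite exprVn u1 invr1.
pose v := g u / u; have v1 : v ^+ n = 1 by rewrite expr_div_n u1 -rmorphXn u1 rmorph1 divr1.
suffices v1' : v = 1 by rewrite -[LHS](divfK nz_u) -/v v1' mul1r.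
have vP : v - 1 \in P.
  have -> : v - 1 = (g u - u) * u^-1 by rewrite mulrBl mulfV.
  by apply: primeMr; rewrite ?Ig.
apply/eqP; rewrite -subr_eq0; apply: contraNT ndv => nz_v1.
have Ov : v \in @Oint M by apply: root1_Oint v1.
have S0 : \sum_(i < n) v ^+ i = 0.
  by apply: (mulfI nz_v1); rewrite -subrX1 v1 subrr mulr0.
rewrite -(prime_nat P n p_pr); have -> : n%:R = - \sum_(i < n) (v ^+ i - 1) :> M.
  by rewrite sumrB S0 sub0r opprK sumr_const card_ord.
rewrite rpredN rpred_sum // => i _; rewrite subrX1; apply: primeMr => //.
by rewrite rpred_sum // => j _; rewrite rpredX.
Qed.

End InertiaRoots.

Section Restriction.
Variables (K M : splittingFieldType rat) (f : {rmorphism K -> M}).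

Lemma prime_restrict_spec p (P : prime_over M p) : prime_over_spec (fun x : K => f x \in P) p.
Proof.
have inR (x : K) : (x \in (fun x : K => f x \in P)) = (f x \in P) by [].
split.
- by split=> [|x y]; rewrite !inR ?rmorph0 ?rpred0 // => Px Py; rewrite rmorphB rpredB.
- by move=> x; rewrite inR => /primeO; rewrite Oint_rmorph.
- by move=> a x Oa; rewrite !inR => Px; rewrite rmorphM primeMl // Oint_rmorph.
- by move=> x y Ox Oy; rewrite !inR rmorphM primeM ?Oint_rmorph // => /orP.
- by rewrite !inR rmorph1 rmorph_nat prime1 prime_p.
Qed.

Definition prime_restrict p (P : prime_over M p) : prime_over K p := PrimeOver (prime_restrict_spec P).

Lemma inertia_restrict p (P : prime_over M p) (g : gal_of {:M}) (k : gal_of {:K}) :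
  (forall x, g (f x) = f (k x)) -> g \in inertia_gr P -> k \in inertia_gr (prime_restrict P).
Proof.
move=> Dk /inertiaP Ig; apply/inertiaP=> x Ox.
by rewrite -[_ \in _]/(f (k x - x) \in P) rmorphB -Dk Ig // Oint_rmorph.
Qed.

End Restriction.

Section KroneckerWeber.
Variables (R : realType) (K : splittingFieldType rat).
Hypothesis cK : forall g h : gal_of {:K}, (g * h = h * g)%g.
Hypothesis tameK : tamely_ramified K.

(** A version of the theorem of Kronecker and Weber. Let n be the product of the
    primes that divide the norm of the product of the g t - t, for an integral
    generator t. All the inertia groups of M = K(zeta_n) are tame, trivial at
    primes not dividing n, and of order at most p - 1 at those p dividing n.
    Together they generate a group of order at most phi(n), whose fixed field is
    unramified, hence rational. So M has degree at most phi(n), M = Q(zeta_n),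
    and the relative trace of zeta_n generates the integers of K. *)
Theorem tame_normal_gen : exists t : K, normal_gen t.
Proof.
have galK := galois_rat K.
have [t Ot gen_t] := int_primitive K.
have gen1 : <<1 & [:: t]>>%VS = {:K}%VS by rewrite -gen_t adjoin_seq1.
(* Inertia above a prime not dividing the norm of D moves t to no other
   conjugate. *)
pose D := \prod_(g : gal_of {:K} | g != 1%g) (g t - t).
have OD : D \in @Oint K by apply: rpred_prod => g _; rewrite rpredB ?Oint_gal.
have nz_D : D != 0.
  apply/prodf_neq0 => g; apply: contraNneq => /eqP; rewrite subr_eq0 => /eqP gt.
  by apply/eqP/(generator_gal_inj gen1) => _ /[1!inE]/eqP->; rewrite gt gal_id.
have [m Dm] := gal_norm_int galK OD.
have nz_m : m != 0 by rewrite -(intK_eq0 K) -Dm gal_norm_eq0.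
pose n := (\prod_(q <- primes `|m|) q)%N.
have n_gt0 : (0 < n)%N.
  by rewrite /n big_seq prodn_cond_gt0 // => q; rewrite mem_primes => /and3P[/prime_gt0].
have sqf p : prime p -> ~~ (p ^ 2 %| n)%N by apply: sqfree_prod_primes.
have dv_n p : prime p -> (p %| m)%Z -> (p %| n)%N.
  move=> p_pr pm; have pm' : p \in primes `|m| by rewrite mem_primes p_pr absz_gt0 nz_m.
  by rewrite /n (bigD1_seq p) ?primes_uniq //= dvdn_mulr.
have [M [f [w [prim_w gen]]]] := compositum_cyclo gen_t n_gt0.
have inj2 (g h : gal_of {:M}) : g (f t) = h (f t) -> g w = h w -> g = h.
  by move=> e1 e2; apply: (generator_gal_inj gen) => x; rewrite !inE => /orP[]/eqP->.
have cM (g h : gal_of {:M}) : (g * h = h * g)%g.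
  have [g' Dg] := gal_restrict f g; have [h' Dh] := gal_restrict f h.
  apply: inj2; rewrite !galMx.
    by rewrite !(Dg, Dh) -!galMx cK.
  have w1 := prim_expr_order prim_w.
  have [a _ Da] := gal_root_pow prim_w g; have [b _ Db] := gal_root_pow prim_w h.
  rewrite (Da w w1) (Db w w1) !rmorphXn /= (Da w w1) (Db w w1); exact: exprAC.
have I1 p (P : prime_over M p) : prime p -> ~~ (p %| n)%N -> inertia_gr P :=: 1%g.
  move=> p_pr ndv; apply/trivgP/fintype.subsetP=> g Ig; apply/set1P.
  have [k Dk] := gal_restrict f g.
  have k1 : k = 1%g.
    apply: contraNeq ndv => nk; apply: dv_n => //.
    rewrite -(prime_int (prime_restrict f P) m p_pr) -Dm.
    have [y Oy ->] := dvd_gal_norm OD; apply: primeMr => //; rewrite /D (bigD1 k) //; apply: primeMr.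
      by apply: rpred_prod => h _; rewrite rpredB ?Oint_gal.
    by have /inertiaP := inertia_restrict Dk Ig; apply.
  apply: inj2; first by rewrite Dk k1 !gal_id.
  by rewrite gal_id (inertia_root p_pr Ig n_gt0 (prim_expr_order prim_w)).
(* An element of order p would act trivially on K, which is tame, and on zeta_n,
   because p^2 does not divide n. *)
have I2 p (P : prime_over M p) : prime p -> (p %| n)%N -> coprime #|inertia_gr P| p.
  move=> p_pr pn; rewrite coprime_sym prime_coprime //; apply/negP => /(Cauchy p_pr)[g Ig og].
  have gp1 : (g ^+ p = 1)%g by rewrite -og expg_order.
  suffices g1 : g = 1%g by have := prime_gt1 p_pr; rewrite -og g1 order1.
  have [k Dk] := gal_restrict f g.
  have k1 : k = 1%g.
    have Ik := inertia_restrict Dk Ig.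
    have co := inertia_tame ((tamely_ramifiedP galK).1 tameK p p_pr (prime_restrict f P)).
    have kp1 : (k ^+ p = 1)%g.
      apply: gal_eq => x; apply: (fmorph_inj f).
      have := congr1 (fun h : gal_of {:M} => h (f x)) gp1.
      rewrite /= !gal_id !galXx => <-.
      by elim: (p) => //= i <-; rewrite Dk.
    apply/eqP; rewrite -order_eq1 -dvdn1; rewrite /coprime in co; rewrite -(eqP co) dvdn_gcd.
    by rewrite order_dvdG // order_dvdn kp1 eqxx.
  apply: inj2; first by rewrite Dk k1 !gal_id.
  rewrite gal_id; pose n' := (n %/ p)%N; have Dn : n = (p * n')%N by rewrite mulnC divnK.
  have n'_gt0 : (0 < n')%N by rewrite divn_gt0 ?prime_gt0 // dvdn_leq.
  have ndv' : ~~ (p %| n')%N by apply: contra (sqf p p_pr) => dv; rewrite Dn expnS expn1 dvdn_mul.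
  have w1 := prim_expr_order prim_w.
  have wp : g (w ^+ p) = w ^+ p.
    by apply: (inertia_root p_pr Ig n'_gt0); rewrite // -exprM -Dn.
  have [a co_a Da] := gal_root_pow prim_w g.
  have Dgw := Da w w1; rewrite Dgw.
  have iterw i : iter i g w = w ^+ (a ^ i).
    by elim: i => //= i ->; rewrite rmorphXn /= Dgw -exprM expnS.
  have ap1 : (a ^ p = 1 %[mod n])%N.
    by apply/eqP; rewrite -(eq_prim_root_expr prim_w) -iterw -galXx gp1 gal_id.
  have a_p : (a = 1 %[mod p])%N.
    rewrite -(fermat_little a p_pr); have := congr1 (fun z => z %% p)%N ap1.
    by rewrite !modn_dvdm.
  have a_n' : (a = 1 %[mod n'])%N.
    have := wp; rewrite rmorphXn /= Dgw -exprM => /eqP; rewrite (eq_prim_root_expr prim_w).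
    by rewrite Dn [(a * p)%N]mulnC -[X in _ == (X %% _)%N]muln1 -!muln_modr eqn_pmul2l ?prime_gt0 // => /eqP.
  rewrite -[RHS]expr1; apply/eqP; rewrite (eq_prim_root_expr prim_w) Dn chinese_remainder ?a_p ?a_n' ?eqxx //.
  by rewrite prime_coprime.
have [H [HP leH]] : exists H : {group gal_of {:M}},
    (forall p, p \in primes n -> exists P : prime_over M p, inertia_gr P \subset H)
    /\ (#|H| <= \prod_(p <- primes n) p.-1)%N.
  have : {subset primes n <= primes n} by [].
  elim: {1 3 4}(primes n) => [|p s IHs] sub.
    by exists 1%G; rewrite big_nil cards1.
  have [q sq|H [HP leH]] := IHs; first by apply: sub; rewrite inE sq orbT.
  have := sub p (mem_head _ _); rewrite mem_primes => /and3P[p_pr _ pn].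
  have [P _] := prime_over_exists M p_pr.
  exists (inertia_gr P <*> H)%G; split=> [q|].
    rewrite inE => /orP[/eqP->|/HP[Q sQH]]; first by exists P; rewrite joing_subl.
    by exists Q; apply: fintype.subset_trans sQH (joing_subr _ _).
  rewrite big_cons /= norm_joinEl; last by apply: cents_norm; apply/centsP=> x _ y _; apply: cM.
  apply: leq_trans (_ : #|inertia_gr P| * #|H| <= _)%N; first by rewrite mul_cardG leq_pmulr ?cardG_gt0.
  by rewrite leq_mul // (inertia_bound (galois_rat M) cM p_pr (I2 p P p_pr pn)).
have HT : H = [set: gal_of {:M}]%SET :> {set _}.
  apply: (unram_full R cM) => p p_pr; have [pn|npn] := boolP (p %| n)%N.
    have [|P sPH] := HP p; first by rewrite mem_primes p_pr n_gt0.
    by exists P; rewrite sPH I2.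
  have [P _] := prime_over_exists M p_pr.
  by exists P; rewrite I1 // sub1G cards1 coprime1n.
have gen_w : <<1; w>>%VS = {:M}%VS.
  apply/eqP; rewrite eqEdim subvf -(card_gal (galois_rat M)) (dim_cyclo prim_w) -cardsT -HT.
  rewrite (leq_trans leH) // totientE // leq_prod // => q _.
  by rewrite leq_pmulr // expn_gt0; case: q => //; rewrite orbT.
exact: normal_gen_descend f _ (cyclo_normal_gen prim_w gen_w sqf).
Qed.

End KroneckerWeber.

(** * Lattices and the Galois action *)

Lemma iter_ordS n (i : 'I_n) k : iter k (@ordS n) i = ((i + k) %% n)%N :> nat.
Proof.
elim: k => [|k IHk] /=; first by rewrite addn0 modn_small.
by rewrite IHk -addn1 modnDml addn1 addnS.
Qed.

Lemma iter_ord_pred_reach n (i j : 'I_n) : exists k, j = iter k (@ord_pred n) i.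
Proof.
pose k := (i + (n - j))%N; exists k.
have -> : i = iter k (@ordS n) j.
  apply: val_inj; rewrite /= iter_ordS /k addnCA subnKC ?(ltnW (ltn_ord j)) //.
  by rewrite modnDr modn_small.
by elim: (k) => // m IHm; rewrite iterSr (iterS m (@ordS n)) ordSK.
Qed.

Lemma rowMz (V : zmodType) n (v : 'rV[V]_n) (m : int) j : (v *~ m) 0 j = v 0 j *~ m.
Proof. by case: m => k; rewrite -?pmulrn ?NegzE ?nmulrn ?mulrNz -?pmulrn ?mxE mulmxnE. Qed.

Section Lattice.
Variables (R : realType) (K : splittingFieldType rat).
Local Notation C := R[i].
Local Notation d := (\dim {:K}).
Local Notation gT := (gal_of {:K}).
Local Notation O := (@Oint K).
Let galK : galois 1 {:K} := galois_rat K.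

Lemma d_gt0 : (0 < d)%N.
Proof. exact: adim_gt0. Qed.

Section Ordering.
Variable sigma : 'I_d -> {rmorphism K -> C}.
Hypothesis ord_sigma : embedding_ordering sigma.
Local Notation Sg := (Sigma sigma).

Lemma Sigma_inj : injective Sg.
Proof.
move=> x y /rowP/(_ (Ordinal d_gt0)); rewrite !mxE; exact: fmorph_inj.
Qed.

Lemma Sigma_sum (I : finType) (x : I -> K) (m : I -> int) :
  Sg (\sum_i x i *~ m i) = \sum_i Sg (x i) *~ m i.
Proof.
apply/rowP=> j; rewrite summxE !mxE rmorph_sum; apply: eq_bigr => i _.
by rewrite rowMz mxE rmorphMz.
Qed.

(** Applied to one coordinate, the rotation is an element c of the Galois group;
    since an integer is determined by one of its embeddings, the rotation is c
    on all coordinates. *)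
Lemma Lambda_rot : cyclic_lattice (Lambda sigma) ->
  exists c : gT, forall x, rotation_shift (Sg x) = Sg (c x).
Proof.
move=> cycl; pose i0 : 'I_d := Ordinal d_gt0.
have [c Dc] := embedding_gal (sigma i0) (sigma (ord_pred i0)) galK.
exists c => x; have [n n_gt0 Onx] := Oint_denom x.
have rotO y : y \in O -> rotation_shift (Sg y) = Sg (c y).
  move=> Oy; have : Lambda sigma (rotation_shift (Sg y)).
    by rewrite -cycl; exists (Sg y) => //; exists y => //; apply/OintP.
  case=> y' _ Dy'; rewrite -Dy'; congr (Sg _).
  have := congr1 (fun v : 'rV_d => v 0 i0) Dy'; rewrite !mxE Dc; exact: fmorph_inj.
apply/rowP=> i; have := congr1 (fun v : 'rV_d => v 0 i) (rotO _ Onx).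
rewrite !mxE !rmorphM /= !rmorph_nat; apply: mulfI.
by rewrite -(rmorph_nat (sigma i)) fmorph_eq0 natK_neq0.
Qed.

Variable c : gT.
Hypothesis rot_c : forall x, rotation_shift (Sg x) = Sg (c x).

Lemma rot_iter k x : iter k (@rotation_shift C d) (Sg x) = Sg ((c ^+ k)%g x).
Proof.
rewrite galXx; elim: k => //= k ->; exact: rot_c.
Qed.

(** An embedding composed with g is some sigma_j, which iterating the rotation
    reaches from the first one. *)
Lemma rot_gen (g : gT) : exists k, g = (c ^+ k)%g.
Proof.
pose i0 : 'I_d := Ordinal d_gt0.
have [j Dj] := ord_sigma.2 (sigma i0 \o g); have [k Dk] := iter_ord_pred_reach i0 j.
exists k; apply: gal_eq => x; apply: (fmorph_inj (sigma i0)).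
rewrite -[LHS]/((sigma i0 \o g) x) -Dj Dk.
have := congr1 (fun v : 'rV_d => v 0 i0) (rot_iter k x); rewrite !mxE => <-.
have iter_rot (v : 'rV[C]_d) i : iter k (@rotation_shift C d) v 0 i = v 0 (iter k (@ord_pred d) i).
  by elim: (k) i => //= l IHl i; rewrite mxE IHl -iterSr.
by rewrite iter_rot mxE.
Qed.

Lemma rot_cycle : <[c]>%g = [set: gT]%SET.
Proof.
apply/eqP; rewrite finset.eqEsubset finset.subsetT; apply/fintype.subsetP=> g _.
by have [k ->] := rot_gen g; rewrite mem_cycle.
Qed.

Lemma rot_cyclic_lattice : cyclic_lattice (Lambda sigma).
Proof.
apply/seteqP; split=> [_ [_ [x Ox <-] <-]|_ [x Ox <-]].
  by rewrite rot_c; exists (c x) => //; apply/OintP; rewrite Oint_gal; apply/OintP.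
exists (Sg (c^-1%g x)); last by rewrite rot_c galVK.
by exists (c^-1%g x) => //; apply/OintP; rewrite Oint_gal; apply/OintP.
Qed.

Lemma rot_sum (a : gT -> int) (t : K) :
  \sum_(g : gT) g t *~ a g = \sum_(k < d) (c ^+ k)%g t *~ a (c ^+ k)%g.
Proof.
have od : #[c]%g = d by rewrite /order rot_cycle cardsT (card_gal galK).
rewrite (eq_bigl (fun g => g \in [set: gT]%SET)) => [|g]; last by rewrite finset.in_setT.
rewrite -rot_cycle -od.
have -> : <[c]>%g = [set (c ^+ k)%g | k : 'I_#[c]%g]%SET.
  by apply/setP=> g; apply/idP/imsetP => [/cyclePmin[k lt_k ->]|[k _ ->]]; [exists (Ordinal lt_k) | apply: mem_cycle].
rewrite big_imset // => i j _ _ /eqP; rewrite eq_expg_mod_order !modn_small // => /eqP.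
exact: val_inj.
Qed.

Lemma rot_simple : simple_cyclic_lattice (Lambda sigma) <-> exists t : K, normal_gen t.
Proof.
have od : #[c]%g = d by rewrite /order rot_cycle cardsT (card_gal galK).
have spanP t v : int_span (fun k : 'I_d => iter k (@rotation_shift C d) (Sg t)) v
    <-> exists a : gT -> int, v = Sg (\sum_(g : gT) g t *~ a g).
  split=> [[m ->]|[a ->]].
    pose a (g : gT) : int := if [pick k : 'I_d | (c ^+ k)%g == g] is Some k then m k else 0.
    exists a; rewrite rot_sum Sigma_sum; apply: eq_bigr => k _; rewrite rot_iter; congr (_ *~ _).
    rewrite /a; case: pickP => [l|/(_ k)]; last by rewrite eqxx.
    by rewrite eq_expg_mod_order od !modn_small // => /eqP/val_inj->.
  exists (fun k => a (c ^+ k)%g); rewrite rot_sum Sigma_sum.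
  by apply: eq_bigr => k _; rewrite rot_iter.
split=> [[_ [_ [t /OintP Ot <-]] DL]|[t [Ot normal_gen_t]]].
  exists t; split=> // x Ox.
  have : Lambda sigma (Sg x) by exists x => //; apply/OintP.
  by rewrite DL => /spanP[a /Sigma_inj ->]; exists a.
split; first exact: rot_cyclic_lattice.
exists (Sg t); first by exists t => //; apply/OintP.
apply/seteqP; split=> [_ [x /OintP/normal_gen_t[a Da] <-]|v /spanP[a ->]].
  by apply/spanP; exists a; rewrite Da.
exists (\sum_(g : gT) g t *~ a g) => //; apply/OintP.
by rewrite rpred_sum // => g _; rewrite rpredMz // Oint_gal.
Qed.

End Ordering.

(** The embeddings are listed as the composites of one of them with the powers
    of c. *)
Lemma cyclic_ordering (c : gT) : <[c]>%g = [set: gT]%SET ->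
  exists2 sigma : 'I_d -> {rmorphism K -> C}, embedding_ordering sigma &
    exists c : gT, forall x, rotation_shift (Sigma sigma x) = Sigma sigma (c x).
Proof.
move=> gen_c; have [j] := embedding_exists C K.
have od : #[c]%g = d by rewrite /order gen_c cardsT (card_gal galK).
exists (fun i : 'I_d => j \o (c ^+ i)%g).
  split=> [i k eq_ik|tau].
    have /eqP : (c ^+ i)%g = (c ^+ k)%g by apply: gal_eq => x; apply: (fmorph_inj j); apply: eq_ik.
    by rewrite eq_expg_mod_order od !modn_small // => /eqP/val_inj.
  have [g Dg] := embedding_gal j tau galK.
  have : g \in <[c]>%g by rewrite gen_c finset.in_setT.
  case/cyclePmin=> k; rewrite od => lt_k Dk; exists (Ordinal lt_k) => x.
  by rewrite /= -Dk Dg.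
exists c^-1%g => x; apply/rowP=> i; rewrite !mxE.
rewrite -[LHS]/(j ((c ^+ ord_pred i)%g x)) -[RHS]/(j ((c ^+ i)%g (c^-1%g x))); congr (j _).
have Di : i = ((ord_pred i).+1 %% d)%N :> nat by rewrite -{1}(ord_predK i).
have -> : (c ^+ i)%g = (c ^+ (ord_pred i).+1)%g by apply/eqP; rewrite eq_expg_mod_order od {1}Di modn_mod.
by rewrite -galMx expgS mulKg.
Qed.

Lemma cyclic_latticeP : for_appropriate_ordering (K := K) (R := R) (@cyclic_lattice _ _)
  <-> cyclic_extension K.
Proof.
split=> [[sigma ord_s /(Lambda_rot)[c rot_c]]|[_]].
  by split=> //; rewrite GalT -(rot_cycle ord_s rot_c) cycle_cyclic.
rewrite GalT => /cyclicP[c Dc]; have [s ord_s [c' rot_c]] := cyclic_ordering (esym Dc).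
by exists s => //; apply: rot_cyclic_lattice rot_c.
Qed.

Lemma cyclic_extension_abelian : cyclic_extension K -> forall g h : gT, (g * h = h * g)%g.
Proof.
case=> _; rewrite GalT => /cyclic_abelian/centsP cGG g h; apply: cGG; exact: finset.in_setT.
Qed.

Lemma simple_cyclic_latticeP : cyclic_extension K ->
  (for_appropriate_ordering (K := K) (R := R) (@simple_cyclic_lattice _ _)
     <-> exists t : K, normal_gen t).
Proof.
move=> cycK; split=> [[sigma ord_s simp]|normal_gen_K].
  have [c rot_c] := Lambda_rot simp.1.
  by apply/(rot_simple ord_s rot_c).
have [_] := cycK; rewrite GalT => /cyclicP[c Dc].
have [s ord_s [c' rot_c]] := cyclic_ordering (esym Dc).
by exists s => //; apply/(rot_simple ord_s rot_c).
Qed.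

Lemma normal_gen_tameP : cyclic_extension K -> (exists t : K, normal_gen t) <-> tamely_ramified K.
Proof.
move=> /cyclic_extension_abelian cGG; split=> [[t normal_gen_t]|tameK]; first exact: normal_gen_tame normal_gen_t.
exact: (tame_normal_gen R).
Qed.

End Lattice.

(** * Residues modulo n and wild cyclotomic ramification *)

Section Residues.
Local Open Scope nat_scope.

Definition primitive_residue n a := coprime a n /\
  forall k, coprime k n -> exists j, k = a ^ j %[mod n].

(** The unit group of Z/q is the automorphism group of a cyclic group of order
    q. *)
Lemma cyclic_units_pfactor p k : prime p -> odd p -> 0 < k -> cyclic (units_Zp (p ^ k)).
Proof.
move=> p_pr odd_p k_gt0; set q := p ^ k.
have q_gt1 : 1 < q by rewrite -(exp1n k) ltn_exp2r // prime_gt1.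
pose a : 'Z_q := Zp1; have oa : #[a]%g = q by rewrite order_Zp1 Zp_cast.
have pG : (p.-group <[a]>)%g by rewrite /pgroup -orderE oa pnatX pnat_id.
have ntG : <[a]>%g != 1%g by rewrite -cardG_gt1 -orderE oa.
have [m [_ [_ cycF _ _] H]] := cyclic_pgroup_Aut_structure pG (cycle_cyclic a) ntG.
have cycA : cyclic (Aut <[a]>%g).
  by move: H; case: eqP => [_ ->|_ [t [_ _ _]]] //; rewrite odd_p => -[[]].
have := isog_cyclic (Zp_unit_isog a); rewrite cycA.
by rewrite oa.
Qed.

Lemma cyclic_primitive_residue n : 1 < n -> cyclic (units_Zp n) -> exists a, primitive_residue n a.
Proof.
move=> n_gt1 /cyclicP[u Du]; pose a : nat := val u; exists a.
have Da : (a%:R : 'Z_n)%R = val u by rewrite natr_Zp.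
have co_a : coprime a n by rewrite coprime_sym -unitZpE // Da; apply: (valP u).
split=> // k co_k; have uk : ((k%:R : 'Z_n) \is a GRing.unit)%R by rewrite unitZpE // coprime_sym.
have : FinRing.unit 'Z_n uk \in units_Zp n by rewrite inE.
rewrite Du => /cycleP[j Dj]; exists j.
have := congr1 val Dj; rewrite FinRing.val_unitX /= -Da -GRing.natrX => /(congr1 val).
by rewrite /= !val_Zp_nat.
Qed.

Lemma primitive_residue_double n a : odd n -> 0 < n -> primitive_residue n a ->
  exists b, primitive_residue (2 * n) b.
Proof.
move=> odd_n n_gt0 [co_a gen_a].
have co2 : coprime 2 n by rewrite coprime2n.
pose b := chinese 2 n 1 a.
have b2 : b = 1 %[mod 2] by apply: chinese_modl.
have bn : b = a %[mod n] by apply: chinese_modr.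
exists b; split.
  by rewrite coprimeMr -coprime_modl b2 coprime_modl coprime1n /= -coprime_modl bn coprime_modl.
move=> k; rewrite coprimeMr => /andP[k2 /gen_a[j Dj]]; exists j.
apply/eqP; rewrite chinese_remainder // -modnXm b2 modnXm exp1n.
rewrite -[(b ^ j) %% n]modnXm bn modnXm -Dj eqxx andbT.
by rewrite !modn2; move: k2; rewrite coprimen2 => ->.
Qed.

Definition cyclotomic_cyclic n := n = 2 \/ n = 4 \/
  exists p k : nat, [/\ prime p, odd p, 1 <= k & n = p ^ k \/ n = 2 * p ^ k].

Definition cyclotomic_simple n := n = 2 \/
  exists p : nat, [/\ prime p, odd p & n = p \/ n = 2 * p].

Lemma list_primitive_residue n : cyclotomic_cyclic n -> exists a, primitive_residue n a.
Proof.
case=> [->|[->|[p [k [p_pr odd_p k_gt0 Dn]]]]].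
- exists 1; split=> // k co_k; exists 0; rewrite expn0 !modn2.
  by move: co_k; rewrite coprimen2 => ->.
- exists 3; split=> // k; rewrite -coprime_modl; have : k %% 4 < 4 by rewrite ltn_mod.
  case E : (k %% 4) => [|[|[|[|r]]]] // _ _; first by exists 0.
  by exists 1.
have [a prim_a] : exists a, primitive_residue (p ^ k) a.
  apply: cyclic_primitive_residue; last exact: cyclic_units_pfactor.
  by rewrite -(exp1n k) ltn_exp2r // prime_gt1.
case: Dn => ->; first by exists a.
apply: primitive_residue_double prim_a; first by rewrite oddX odd_p orbT.
by rewrite expn_gt0 prime_gt0.
Qed.

Definition extra_sqrt1 n k := [/\ k ^ 2 = 1 %[mod n], k <> 1 %[mod n] & k + 1 <> 0 %[mod n]].

Lemma sqr_predn n : 1 < n -> n.-1 ^ 2 = (n - 2) * n + 1.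
Proof.
move=> n_gt1; have -> : n = (n - 2).+2 by lia.
by rewrite subn2 /= -mulnn mulSn !mulnS; lia.
Qed.

Lemma extra_sqrt1_coprime a b : coprime a b -> 2 < a -> 2 < b -> exists k, extra_sqrt1 (a * b) k.
Proof.
move=> co_ab a_gt2 b_gt2; pose k := chinese a b (a.-1) 1; exists k.
have ka : k = a.-1 %[mod a] by apply: chinese_modl.
have kb : k = 1 %[mod b] by apply: chinese_modr.
split.
- apply/eqP; rewrite chinese_remainder // -modnXm ka modnXm -[(k ^ 2) %% b]modnXm kb modnXm exp1n eqxx andbT.
  rewrite sqr_predn; last exact: ltnW.
  by rewrite modnMDl.
- move=> /(congr1 (fun z => z %% a)); rewrite !modn_dvdm ?dvdn_mulr // ka.
  by rewrite !modn_small; lia.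
- move=> /(congr1 (fun z => z %% b)); rewrite !modn_dvdm ?dvdn_mull // -modnDml kb modnDml.
  by rewrite mod0n modn_small; lia.
Qed.

Lemma extra_sqrt1_2X e : 2 < e -> exists k, extra_sqrt1 (2 ^ e) k.
Proof.
case: e => [|[|[|e]]] // _; set q := 2 ^ e.+1.
have Dq : 2 ^ e.+3 = 4 * q by rewrite /q !expnS; lia.
have q2 : 1 < q by rewrite /q expnS; have := expn_gt0 2 e; lia.
exists (2 * q).+1; rewrite Dq; split.
- have -> : (2 * q).+1 ^ 2 = (q + 1) * (4 * q) + 1 by rewrite -mulnn mulnDl mulSn !mulnS !mulnA; lia.
  by rewrite modnMDl.
- by rewrite !modn_small; lia.
- by rewrite mod0n modn_small; lia.
Qed.

Lemma cyclotomic_list_or_root n : 2 <= n -> cyclotomic_cyclic n \/ exists k, extra_sqrt1 n k.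
Proof.
move=> n_ge2; have n_gt0 : 0 < n by apply: leq_trans n_ge2.
have [m co_m Dn] := pfactor_coprime (isT : prime 2) n_gt0; set e := logn 2 n in Dn.
rewrite coprime2n in co_m.
have [m_le1|m_gt1] := leqP m 1.
  have m1 : m = 1 by case: (m) m_le1 co_m => [|[|r]].
  rewrite m1 mul1n in Dn; case: e Dn => [|[|[|e']]] Dn; [lia | by left; left | by left; right; left |].
  by right; rewrite Dn; apply: extra_sqrt1_2X.
have p_pr := pdiv_prime m_gt1; set p := pdiv m in p_pr.
have m_gt0 : 0 < m by apply: ltnW.
have pm : p %| m by apply: pdiv_dvd.
have odd_p : odd p by apply: dvdn_odd pm co_m.
have p_gt2 : 2 < p by have := prime_gt1 p_pr; case: (p) odd_p => [|[|[|r]]].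
have [m' co_m' Dm] := pfactor_coprime p_pr m_gt0; set k := logn p m in Dm.
have k_gt0 : 0 < k by rewrite /k logn_gt0 mem_primes p_pr m_gt0.
have pk_gt2 : 2 < p ^ k by apply: leq_trans p_gt2 _; rewrite -[X in X <= _]expn1 leq_exp2l ?prime_gt1.
have odd_m' : odd m' by move: co_m; rewrite Dm oddM => /andP[].
have odd_pk : odd (p ^ k) by rewrite oddX odd_p orbT.
have m'_gt0 : 0 < m' by case: (m') odd_m'.
have co2 : coprime (p ^ k) (2 ^ e) by rewrite coprimeXr // coprimen2.
have [m'_gt1|m'_le1] := ltnP 1 m'.
  right; rewrite Dn Dm; have -> : m' * p ^ k * 2 ^ e = p ^ k * (m' * 2 ^ e) by lia.
  apply: extra_sqrt1_coprime => //; first by rewrite coprimeMr co2 coprimeXl.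
  have m'_gt2 : 2 < m' by case: (m') m'_gt1 odd_m' => [|[|[|r]]].
  by rewrite (leq_trans m'_gt2) // leq_pmulr // expn_gt0.
have m'1 : m' = 1 by apply/eqP; rewrite eqn_leq m'_le1.
rewrite m'1 mul1n in Dm; rewrite Dm in Dn.
case: e Dn co2 => [|[|e']] Dn co2.
- by left; right; right; exists p, k; split=> //; left; rewrite Dn muln1.
- by left; right; right; exists p, k; split=> //; right; rewrite Dn mulnC.
right; rewrite Dn; apply: extra_sqrt1_coprime => //.
by rewrite !expnS; have := expn_gt0 2 e'; lia.
Qed.

Lemma list_simple_or_square n : cyclotomic_cyclic n ->
  cyclotomic_simple n \/ exists2 p, prime p & p ^ 2 %| n.
Proof.
case=> [->|[->|[p [[|[|k]] [p_pr odd_p k_gt0 Dn]]]]] //; first by left; left.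
- by right; exists 2.
- by left; right; exists p; split=> //; rewrite expn1 in Dn.
right; exists p => //; case: Dn => ->; last apply: dvdn_mull.
  by rewrite dvdn_exp2l.
by rewrite dvdn_exp2l.
Qed.

Lemma simple_sqfree n p : cyclotomic_simple n -> prime p -> ~~ (p ^ 2 %| n).
Proof.
move=> sn p_pr; have p_gt1 := prime_gt1 p_pr; apply/negP => dv.
have prime_case q : prime q -> ~~ (p ^ 2 %| q).
  move=> q_pr; apply/negP => dv2; have q_gt1 := prime_gt1 q_pr.
  have : p %| q by apply: dvdn_trans dv2; rewrite expnS dvdn_mulr.
  rewrite dvdn_prime2 // => /eqP pq; have := dvdn_leq (ltnW q_gt1) dv2.
  by rewrite pq expnS expn1 leqNgt ltn_Pmull // ltnW.
case: sn => [D|[q [q_pr odd_q [D|D]]]]; try by rewrite D (negPf (prime_case _ _)) in dv.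
have [p2|np2] := eqVneq p 2.
  move: dv; rewrite D p2 expnS expn1 dvdn_pmul2l // => /(dvdn_odd)/(_ odd_q) //.
have : p ^ 2 %| q.
  have -> : (p ^ 2 %| q) = (p ^ 2 %| 2 * q).
    by rewrite Gauss_dvdr // coprimeXl // coprimen2; case: (even_prime p_pr) np2 => [->|->].
  by rewrite -D.
by rewrite (negPf (prime_case q q_pr)).
Qed.

Lemma simple_cyclic_list n : cyclotomic_simple n -> cyclotomic_cyclic n.
Proof.
case=> [->|[p [p_pr odd_p Dn]]]; first by left.
by right; right; exists p, 1; rewrite expn1.
Qed.

End Residues.

Section WildCyclotomic.
Variables (L : splittingFieldType rat) (n p : nat) (z : L).
Hypotheses (prim_z : n.-primitive_root z) (p_pr : prime p) (p2n : (p ^ 2 %| n)%N).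
Let galL : galois 1 {:L} := galois_rat L.
Variable P : prime_over L p.
Local Notation O := (@Oint L).
Local Notation exact_level := (exact_level galL p_pr P).

Lemma exact_level_assoc s x y y' : y \in O -> y' \in O -> y * y' = 1 -> exact_level s x -> exact_level s (x * y).
Proof.
move=> Oy Oy' yy' Hx; rewrite -[s]addn0; apply: exact_levelM => //; rewrite exact_level0 Oy /=.
by apply: contra (prime1 P) => Py; rewrite -yy' primeMr.
Qed.

Lemma exact_level_pow_sub1 m s (v : L) k : (0 < m)%N -> v ^+ m = 1 -> v != 1 -> coprime k m ->
  exact_level s (v - 1) -> exact_level s (v ^+ k - 1).
Proof.
move=> m_gt0 v1 nv1 co_k Hs; have Ov : v \in O by apply: root1_Oint v1.
pose k' := (k ^ (totient m).-1)%N.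
have vkk : v ^+ k ^+ k' = v.
  rewrite -exprM /k' -expnS prednK ?totient_gt0 //.
  by rewrite (expr_inj_mod v1 (Euler_exp_totient co_k)) expr1.
have Osum (u : L) l : u \in O -> \sum_(i < l) u ^+ i \in O.
  by move=> Ou; rewrite rpred_sum // => i _; rewrite rpredX.
rewrite subrX1; apply: (@exact_level_assoc _ _ _ (\sum_(i < k') v ^+ k ^+ i)) => //; try by rewrite Osum ?rpredX.
apply: (mulfI (_ : v - 1 != 0)); first by rewrite subr_eq0.
by rewrite mulrA -subrX1 -subrX1 vkk mulr1.
Qed.

(** Let u have order p^2 and w = u^p. Then w - 1 is the product of the p
    elements u - w^i, and p is the product of the p - 1 elements 1 - w^i. In
    each product the factors are associated, to u - 1 and to w - 1, so the
    valuation of p is p (p - 1) times that of u - 1. *)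
Lemma wild_ramidx : (p %| ramidx galL p_pr P)%N.
Proof.
have p_gt0 := prime_gt0 p_pr; have p_gt1 := prime_gt1 p_pr.
pose u := z ^+ (n %/ p ^ 2); have prim_u : (p ^ 2).-primitive_root u by apply: dvdn_prim_root.
have p2_gt0 : (0 < p ^ 2)%N by rewrite expn_gt0 p_gt0.
have u1 := prim_expr_order prim_u.
pose w := u ^+ p; have prim_w : p.-primitive_root w.
  have := dvdn_prim_root prim_u (_ : p %| p ^ 2)%N; rewrite expnS expn1 mulnK //.
  by apply; rewrite dvdn_mulr.
have w1 := prim_expr_order prim_w.
have Ou : u \in O by apply: root1_Oint u1.
have Ow : w \in O by rewrite rpredX.
have nu1 : u != 1.
  have := prim_order_dvd prim_u 1; rewrite expr1 => <-; rewrite dvdn1 gtn_eqF //.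
  by rewrite -(exp1n 2) ltn_exp2r.
have nw1 : w != 1.
  by have := prim_order_dvd prim_w 1; rewrite expr1 => <-; rewrite dvdn1 gtn_eqF.
have [r Hr] : exists r, exact_level r (u - 1).
  by apply: exact_level_ex; [rewrite rpredB ?rpred1 | rewrite subr_eq0].
have Hw : exact_level (p * r) (w - 1).
  have -> : w - 1 = \prod_(i < p) (u - w ^+ i).
    have := congr1 (fun q : {poly L} => q.[u]) (factor_Xn_sub_1 prim_w).
    rewrite big_mkord horner_prod !hornerE => <-.
    by apply: eq_bigr => i _; rewrite !hornerE.
  have -> : (p * r = #|'I_p| * r)%N by rewrite card_ord.
  apply: (@exact_level_prod L galL p p_pr P r 'I_p 'I_p) => i _.
  (* u - w^i is w^i times u^k - 1. *)
  pose k := (1 + p * (p - i))%N.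
  have -> : u - w ^+ i = (u ^+ k - 1) * w ^+ i.
    rewrite mulrBl mul1r; congr (_ - _); rewrite /k exprD expr1 exprM -/w -mulrA -exprD.
    by rewrite subnK ?(ltnW (ltn_ord i)) // w1 mulr1.
  apply: (@exact_level_assoc _ _ _ (w ^+ (p - i))); [by rewrite rpredX | by rewrite rpredX | |].
    by rewrite -exprD subnKC ?(ltnW (ltn_ord i)) // w1.
  apply: (exact_level_pow_sub1 p2_gt0 u1 nu1) Hr.
  by rewrite coprimeXr // /k /coprime gcdnC addnC mulnC gcdnMDl gcdn1.
have Hp : exact_level (p.-1 * (p * r)) p%:R.
  have -> : p%:R = \prod_(i < p | i != Ordinal p_gt0) (1 - w ^+ i) :> L.
    have nzX : ('X - 1 : {poly L}) != 0 by rewrite -size_poly_gt0 -[1]/(1%:P) size_XsubC.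
    have D : \prod_(i < p | i != Ordinal p_gt0) ('X - (w ^+ i)%:P) = \sum_(i < p) 'X^i.
      apply: (mulfI nzX); rewrite -subrX1 -(factor_Xn_sub_1 prim_w) big_mkord.
      by rewrite [RHS](bigD1 (Ordinal p_gt0)) //= expr0.
    have := congr1 (fun q : {poly L} => q.[1]) D; rewrite horner_prod horner_sum.
    have -> : \sum_(i < p) ('X^i : {poly L}).[1] = p%:R.
      rewrite (eq_bigr (fun=> 1)) => [|i _]; last by rewrite hornerXn expr1n.
      by rewrite sumr_const card_ord.
    by move=> <-; apply: eq_bigr => i _; rewrite !hornerE.
  have -> : (p.-1 * (p * r) = #|[pred i : 'I_p | i != Ordinal p_gt0]| * (p * r))%N.
    by rewrite cardC1 card_ord.
  apply: exact_level_prod => i; rewrite inE => ni; rewrite -opprB -mulrN1.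
  apply: (@exact_level_assoc _ _ _ (-1)); rewrite ?rpredN ?rpred1 ?mulrNN ?mulr1 //.
  apply: (exact_level_pow_sub1 p_gt0 w1 nw1) Hw.
  by rewrite coprime_sym prime_coprime // gtnNdvd ?ltn_ord // lt0n.
by rewrite (exact_level_uniq (ramidxP galL p_pr P) Hp) mulnCA dvdn_mulr.
Qed.

End WildCyclotomic.

Lemma cyclo_wild (L : splittingFieldType rat) n (z : L) p : n.-primitive_root z ->
  prime p -> (p ^ 2 %| n)%N -> ~ tamely_ramified L.
Proof.
move=> prim_z p_pr p2n tameL; have [P _] := prime_over_exists L p_pr.
have := (tamely_ramifiedP (galois_rat L)).1 tameL p p_pr P.
by rewrite coprime_sym prime_coprime // (wild_ramidx prim_z p_pr p2n).
Qed.

(** * Cyclotomic lattices *)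

Section CyclotomicGroup.
Variables (L : splittingFieldType rat) (n : nat) (z : L).
Local Notation gT := (gal_of {:L}).
Hypothesis prim_z : n.-primitive_root z.
Hypothesis gen_z : <<1; z>>%VS = {:L}%VS.

Lemma primitive_residue_cyclic a : primitive_residue n a -> cyclic_extension L.
Proof.
move=> [co_a gen_a]; split; first exact: galois_rat.
have z1 := prim_expr_order prim_z.
have [g Dg] := cyclo_gal_pow prim_z gen_z co_a; rewrite GalT.
apply/cyclicP; exists g; apply/eqP; rewrite eq_sym finset.eqEsubset finset.subsetT /=.
apply/fintype.subsetP=> h _; have [k co_k Dh] := gal_root_pow prim_z h.
have [j Dj] := gen_a k co_k; suffices -> : h = (g ^+ j)%g by apply: mem_cycle.
apply: (cyclo_gal_inj gen_z); rewrite (Dh z z1) (expr_inj_mod z1 Dj) galXx.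
elim: (j) => [|i IHi]; first by rewrite expn0 expr1.
by rewrite /= -IHi rmorphXn /= (Dg z z1) -exprM expnS.
Qed.

(** z |-> z^k and z |-> z^-1 are distinct involutions, and a cyclic group has at
    most one. *)
Lemma extra_sqrt1_not_cyclic k : (1 < n)%N -> extra_sqrt1 n k -> ~ cyclic_extension L.
Proof.
move=> n_gt1 [k2 k1 kN1] [_]; rewrite GalT => cycG.
have z1 := prim_expr_order prim_z.
have n_gt0 : (0 < n)%N by apply: ltnW.
have co_k : coprime k n.
  by rewrite -(@coprime_pexpl 2) // -coprime_modl k2 coprime_modl coprime1n.
have co_n1 : coprime n.-1 n by rewrite coprimePn.
have [g Dg] := cyclo_gal_pow prim_z gen_z co_k.
have [h Dh] := cyclo_gal_pow prim_z gen_z co_n1.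
have sq1 (f : gT) a : f z = z ^+ a -> a ^ 2 = 1 %[mod n] -> (f ^+ 2 = 1)%g.
  move=> Df a2; apply: (cyclo_gal_inj gen_z).
  by rewrite galXx /= Df rmorphXn /= Df -exprM mulnn (expr_inj_mod z1 a2) expr1 gal_id.
have nt (f : gT) a : f z = z ^+ a -> a <> 1 %[mod n] -> f != 1%g.
  move=> Df na; apply/eqP => f1; apply: na; apply/eqP.
  by rewrite -(eq_prim_root_expr prim_z) -Df f1 gal_id expr1.
have og : #[g]%g = 2%N by apply: nt_prime_order => //; [apply: sq1 (Dg z z1) k2 | apply: nt (Dg z z1) k1].
have oh : #[h]%g = 2%N.
  apply: nt_prime_order => //.
    by apply: sq1 (Dh z z1) _; rewrite sqr_predn // modnMDl.
  apply: nt (Dh z z1) _; rewrite !modn_small ?prednK // => n2.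
  have Dn : n = 2%N by rewrite -(prednK n_gt0) n2.
  by move: k2 k1; rewrite Dn !modn2 oddX /=; case: odd.
have : <[g]>%g == <[h]>%g.
  by rewrite (eq_subG_cyclic cycG) ?finset.subsetT // -!orderE og oh.
move=> /eqP Dgh; have : g \in <[h]>%g by rewrite -Dgh cycle_id.
rewrite cycle2g // !inE => /orP[/eqP g1|/eqP gh].
  by have := nt g k (Dg z z1) k1; rewrite g1 eqxx.
apply: kN1; have : z ^+ k == z ^+ n.-1 by rewrite -(Dg z z1) gh (Dh z z1).
rewrite (eq_prim_root_expr prim_z) => /eqP kn.
by rewrite -modnDml kn modnDml addn1 prednK // modnn mod0n.
Qed.

Lemma cyclotomic_cyclicP : (1 < n)%N -> cyclic_extension L <-> cyclotomic_cyclic n.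
Proof.
move=> n_gt1; split=> [cycL|/list_primitive_residue[a]]; last exact: primitive_residue_cyclic.
by have [//|[k /extra_sqrt1_not_cyclic[]]] := cyclotomic_list_or_root n_gt1.
Qed.

Lemma cyclotomic_normal_genP : (1 < n)%N -> cyclic_extension L ->
  (exists t : L, normal_gen t) <-> cyclotomic_simple n.
Proof.
move=> n_gt1 cycL; have list_n := (cyclotomic_cyclicP n_gt1).1 cycL.
split=> [[t normal_gen_t]|simp]; last first.
  by exists z; apply: (cyclo_normal_gen prim_z gen_z) => p p_pr; apply: simple_sqfree.
have [//|[p p_pr p2n]] := list_simple_or_square list_n.
have tameL : tamely_ramified L by apply: normal_gen_tame normal_gen_t; apply: cyclic_extension_abelian.
by have := cyclo_wild prim_z p_pr p2n tameL.
Qed.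

End CyclotomicGroup.

(** If zeta^k = 1 with 0 < k < n, the sine of pi k / n vanishes. *)
Lemma zeta_primitive (R : realType) n : (0 < n)%N -> n.-primitive_root (zeta R n).
Proof.
move=> n_gt0; set t := 2 * pi / n%:R : R.
have zetaX m : zeta R n ^+ m = (cos (t *+ m) +i* sin (t *+ m))%C.
  elim: m => [|m IHm]; first by rewrite expr0 !mulr0n cos0 sin0.
  rewrite exprSr IHm !mulrSr cosD sinD /zeta -/t.
  by apply/eqP; rewrite eq_complex /= eqxx /= addrC.
have [k prim_k dv_k] := prim_order_exists n_gt0 (zeta_expn R n_gt0).
suffices Dk : k = n by rewrite Dk in prim_k.
apply/eqP; rewrite eqn_leq dvdn_leq //= leqNgt; apply/negP => lt_kn.
have k_gt0 := prim_order_gt0 prim_k.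
have := prim_expr_order prim_k; rewrite zetaX => /eqP; rewrite eq_complex /= => /andP[/eqP c1 _].
pose x : R := pi * (k%:R / n%:R).
have Dx : t *+ k = x *+ 2.
  by rewrite /x /t -[LHS]mulr_natr -[RHS]mulr_natr; ring.
have n0 : 0 < n%:R :> R by rewrite ltr0n.
have x_itv : 0 < x < pi.
  rewrite mulr_gt0 ?pi_gt0 ?divr_gt0 ?ltr0n //= gtr_pMr ?pi_gt0 //.
  by rewrite ltr_pdivrMr // mul1r ltr_nat.
have := sin_gt0_pi x_itv; have := cos2Dsin2 x; move: c1; rewrite Dx cos_mulr2n.
move: (cos x) (sin x) => c s; rewrite mulr2n => h1 h2 h3; nra.
Qed.

Lemma cyclotomic_splitting (K : fieldExtType rat) n (z : K) : n.-primitive_root z ->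
  <<1; z>>%VS = {:K}%VS -> SplittingField.axiom K.
Proof.
move=> prim_z gen_z; exists ('X^n - 1); first by rewrite rpredB ?rpred1 ?rpredX ?polyOverX.
pose r := codom (fun i : 'I_n => z ^+ i).
have Dr : 'X^n - 1 = \prod_(y <- r) ('X - y%:P).
  by rewrite -(factor_Xn_sub_1 prim_z) big_mkord big_image.
exists r; first by rewrite -Dr eqpxx.
apply/eqP; rewrite eqEsubv subvf -gen_z -adjoin_seq1 adjoin_seqSr //; apply/allP=> /=.
rewrite andbT; apply/codomP; have n_gt0 := prim_order_gt0 prim_z.
by exists (Ordinal (ltn_pmod 1 n_gt0)); rewrite /= (prim_expr_mod prim_z) expr1.
Qed.

Theorem theorem1p4 (R : realType) :
  (forall K : splittingFieldType rat, galois 1%VS {:K} ->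
     (for_appropriate_ordering (K := K) (R := R) (@cyclic_lattice _ _)
        <-> cyclic_extension K) /\
     (cyclic_extension K ->
        (for_appropriate_ordering (K := K) (R := R) (@simple_cyclic_lattice _ _)
           <-> tamely_ramified K))) /\
  (forall (n : nat) (K : fieldExtType rat),
     (2 <= n)%N -> is_cyclotomic_field R n K ->
     (for_appropriate_ordering (K := K) (R := R) (@cyclic_lattice _ _)
        <-> n = 2%N \/ n = 4%N \/
            exists p k : nat, [/\ prime p, odd p, (1 <= k)%N &
                                  n = (p ^ k)%N \/ n = (2 * p ^ k)%N]) /\
     (for_appropriate_ordering (K := K) (R := R) (@simple_cyclic_lattice _ _)
        <-> n = 2%N \/
            exists p : nat, [/\ prime p, odd p & n = p \/ n = (2 * p)%N])).
Proof.
split=> [K _|n K n_gt1 [iota [z [iota_z gen_z]]]].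
  split=> [|cycK]; first exact: cyclic_latticeP.
  by rewrite (simple_cyclic_latticeP R cycK); apply: normal_gen_tameP.
have prim_z : n.-primitive_root z.
  by rewrite -(fmorph_primitive_root iota) iota_z; apply/zeta_primitive/ltnW.
have K_ax : FieldExt_isSplittingField _ K by constructor; exact: (cyclotomic_splitting prim_z gen_z).
pose L : splittingFieldType rat := HB.pack_for (splittingFieldType rat) K K_ax.
have cycP : for_appropriate_ordering (K := L) (R := R) (@cyclic_lattice _ _)
    <-> cyclotomic_cyclic n.
  by rewrite cyclic_latticeP; apply: (cyclotomic_cyclicP (L := L) prim_z gen_z).
have simpP : for_appropriate_ordering (K := L) (R := R) (@simple_cyclic_lattice _ _)
    <-> cyclotomic_simple n.
  split=> [simp|simp].
    have cycL : cyclic_extension L.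
      by apply/(cyclic_latticeP R); case: simp => s ord_s [cyc_s _]; exists s.
    apply/(cyclotomic_normal_genP (L := L) prim_z gen_z n_gt1 cycL).
    exact/(simple_cyclic_latticeP R cycL).
  have cycL : cyclic_extension L.
    by apply/(cyclotomic_cyclicP (L := L) prim_z gen_z n_gt1)/simple_cyclic_list.
  apply/(simple_cyclic_latticeP R cycL).
  exact/(cyclotomic_normal_genP (L := L) prim_z gen_z n_gt1 cycL).
by split; [exact: cycP | exact: simpP].
Qed.
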